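(* Let $\varepsilon',\delta>0$ be real numbers with $\delta$ sufficiently small in terms of $\varepsilon'$. Then there is a constant $c_\delta>0$, depending only on $\delta$, such that the following holds. Let $A\subset\mathbb{Z}$ be a finite, non-empty set such that $|A+A|\le(4+\delta)|A|$. Then one of the following must hold. (1) There exists a $1$-dimensional progression $P\subseteq\mathbb{Z}$ with $|P|\ge c_\delta|A|$ such that $\frac{|A\cap P|}{|P|}\ge \frac12-\varepsilon'$. (2) There exists a proper $2$-dimensional progression $Q\subseteq\mathbb{Z}$ with $|Q|\ge c_\delta|A|$ such that $\frac{|A\cap Q|}{|Q|}\ge 1-\varepsilon'$. Moreover, the same conclusion holds if the hypothesis $|A+A|\le(4+\delta)|A|$ is replaced by $|A-A|\le(4+\delta)|A|$.
   Context: $A+A=\{a+a':a,a'\in A\}$ and $A-A=\{a-a':a,a'\in A\}$. For $d\in\mathbb{N}$, a $d$-dimensional progression is a set of the form $P=\{a_0+l_1a_1+\dots+l_da_d: 1\le l_i\le L_i,\ l_i \in \mathbb{Z}\ (1\le i\le d)\}$ with $a_0,\dots,a_d\in\mathbb{Z}$ and $L_1,\dots,L_d\in\mathbb{N}$ (positive integers); it is proper if $|P|=L_1L_2\cdots L_d$. ''$\delta$ sufficiently small in terms of $\varepsilon'$'' means $0<\delta\le\delta_0(\varepsilon')$ for some $\delta_0(\varepsilon')>0$ depending only on $\varepsilon'$. *)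

(* Defs.v *)
From mathcomp Require Import all_boot all_order all_algebra.
From mathcomp Require Import finmap reals.

Set Implicit Arguments.
Unset Strict Implicit.
Unset Printing Implicit Defensive.

Import Order.TTheory GRing.Theory Num.Theory.

Local Open Scope ring_scope.

Definition sumset (A B : {fset int}) : {fset int} :=
  [fset (a + b)%R | a in A, b in B]%fset.

Definition diffset (A B : {fset int}) : {fset int} :=
  [fset (a - b)%R | a in A, b in B]%fset.

Definition progression_with (d : nat) (a0 : int) (a : 'I_d -> int)
    (L : 'I_d -> nat) (P : {fset int}) : Prop :=
  (forall i, (0 < L i)%N) /\
  (forall x : int, x \in P <->
     exists2 l : 'I_d -> int,
       forall i, 1 <= l i <= (L i)%:Z & x = a0 + \sum_(i < d) l i * a i).

Definition is_progression (d : nat) (P : {fset int}) : Prop :=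
  exists (a0 : int) (a : 'I_d -> int) (L : 'I_d -> nat),
    progression_with a0 a L P.

(* Properness refers to a presentation (a0, a, L) of the set P; a set is called
   proper when it has some presentation with all the sums distinct. *)
Definition is_proper_progression (d : nat) (P : {fset int}) : Prop :=
  exists (a0 : int) (a : 'I_d -> int) (L : 'I_d -> nat),
    progression_with a0 a L P /\ #|` P| = (\prod_(i < d) L i)%N.

Definition density (R : realType) (A P : {fset int}) : R :=
  #|` (A `&` P)%fset|%:R / #|` P|%:R.

Definition dense_on_progression (R : realType) (c eps : R) (A : {fset int}) :
    Prop :=
  (exists P : {fset int},
     [/\ is_progression 1 P,
         c * #|` A|%:R <= #|` P|%:R
       & 1 / 2 - eps <= density R A P])
  \/
  (exists Q : {fset int},
     [/\ is_proper_progression 2 Q,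
         c * #|` A|%:R <= #|` Q|%:R
       & 1 - eps <= density R A Q]).

(* Main.v *)
(** Write B for A or -A, so that |A + B| <= (4 + delta)|A|. In a large cyclic group
    containing A and B, Croot-Sisask almost periodicity and a regularity argument
    yield a symmetric set C with |C| >= c|A| and chains U_0, ..., U_r and V_0, ..., V_r
    with U_j + C inside U_(j+1) and V_j + C inside V_(j+1), such that U_r + V_r is
    hardly larger than A + B while U_0 and V_0 carry almost all the mass of smoothed
    indicators a of A and b of B.

    Back on the integers, restrict to residue classes so that C has gcd 1, put
    L = max C and cut Z into windows of length J L. Chains of this length make
    U_r + V_r fill, in the window sum of the k-th and l-th windows, all integers with
    residue modulo L in E + 2C + F, where E and F are the residues of U_0 and V_0 in
    these windows. If no window has mass close to half its length, which would be
    alternative (1), then the one-dimensional Prekopa-Leindler inequality for the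
    window masses says that |U_r + V_r| is at least about 4|A|, and near-equality
    produces a pair of windows with |E + 2C + F| <= (1 + o(1))(|E| + |F|) on which a is
    nearly 1 on E.

    In Z/L such a critical pair is rigid. Submodularity shrinks F to a tiny set B0, so
    that translation by elements of B0 + C barely changes E, while the iterates of
    B0 + C grow linearly; a Fourier argument rectifies them, and a small-doubling
    argument in Z/L x Z/(LY) shows that E is almost invariant under a set
    {i v + h : i < I, h in H} with H a subgroup and I|H| comparable to |E|. The
    integers of size at most L with residue in this set contain a large proper
    two-dimensional progression, and averaging a over its translates gives
    alternative (2). *)
Require Import Defs.
From HB Require Import structures.
From mathcomp Require Import all_boot all_order all_algebra.
From mathcomp Require Import finmap reals.
From mathcomp Require Import trigo.
From mathcomp Require boolp.
From mathcomp Require Import zify ring lra.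

Set Implicit Arguments.
Unset Strict Implicit.
Unset Printing Implicit Defensive.

Import Order.TTheory GRing.Theory Num.Theory.

Local Open Scope ring_scope.

(** * Sumsets in finite abelian groups *)

(** The constant 4 is a product of two doublings. Residues give |E + 2C + F| >= |E| + |F| as long as
    |E| + |F| stays below L, which is why windows of mass close to half are set apart. Window
    indices give the other one: windows k and l add up to parts of the windows k + l and k + l + 1,
    and normalising by the largest masses mu, mu' leaves (mu + mu')^2 >= 4 mu mu'. A generating C
    removes the obstruction by subgroups, so a bound of Cauchy-Davenport type holds in every Z/L.
    Two copies of C are carried: one is spent on this bound, the other on |F + C| <= |F| + x, the
    continuity that lets F shrink. Reducing a set modulo its own length, as in Freiman's 3k-3
    theorem, turns doubling 41/20 into about 21/20, and below 3/2 the difference set is a subgroup.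
    Constants are chosen in the order eps, J, d0, eta, c: J bounds the loss at the ends of blocks
    and fixes the chain length J + 2 before the smooth model is built. Since c_delta may depend on
    delta only, while the argument yields one constant per eps, the end of the proof makes a
    diagonal choice over eps = 1/(n + 1). *)

Section Sumsets.
Variable G : finComNzRingType.
Implicit Types (A B C D X Y Z : {set G}) (x y t : G).

(** The group is the additive group of a finite commutative ring: the instances are Z/L and Z/L x
    Z/(LY), and [ring] settles the additive identities. *)
Definition sadd A B : {set G} := [set a + b | a in A, b in B].

Definition sdiff A B : {set G} := [set a - b | a in A, b in B].

Fixpoint smul (i : nat) B : {set G} :=
  if i is j.+1 then sadd (smul j B) B else [set 0].

Lemma saddP A B x :
  reflect (exists a b, [/\ a \in A, b \in B & x = a + b]) (x \in sadd A B).
Proof.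
apply: (iffP imset2P) => [[a b aA bB ->]|[a [b [aA bB ->]]]]; last by exists a b.
by exists a, b.
Qed.

Lemma mem_sadd A B x y : x \in A -> y \in B -> x + y \in sadd A B.
Proof. by move=> xA yB; apply/saddP; exists x, y. Qed.

Lemma saddC A B : sadd A B = sadd B A.
Proof. by apply/setP => x; apply/saddP/saddP => -[a [b [? ? ->]]]; exists b, a; rewrite addrC. Qed.

Lemma saddA A B C : sadd A (sadd B C) = sadd (sadd A B) C.
Proof.
apply/setP => x; apply/saddP/saddP.
  move=> [a [_ [aA /saddP [b [c [bB cC ->]]] ->]]].
  by exists (a + b), c; rewrite addrA mem_sadd.
move=> [_ [c [/saddP [a [b [aA bB ->]]] cC ->]]].
by exists a, (b + c); rewrite addrA mem_sadd.
Qed.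

Lemma saddS A B C D : A \subset C -> B \subset D -> sadd A B \subset sadd C D.
Proof.
move=> /subsetP AC /subsetP BD; apply/subsetP => x /saddP [a [b [aA bB ->]]].
by rewrite mem_sadd ?AC ?BD.
Qed.

Lemma sadd0 A : sadd A [set 0] = A.
Proof.
apply/setP => x; apply/saddP/idP => [[a [b [aA /set1P -> ->]]]|xA].
  by rewrite addr0.
by exists x, 0; rewrite addr0 set11.
Qed.

Lemma sub_saddr A B : 0 \in B -> A \subset sadd A B.
Proof. by move=> B0; apply/subsetP => x xA; rewrite -[x]addr0 mem_sadd. Qed.

Lemma sadd1P t A x : (x \in sadd [set t] A) = (x - t \in A).
Proof.
apply/saddP/idP => [[a [b [/set1P -> bA ->]]]|xA].
  by rewrite addrC addKr.
by exists t, (x - t); rewrite set11 xA addrC subrK.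
Qed.

Lemma card_sadd1 t A : #|sadd [set t] A| = #|A|.
Proof.
rewrite -(card_imset (mem A) (@addrI _ t)); apply: eq_card => x.
rewrite sadd1P; apply/idP/imsetP => [xA|[y yA ->]]; last by rewrite addrC addKr.
by exists (x - t); rewrite // addrC subrK.
Qed.

Lemma sadd_neq0 A B : A != set0 -> B != set0 -> sadd A B != set0.
Proof.
by move=> /set0Pn [a aA] /set0Pn [b bB]; apply/set0Pn; exists (a + b); rewrite mem_sadd.
Qed.

Lemma card_sadd_ge A B : B != set0 -> (#|A| <= #|sadd A B|)%N.
Proof.
move=> /set0Pn [b bB]; rewrite -(card_sadd1 b A); apply: subset_leq_card.
by rewrite [sadd A B]saddC saddS // sub1set.
Qed.

Lemma sadd1_sub A B b : b \in B -> sadd [set b] A \subset sadd A B.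
Proof. by move=> bB; rewrite [sadd A B]saddC saddS // sub1set. Qed.

Lemma card_sadd_le A B : (#|sadd A B| <= #|A| * #|B|)%N.
Proof. by rewrite -cardsX /sadd curry_imset2X leq_imset_card. Qed.

Lemma saddU A B C : sadd A (B :|: C) = sadd A B :|: sadd A C.
Proof.
apply/setP => x; rewrite inE; apply/saddP/orP.
  by move=> [a [b [aA /setUP [bB|bB] ->]]]; [left|right]; rewrite mem_sadd.
by move=> [|] /saddP [a [b [aA bB ->]]]; exists a, b; rewrite inE bB ?orbT.
Qed.

Lemma smul1 B : smul 1 B = B.
Proof. by rewrite /= saddC sadd0. Qed.

Lemma smulD i j B : smul (i + j) B = sadd (smul i B) (smul j B).
Proof.
elim: j => [|j IH]; first by rewrite addn0 /= sadd0.
by rewrite addnS /= IH saddA.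
Qed.

Lemma smul_0in i B : 0 \in B -> 0 \in smul i B.
Proof.
move=> B0; elim: i => [|i IH] /=; first by rewrite set11.
by rewrite -(addr0 0) mem_sadd.
Qed.

Lemma smul_sub i j B : 0 \in B -> (i <= j)%N -> smul i B \subset smul j B.
Proof. by move=> B0 ij; rewrite -(subnKC ij) smulD sub_saddr // smul_0in. Qed.

Lemma smul_neq0 i B : B != set0 -> smul i B != set0.
Proof.
move=> B0; elim: i => [|i IH] /=; last exact: sadd_neq0.
by apply/set0Pn; exists 0; rewrite set11.
Qed.

(** Stability under adding [D] is tested on arbitrary sets containing 0, not only on subgroups; in a
    finite group this still says that [D] generates the group. *)
Definition generating D := forall H : {set G}, 0 \in H -> sadd H D \subset H -> H = setT.

Lemma sub_generating D X : generating D -> X != set0 -> sadd X D \subset X -> X = setT.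
Proof.
move=> gD /set0Pn [x xX] XD.
have -> : X = sadd [set x] (sadd [set - x] X).
  rewrite saddA; apply/setP => z; apply/idP/saddP => [zX|].
    by exists 0, z; rewrite add0r zX; split => //; apply/saddP; exists x, (- x); rewrite !set11 subrr.
  by move=> [a [b [/saddP [u [v [/set1P -> /set1P -> ->]]] bX ->]]]; rewrite subrr add0r.
rewrite (gD (sadd [set - x] X)).
- by apply/setP => z; rewrite sadd1P !inE.
- by rewrite sadd1P opprK add0r.
by rewrite -saddA saddS.
Qed.

(* The Dyson e-transform: a pair with smallest second set satisfies
   [X + Y - Y <= X], so [X] is a union of cosets of the group spanned by [Y - Y]. *)
Lemma card_sadd_generating D X Y : 0 \in D -> generating D ->
  X != set0 -> Y != set0 -> (minn #|G| (#|X| + #|Y|) <= #|sadd (sadd X Y) D|)%N.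
Proof.
move=> D0 gD; move: {2}#|Y| (leqnn #|Y|) => n.
elim: n X Y => [|n IH] X Y; first by rewrite leqn0 cards_eq0 => /eqP-> _ /eqP.
move=> Yn X0 Y0.
case: (boolP [exists x in X, exists y in Y, exists z in Y, x - y + z \notin X]).
  move=> /exists_inP [x xX /exists_inP [y yY /exists_inP [z zY nX]]].
  set e := x - y.
  set X' := X :|: sadd [set e] Y; set Y' := Y :&: sadd [set - e] X.
  have yY' : y \in Y' by rewrite inE yY sadd1P opprK /e addrC subrK.
  have cXY : (#|X'| + #|Y'| = #|X| + #|Y|)%N.
    have -> : #|Y'| = #|X :&: sadd [set e] Y|.
      rewrite -(card_sadd1 e Y'); apply: eq_card => u.
      rewrite sadd1P !inE !sadd1P opprK andbC; congr (_ && _); congr (_ \in X); ring.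
    by rewrite /X' cardsUI card_sadd1.
  have lt : (#|Y'| < #|Y|)%N.
    apply: proper_card; rewrite properE subsetIl; apply/subsetPn; exists z => //.
    by rewrite inE zY sadd1P opprK /= addrC -/e in nX *.
  have := IH X' Y'; rewrite cXY => h; apply: leq_trans (h _ _ _) _ => //.
  - by rewrite -ltnS; apply: leq_trans lt Yn.
  - by apply/set0Pn; case/set0Pn: X0 => u uX; exists u; rewrite inE uX.
  - by apply/set0Pn; exists y.
  apply: subset_leq_card; apply: saddS => //; apply/subsetP => u /saddP [a [b [aX bY ->]]].
  move: aX bY; rewrite !inE !sadd1P opprK => /orP [aX|aY] /andP [bY bX].
    by rewrite mem_sadd.
  by rewrite (_ : a + b = (b + e) + (a - e)); [rewrite mem_sadd|ring].
move=> nex.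
have inX x y z : x \in X -> y \in Y -> z \in Y -> x - y + z \in X.
  move=> xX yY zY; apply: contraNT nex => nX.
  by apply/exists_inP; exists x => //; apply/exists_inP; exists y => //; apply/exists_inP; exists z.
case/set0Pn: (Y0) => y0 y0Y.
case: (boolP (sadd X D \subset X)) => XD.
  have XT := sub_generating gD X0 XD.
  rewrite geq_min; apply/orP; left.
  rewrite -cardsT -XT; apply: leq_trans (card_sadd_ge _ Y0) _; apply: card_sadd_ge.
  by apply/set0Pn; exists 0.
rewrite geq_min; apply/orP; right.
case/subsetPn: XD => u /saddP [x [d [xX dD ->]]] nX.
(* Periodicity of [X] under [Y - Y] spreads the escape of [x + d] to the whole translate
   [x + d + Y]: it misses [y0 + X], and both lie in [X + Y + D]. *)
have dis : [disjoint sadd [set y0] X & sadd [set x + d] Y].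
  rewrite -setI_eq0; apply/eqP/setP => w; rewrite !inE !sadd1P.
  apply/negP => /andP [h1 h2]; case/negP: nX.
  rewrite (_ : x + d = (w - y0) - (w - (x + d)) + y0); [exact: inX|ring].
rewrite -(card_sadd1 y0 X) -(card_sadd1 (x + d) Y).
move: dis; rewrite -leq_card_setU => /eqP <-; apply: subset_leq_card; apply/subUsetP; split.
  by apply: subset_trans (sadd1_sub _ y0Y) _; exact: sub_saddr.
apply/subsetP => w; rewrite sadd1P => wY.
by rewrite (_ : w = x + (w - (x + d)) + d); [rewrite !mem_sadd|ring].
Qed.

(* Petridis: for a subset minimizing [|X + B| / |X|], adding [C] does not
   increase the ratio. *)
Lemma petridis_step B X : X != set0 ->
  (forall Z, Z \subset X -> #|sadd X B| * #|Z| <= #|sadd Z B| * #|X|)%N ->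
  forall C, (#|sadd (sadd X C) B| * #|X| <= #|sadd X B| * #|sadd X C|)%N.
Proof.
move=> X0 min C; move: {2}#|C| (leqnn #|C|) => n; elim: n C => [|n IH] C.
  rewrite leqn0 cards_eq0 => /eqP ->.
  have -> : sadd X set0 = set0.
    by apply/setP => x; rewrite inE; apply/negP => /saddP [a [b [_]]]; rewrite inE.
  have -> : sadd set0 B = set0.
    by apply/setP => x; rewrite inE; apply/negP => /saddP [a [b []]]; rewrite inE.
  by rewrite cards0.
case: (set_0Vmem C) => [-> _|[c cC] Cn]; first by apply: IH; rewrite cards0.
set C' := C :\ c.
have {}Cn : (#|C'| <= n)%N by move: Cn; rewrite (cardsD1 c) cC.
have CE : C = C' :|: [set c] by rewrite setUC setD1K.
have := IH _ Cn; set P := sadd X C' => IHP.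
(* For these [x] the translate [x + c + B] is already covered, so only [X] minus [Y] creates new
   sums; minimality bounds |Y + B| from below. *)
set Y := [set x in X | sadd [set x + c] B \subset sadd P B].
have YX : Y \subset X by apply/subsetP => x; rewrite inE => /andP [].
have h1 : (#|sadd (sadd X C) B| + #|sadd Y B| <= #|sadd P B| + #|sadd X B|)%N.
  rewrite -(card_sadd1 c (sadd Y B)) -(card_sadd1 c (sadd X B)).
  have -> : sadd (sadd X C) B = sadd P B :|: sadd [set c] (sadd X B).
    by rewrite CE saddU -/P saddC saddU ![sadd B _]saddC [sadd X [set c]]saddC saddA.
  rewrite -[X in (_ <= X)%N]cardsUI leq_add2l; apply: subset_leq_card.
  apply/subsetP => w; rewrite inE => hw; apply/andP; split; last first.
    by apply: (subsetP (saddS (subxx _) (saddS YX (subxx _)))).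
  move: hw; rewrite sadd1P => /saddP [y [b []]]; rewrite inE => /andP [yX /subsetP h] bB E.
  apply: h; apply/saddP; exists (y + c), b; split; rewrite ?set11 //.
  by rewrite -[w](subrK c) E; ring.
have h2 : (#|P| + #|X| <= #|sadd X C| + #|Y|)%N.
  rewrite CE saddU -/P -(card_sadd1 c X) -(card_sadd1 c Y) [sadd X [set c]]saddC -cardsUI leq_add2l.
  apply: subset_leq_card; apply/subsetP => w; rewrite inE !sadd1P inE => /andP [wP wX].
  by rewrite wX subrK saddS // sub1set.
have := min _ YX; move: IHP h1 h2.
nia.
Qed.

Lemma petridis B E : E != set0 -> exists X, [/\ X != set0, X \subset E,
    (#|sadd X B| * #|E| <= #|sadd E B| * #|X|)%N &
    forall C, (#|sadd (sadd X C) B| * #|X| <= #|sadd X B| * #|sadd X C|)%N].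
Proof.
move=> E0.
pose P (X : {set G}) := (X != set0) && (X \subset E).
pose better (X Z : {set G}) := (#|sadd X B| * #|Z| <= #|sadd Z B| * #|X|)%N.
suff [X [X0 XE Xm]] : exists X, [/\ X != set0, X \subset E &
     forall Z, Z \subset E -> better X Z].
  exists X; split => //; first exact: (Xm _ (subxx _)).
  by apply: petridis_step => // Z ZX; apply: Xm; apply: subset_trans XE.
pose f (X : {set G}) : rat := #|sadd X B|%:R / #|X|%:R.
have PE : P E by rewrite /P E0 subxx.
case: (Order.TotalTheory.arg_minP f PE) => X /andP [X0 XE] h.
exists X; split => // Z ZE; rewrite /better.
case: (eqVneq Z set0) => [->|Z0]; first by rewrite cards0 muln0.
have := h Z; rewrite /P Z0 ZE => /(_ isT).
rewrite /f ler_pdivrMr ?ltr0n ?card_gt0 // mulrAC ler_pdivlMr ?ltr0n ?card_gt0 //.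
by rewrite -!natrM ler_nat.
Qed.

(** Fix a representation d = a - b of each difference and send (d, x) to (x + a, x + b): the
    difference of the two coordinates recovers d, and then x. *)
Lemma ruzsa_triangle X A B :
  (#|sdiff A B| * #|X| <= #|sadd X A| * #|sadd X B|)%N.
Proof.
set D := sdiff A B.
have dP d : d \in D -> exists p : G * G, [&& p.1 \in A, p.2 \in B & d == p.1 - p.2].
  by move=> /imset2P [a b aA bB ->]; exists (a, b); rewrite aA bB eqxx.
pose r (d : G) : G * G := odflt (0, 0) [pick p : G * G | [&& p.1 \in A, p.2 \in B & d == p.1 - p.2]].
have rP d : d \in D -> [/\ (r d).1 \in A, (r d).2 \in B & d = (r d).1 - (r d).2].
  move=> /dP [p hp]; rewrite /r; case: pickP => [q /and3P [h1 h2 /eqP h3]|/(_ p)] //=.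
  by rewrite hp.
rewrite -[X in (_ * X)%N]/(#|X|) -!cardsX.
pose g (p : G * G) := (p.2 + (r p.1).1, p.2 + (r p.1).2).
have gi : {in setX D X &, injective g}.
  move=> [d x] [d' x']; rewrite !inE /= => /andP [/rP [_ _ h] _] /andP [/rP [_ _ h'] _] [e1 e2].
  have dd : d = d' by rewrite h h' -[LHS](addrKA x) -[RHS](addrKA x') ![_ + x]addrC ![_ + x']addrC e1 e2.
  by move: e1; rewrite dd => /addIr ->.
rewrite -(card_in_imset gi); apply: subset_leq_card; apply/subsetP => _ /imsetP [[d x] /setXP [/rP [h1 h2 _] xX] ->].
by rewrite inE /= !mem_sadd.
Qed.

(** Petridis's inequality with [C := smul i B], iterated: one subset [X] serves all [i]. Powers of
    |E| are multiplied out to stay in nat. *)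
Lemma petridis_smul B E : E != set0 -> exists X, [/\ X != set0, X \subset E &
  forall i, (#|sadd X (smul i B)| * #|E| ^ i <= #|sadd E B| ^ i * #|X|)%N].
Proof.
move=> E0; have [X [X0 XE h hC]] := petridis B E0.
exists X; split => //; elim => [|i IH]; first by rewrite /= sadd0 !expn0 mul1n muln1.
have := hC (smul i B); rewrite -saddA -[sadd (smul i B) B]/(smul i.+1 B) => hi.
have Xp : (0 < #|X|)%N by rewrite card_gt0.
rewrite -(leq_pmul2r Xp) !expnS.
have h1 := leq_mul hi (leqnn (#|E| * #|E| ^ i)%N).
have h2 := leq_mul h IH.
nia.
Qed.

(* Every element of [X - X] has more than [|X| / 2] representations, so two
   such differences share a summand. *)
Lemma small_doubling_subgroup X : X != set0 -> (2 * #|sadd X X| < 3 * #|X|)%N ->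
  let H := sdiff X X in
  [/\ 0 \in H, {in H &, forall a b, a - b \in H} &
      (#|H| * (2 * #|X| - #|sadd X X|) <= #|X| ^ 2)%N].
Proof.
move=> X0 hX H.
pose rep (d : G) := [set x in X | x - d \in X].
have repP d : d \in H -> (2 * #|X| - #|sadd X X| <= #|rep d|)%N.
  move=> /imset2P [a b aX bX ->].
  have := cardsUI (sadd [set b] X) (sadd [set a] X).
  rewrite !card_sadd1.
  have : (#|sadd [set b] X :|: sadd [set a] X| <= #|sadd X X|)%N.
    by apply: subset_leq_card; rewrite subUset !sadd1_sub.
  have -> : #|sadd [set b] X :&: sadd [set a] X| = #|rep (a - b)|.
    rewrite -(card_sadd1 b (rep _)); apply: eq_card => u.
    by rewrite !inE !sadd1P !inE; congr (_ && (_ \in X)); ring.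
  lia.
have X0' : (0 < #|X|)%N by rewrite card_gt0.
split.
- by case/set0Pn: X0 => x xX; apply/imset2P; exists x x; rewrite ?subrr.
- move=> d e /repP hd /repP he.
  have hU : (#|rep d :|: rep e| <= #|X|)%N.
    by apply: subset_leq_card; apply/subsetP => u; rewrite !inE => /orP [] /andP [].
  have : (0 < #|rep d :&: rep e|)%N by have := cardsUI (rep d) (rep e); lia.
  rewrite card_gt0 => /set0Pn [u]; rewrite !inE => /andP [/andP [uX ud] /andP [_ ue]].
  by apply/imset2P; exists (u - e) (u - d) => //; ring.
(* Pairs (d, x) with x and x - d in [X] inject into [X * X], and each d in [H] occurs at least 2|X|
   - |X + X| times. *)
pose P := [set p : G * G | (p.1 \in H) && (p.2 \in rep p.1)].
have hP : #|P| = (\sum_(d in H) #|rep d|)%N.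
  rewrite -sum1_card (eq_bigl (fun p : G * G => (p.1 \in H) && (p.2 \in rep p.1))); last by move=> p; rewrite inE.
  rewrite -(pair_big_dep (mem H) (fun d x => x \in rep d) (fun _ _ => 1%N)) /=.
  by apply: eq_bigr => d _; rewrite sum1_card.
have h1 : (#|H| * (2 * #|X| - #|sadd X X|) <= #|P|)%N.
  by rewrite hP -sum_nat_const; apply: leq_sum => d /repP.
apply: leq_trans h1 _; rewrite -mulnn -cardsX.
have gi : injective (fun p : G * G => (p.2, p.2 - p.1)).
  by move=> [d x] [d' x'] [-> /addrI /oppr_inj ->].
rewrite -(card_imset _ gi); apply: subset_leq_card; apply/subsetP => _ /imsetP [[d x] + ->].
by rewrite !inE /= => /andP [_].
Qed.

End Sumsets.

(** * Almost periodicity *)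

Ltac le_ring := rewrite le_eqVlt; apply/orP; left; apply/eqP; ring.

Section CrootSisask.
Variables (R : realFieldType) (G : finComNzRingType) (I : finType).
Implicit Types (S T Z : {set G}) (h : G -> R) (f : I -> G -> R).

(** Samples are nested pairs rather than functions, so that a sum over samples splits off one
    coordinate at a time. *)
Fixpoint power k : finType := if k is j.+1 then (G * power j)%type : finType else unit.

Fixpoint power_on S k : power k -> bool :=
  if k is j.+1 then fun z => (z.1 \in S) && power_on S z.2 else fun=> true.

Fixpoint power_sum h k : power k -> R :=
  if k is j.+1 then fun z => h z.1 + power_sum h z.2 else fun=> 0.

Fixpoint power_shift (t : G) k : power k -> power k :=
  if k is j.+1 then fun z => (z.1 + t, power_shift t z.2) else id.

Lemma sum_power (V : nmodType) S k (phi : power k.+1 -> V) :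
  \sum_(z : power k.+1 | power_on S z) phi z =
  \sum_(s in S) \sum_(z : power k | power_on S z) phi (s, z).
Proof.
rewrite (pair_big_dep (mem S) (fun s (z : power k) => power_on S z) (fun s z => phi (s, z))) /=.
by apply: eq_bigr => -[].
Qed.

Lemma card_power_on S k : (#|[pred z : power k | power_on S z]| = #|S| ^ k)%N.
Proof.
have E j : #|[pred z : power j | power_on S z]| = (\sum_(z : power j | power_on S z) 1)%N.
  by rewrite sum1_card.
elim: k => [|k IH]; first by rewrite expn0 E (bigD1 tt) //= big1 // => -[].
rewrite E (sum_power S (fun=> 1%N : nat)) expnS -sum_nat_const.
by apply: eq_bigr => s _; rewrite -E.
Qed.

Lemma power_shift_on S Z t k (z : power k) :
  t \in Z -> power_on S z -> power_on (sadd S Z) (power_shift t z).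
Proof.
move=> tZ; elim: k z => [|k IH] //= [s z] /= /andP [sS /IH ->].
by rewrite mem_sadd.
Qed.

Lemma power_shiftK t k : cancel (@power_shift t k) (@power_shift (- t) k).
Proof. by elim: k => [|k IH] //= [s z] /=; rewrite IH addrK. Qed.

Lemma power_sum_shift h t k (z : power k) :
  power_sum h (power_shift t z) = power_sum (fun x => h (x + t)) z.
Proof. by elim: k z => [|k IH] //= [s z] /=; rewrite IH. Qed.

Lemma eq_power_sum h h' k (z : power k) : h =1 h' -> power_sum h z = power_sum h' z.
Proof. by move=> e; elim: k z => [|k IH] //= [s z] /=; rewrite IH e. Qed.

Lemma power_sumB h (m : R) k (z : power k) :
  power_sum (fun x => h x - m) z = power_sum h z - k%:R * m.
Proof.
elim: k z => [|k IH] /=; first by rewrite mul0r subr0.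
by move=> [s z] /=; rewrite IH -natr1; ring.
Qed.

(** The cross terms vanish because [h] has mean zero, so the variance of [k] independent samples is
    [k] times that of one. *)
Lemma variance S h k : \sum_(s in S) h s = 0 ->
  \sum_(z : power k | power_on S z) power_sum h z = 0 /\
  #|S|%:R * (\sum_(z : power k | power_on S z) power_sum h z ^+ 2) =
    k%:R * #|S|%:R ^+ k * \sum_(s in S) h s ^+ 2.
Proof.
move=> h0; elim: k => [|k [IH1 IH2]].
  split; first by rewrite big1.
  by rewrite big1 ?mulr0 ?mul0r // => z _; rewrite /= expr0n.
split.
  rewrite sum_power /=.
  under eq_bigr => s _ do rewrite big_split /= IH1 addr0 sumr_const.
  by rewrite sumrMnl h0 mul0rn.
rewrite sum_power /=.
have -> : \sum_(s in S) \sum_(z : power k | power_on S z) (h s + power_sum h z) ^+ 2 =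
   \sum_(s in S) (#|S|%:R ^+ k * h s ^+ 2 + \sum_(z : power k | power_on S z) power_sum h z ^+ 2).
  apply: eq_bigr => s _.
  transitivity (\sum_(z : power k | power_on S z) (h s ^+ 2 + (h s *+ 2) * power_sum h z + power_sum h z ^+ 2)).
    by apply: eq_bigr => z _; ring.
  have e : \sum_(z : power k | power_on S z) (h s *+ 2) * power_sum h z = 0.
    by rewrite -mulr_sumr IH1 mulr0.
  rewrite 2!big_split /= e addr0 sumr_const card_power_on.
  by congr (_ + _); rewrite -[LHS]mulr_natl natrX.
rewrite big_split /= -mulr_sumr sumr_const mulrDr -[X in _ + _ * X]mulr_natl IH2 exprS -natr1.
ring.
Qed.

(** The index [I] lets one set of almost periods serve a whole family of functions; the L2 norm is
    summed over the family. *)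
Definition sqnorm f : R := \sum_i \sum_x f i x ^+ 2.

Definition averaged S f : I -> G -> R := fun i x => (\sum_(s in S) f i (x - s)) / #|S|%:R.

Lemma sqnorm_ge0 f : 0 <= sqnorm f.
Proof. by apply: sumr_ge0 => i _; apply: sumr_ge0 => x _; exact: sqr_ge0. Qed.

Lemma sum_shift (V : nmodType) (t : G) (phi : G -> V) : \sum_x phi (x + t) = \sum_x phi x.
Proof. by rewrite [RHS](reindex_inj (addIr t)). Qed.

Lemma variance_le S h k : S != set0 -> (0 < k)%N ->
  \sum_(z : power k | power_on S z) (k%:R^-1 * power_sum h z - (\sum_(s in S) h s) / #|S|%:R) ^+ 2 * #|S|%:R
   <= #|S|%:R ^+ k / k%:R * \sum_(s in S) h s ^+ 2.
Proof.
move=> S0 k0; set m := (\sum_(s in S) h s) / _.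
have Sp : 0 < #|S|%:R :> R by rewrite ltr0n card_gt0.
have kp : 0 < k%:R :> R by rewrite ltr0n.
have mE : \sum_(s in S) h s = m * #|S|%:R by rewrite /m divfK ?gt_eqF.
pose h' x := h x - m.
have h'0 : \sum_(s in S) h' s = 0.
  by rewrite /h' big_split /= sumr_const mE mulr_natr mulNrn subrr.
have [_ var] := variance k h'0.
have hh' : \sum_(s in S) h' s ^+ 2 <= \sum_(s in S) h s ^+ 2.
  have -> : \sum_(s in S) h s ^+ 2 = \sum_(s in S) h' s ^+ 2 + 2 * m * (\sum_(s in S) h' s) + m ^+ 2 *+ #|S|.
    rewrite mulr_sumr -sumr_const -!big_split /=; apply: eq_bigr => s _; rewrite /h'; ring.
  by rewrite h'0 mulr0 addr0 lerDl mulrn_wge0 // sqr_ge0.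
apply: le_trans (ler_wpM2l _ hh'); last by rewrite divr_ge0 ?exprn_ge0 // ltW.
rewrite -mulr_suml mulrC.
have -> : \sum_(z : power k | power_on S z) (k%:R^-1 * power_sum h z - m) ^+ 2 =
    k%:R^-2 * \sum_(z : power k | power_on S z) power_sum h' z ^+ 2.
  rewrite mulr_sumr; apply: eq_bigr => z _; rewrite /h' power_sumB -exprVn -exprMn.
  by congr (_ ^+ 2); rewrite mulrBr mulKf ?gt_eqF.
rewrite mulrCA var le_eqVlt; apply/orP; left; apply/eqP.
by field; rewrite gt_eqF.
Qed.

(** At least half of the [k]-samples of [S] approximate the average well. Shifting a good sample by
    t in [Z] lands in [(S + Z)^k], so some [w] there is a shift of good samples for many t. Any two
    of these t compare the average with the same sample average of [w]. *)
Lemma croot_sisask f S Z k : S != set0 -> Z != set0 -> (0 < k)%N ->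
  exists T, [/\ T \subset Z, (#|S| ^ k * #|Z| <= 2 * #|sadd S Z| ^ k * #|T|)%N &
    {in T &, forall t t', sqnorm (fun i x => averaged S f i (x - t) - averaged S f i (x - t'))
        <= 8 / k%:R * sqnorm f}].
Proof.
move=> S0 Z0 k0.
have Sp : 0 < #|S|%:R :> R by rewrite ltr0n card_gt0.
have kp : 0 < k%:R :> R by rewrite ltr0n.
pose avg (z : power k) i x := k%:R^-1 * power_sum (fun s => f i (x - s)) z.
pose err z := sqnorm (fun i x => avg z i x - averaged S f i x).
pose E := sqnorm f / k%:R.
have E0 : 0 <= E by rewrite divr_ge0 ?sqnorm_ge0 // ltW.
pose good (z : power k) := power_on S z && (err z <= 2 * E).
have toterr : \sum_(z : power k | power_on S z) err z <= #|S|%:R ^+ k * E.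
  rewrite /err /sqnorm exchange_big /=.
  rewrite -(ler_pM2r Sp) mulr_suml.
  have -> : #|S|%:R ^+ k * E * #|S|%:R =
     \sum_i (#|S|%:R ^+ k / k%:R * (#|S|%:R * \sum_x f i x ^+ 2)).
    by rewrite -!mulr_sumr /E /sqnorm; ring.
  apply: ler_sum => i _; rewrite exchange_big /= mulr_suml.
  have -> : #|S|%:R * \sum_x f i x ^+ 2 = \sum_x \sum_(s in S) f i (x - s) ^+ 2.
    rewrite exchange_big /=.
    transitivity (\sum_(s in S) \sum_x f i x ^+ 2).
      by rewrite sumr_const mulr_natl.
    by apply: eq_bigr => s _; rewrite -[LHS](sum_shift (- s)).
  rewrite mulr_sumr; apply: ler_sum => x _; rewrite mulr_suml.
  exact: (variance_le (fun s => f i (x - s))).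
(* Markov's inequality against the total error. *)
have goodN : #|S|%:R ^+ k <= 2 * #|[set z | good z]|%:R :> R.
  have bad : 2 * #|[set z : power k | power_on S z && ~~ (err z <= 2 * E)]|%:R <= #|S|%:R ^+ k :> R.
    set W := [set z | _]; have [->|W0] := eqVneq W set0.
      by rewrite cards0 mulr0 exprn_ge0.
    have h : \sum_(z in W) err z <= #|S|%:R ^+ k * E.
      apply: le_trans toterr; rewrite [leRHS](bigID (fun z => err z <= 2 * E)) /= addrC.
      rewrite [X in X + _](_ : _ = \sum_(z in W) err z); last by apply: eq_bigl => z; rewrite inE.
      by rewrite lerDl sumr_ge0 // => z _; exact: sqnorm_ge0.
    have h' : (2 * E) *+ #|W| < \sum_(z in W) err z.
      rewrite -sumr_const; apply: ltr_sum => [|z].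
        by case/set0Pn: W0 => z zW; apply/hasP; exists z; rewrite ?mem_index_enum.
      by rewrite inE -ltNge => /andP [].
    have Ep : 0 < E.
      rewrite lt_def E0 andbT; apply/eqP => e0; move: (lt_le_trans h' h).
      by rewrite e0 mulr0 mul0rn mulr0 ltxx.
    rewrite -(ler_pM2r Ep); apply: ltW; apply: le_lt_trans (lt_le_trans h' h).
    by rewrite -mulr_natr; le_ring.
  have : #|[set z : power k | power_on S z]|%:R = #|S|%:R ^+ k :> R.
    by rewrite cardsE card_power_on natrX.
  rewrite -(cardsID [set z | err z <= 2 * E]) natrD.
  have -> : [set z : power k | power_on S z] :&: [set z | err z <= 2 * E] = [set z | good z].
    by apply/setP => z; rewrite !inE.
  have -> : [set z : power k | power_on S z] :\: [set z | err z <= 2 * E] =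
    [set z : power k | power_on S z && ~~ (err z <= 2 * E)].
    by apply/setP => z; rewrite !inE andbC.
  by move: bad; lra.
pose Tw (w : power k) := [set t in Z | good (power_shift (- t) w)].
have [w hw] : exists w : power k, (#|S| ^ k * #|Z| <= 2 * #|sadd S Z| ^ k * #|Tw w|)%N.
  pose W := [pred z : power k | power_on (sadd S Z) z].
  have hsum : (#|Z| * #|[set z | good z]| <= \sum_(w in W) #|Tw w|)%N.
    have -> : (\sum_(w in W) #|Tw w| = \sum_(w in W) \sum_(t in Z) good (power_shift (- t) w))%N.
      apply: eq_bigr => w _; rewrite -sum1_card big_mkcond [RHS]big_mkcond /=.
      by apply: eq_bigr => t _; rewrite inE; case: (t \in Z); case: (good _).
    rewrite exchange_big /= -sum_nat_const; apply: leq_sum => t tZ.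
    rewrite (reindex_inj (can_inj (@power_shiftK t k))) /=.
    rewrite -sum1_card big_mkcond [X in (_ <= X)%N]big_mkcond /=; apply: leq_sum => z _.
    rewrite inE power_shiftK; case: (boolP (good z)) => // /andP [zS _].
    by rewrite inE power_shift_on.
  case: (pickP [pred w : power k | (#|S| ^ k * #|Z| <= 2 * #|sadd S Z| ^ k * #|Tw w|)%N]) => [w hw|no].
    by exists w.
  exfalso.
  have Zp : (0 < #|Z|)%N by rewrite card_gt0.
  have SZp : (0 < #|sadd S Z| ^ k)%N by rewrite expn_gt0 card_gt0 sadd_neq0.
  have gN : (#|S| ^ k <= 2 * #|[set z | good z]|)%N.
    by rewrite -(ler_nat R) natrX natrM.
  have : (\sum_(w in W) (2 * #|sadd S Z| ^ k * #|Tw w|) < \sum_(w in W) #|S| ^ k * #|Z|)%N.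
    have [w0 w0W] : exists w0 : power k, w0 \in W.
      by apply/card_gt0P; rewrite card_power_on.
    rewrite (bigD1 w0) //= [X in (_ < X)%N](bigD1 w0) //= -addSn; apply: leq_add.
      by rewrite ltnNge; apply/negbT; exact: no.
    by apply: leq_sum => w _; apply: ltnW; rewrite ltnNge; apply/negbT; exact: no.
  rewrite sum_nat_const card_power_on -big_distrr /=.
  rewrite ltnNge => /negP; apply; rewrite [(2 * _)%N]mulnC -mulnA leq_mul2l; apply/orP; right.
  apply: leq_trans (leq_mul gN (leqnn #|Z|)) _.
  by rewrite -mulnA leq_mul2l /= mulnC.
exists (Tw w); split => //; first by apply/subsetP => t; rewrite inE => /andP [].
have tP t : t \in Tw w -> sqnorm (fun i x => avg w i x - averaged S f i (x - t)) <= 2 * E.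
  rewrite inE => /andP [_ /andP [_]]; congr (_ <= _); apply: eq_bigr => i _.
  rewrite -[RHS](sum_shift t); apply: eq_bigr => x _; congr ((_ - _) ^+ 2); last by rewrite addrK.
  rewrite /avg power_sum_shift; congr (_ * _); apply: eq_power_sum => s; congr (f i _); ring.
move=> t t' /tP ht /tP ht'.
(* Both translates are within [2 * E] of the sample average of [w]; (p - q)^2 <= 2 p^2 + 2 q^2 then
   gives [8 * E]. *)
apply: le_trans (_ : 2 * (2 * E) + 2 * (2 * E) <= _); last by rewrite /E; le_ring.
apply: le_trans (lerD (ler_wpM2l _ ht) (ler_wpM2l _ ht')); rewrite ?ler0n //.
rewrite /sqnorm !mulr_sumr -big_split; apply: ler_sum => i _.
rewrite !mulr_sumr -big_split; apply: ler_sum => x _ /=.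
move: (avg w i x) (averaged S f i (x - t)) (averaged S f i (x - t')) => a b c.
by rewrite -subr_ge0 (_ : _ - _ = (2 * a - b - c) ^+ 2) ?sqr_ge0 //; ring.
Qed.

End CrootSisask.

(** * Smooth models of a pair of sets *)

Section AutocorrelationKernel.
Variables (R : realType) (G : finComNzRingType).
Implicit Types (A B C D S T X Z : {set G}) (b : G -> R).

(** The autocorrelation of the uniform measure on [T]: a symmetric probability density supported on
    [T - T]. *)
Definition kernel T (x : G) : R := (\sum_(s in T) ((s - x) \in T)%:R) / #|T|%:R ^+ 2.

Definition smooth b C (e : R) := {in C, forall c, \sum_x `|b (x - c) - b x| <= e}.

(** The convolution of the indicator of [X] with [b]: the density of [X] around [x] when [b] is a
    symmetric probability density. *)
Definition dens X b (x : G) : R := \sum_(u in X) b (x - u).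

Lemma sum_shiftl (t : G) (phi : G -> R) : \sum_x phi (t + x) = \sum_x phi x.
Proof. by rewrite -[RHS](sum_shift t); apply: eq_bigr => x _; rewrite addrC. Qed.

Lemma sum_opp (phi : G -> R) : \sum_x phi (- x) = \sum_x phi x.
Proof. by rewrite [RHS](reindex_inj (@oppr_inj G)). Qed.

Lemma sum_reflect (t : G) (phi : G -> R) : \sum_x phi (t - x) = \sum_x phi x.
Proof. by rewrite (sum_opp (fun x => phi (t + x))) sum_shiftl. Qed.

Lemma sum_mem X (phi : G -> R) : \sum_(x in X) phi x = \sum_x (x \in X)%:R * phi x.
Proof. by rewrite big_mkcond; apply: eq_bigr => x _; case: ifP; rewrite ?mul1r ?mul0r. Qed.

Lemma sum_indicator X : \sum_x (x \in X)%:R = #|X|%:R :> R.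
Proof. by rewrite -sum1_card natr_sum sum_mem; apply: eq_bigr => x _; rewrite mulr1. Qed.

Lemma kernel_ge0 T x : 0 <= kernel T x.
Proof. by rewrite divr_ge0 ?exprn_ge0 // sumr_ge0. Qed.

Lemma kernelN T x : kernel T (- x) = kernel T x.
Proof.
rewrite /kernel; congr (_ / _); rewrite !sum_mem -[LHS](sum_shift (- x)); apply: eq_bigr => s _.
by rewrite opprK subrK mulrC.
Qed.

Lemma sum_kernel T : T != set0 -> \sum_x kernel T x = 1.
Proof.
move=> T0; rewrite -mulr_suml exchange_big /=.
have -> : \sum_(s in T) \sum_x ((s - x) \in T)%:R = #|T|%:R ^+ 2 :> R.
  transitivity (\sum_(s in T) #|T|%:R : R).
    by apply: eq_bigr => s _; rewrite (sum_reflect s (fun x => (x \in T)%:R)) sum_indicator.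
  by rewrite sumr_const expr2 mulr_natr.
by rewrite divff // expf_neq0 // pnatr_eq0 cards_eq0.
Qed.

Lemma kernel_supp T x : x \notin sdiff T T -> kernel T x = 0.
Proof.
move=> nx; rewrite /kernel big1 ?mul0r // => s sT; case: (boolP (s - x \in T)) => // sx.
by case/negP: nx; apply/imset2P; exists s (s - x) => //; ring.
Qed.

Lemma kernel_le T x : T != set0 -> kernel T x <= #|T|%:R^-1.
Proof.
move=> T0; have Tp : 0 < #|T|%:R :> R by rewrite ltr0n card_gt0.
rewrite ler_pdivrMr ?exprn_gt0 // expr2 mulKf ?gt_eqF // -sum1_card natr_sum.
by apply: ler_sum => s _; case: (_ \in _).
Qed.

Lemma smooth_sub b C D e : D \subset C -> smooth b C e -> smooth b D e.
Proof. by move=> /subsetP h s c /h; exact: s. Qed.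

Lemma dens_ge0 X b x : (forall y, 0 <= b y) -> 0 <= dens X b x.
Proof. by move=> b0; apply: sumr_ge0. Qed.

Lemma sum_dens X b : \sum_x b x = 1 -> \sum_x dens X b x = #|X|%:R.
Proof.
move=> b1; rewrite exchange_big /=.
under eq_bigr => u _ do rewrite (sum_shift (- u) b) b1.
by rewrite sumr_const.
Qed.

Lemma dens_le1 X b x : (forall y, 0 <= b y) -> \sum_x b x = 1 -> dens X b x <= 1.
Proof.
move=> b0 b1; rewrite -b1 -(sum_reflect x) /dens [leRHS](bigID (mem X)) /=.
by rewrite lerDl sumr_ge0.
Qed.

Lemma dens_smooth X b C e x c : smooth b C e -> - c \in C -> `|dens X b (x + c) - dens X b x| <= e.
Proof.
move=> sb cC; rewrite -sumrB; apply: le_trans (ler_norm_sum _ _ _) _.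
apply: le_trans (sb _ cC); rewrite -[leRHS](sum_reflect x) [leRHS](bigID (mem X)) /= ler_wpDr ?sumr_ge0 //.
by apply: ler_sum => u _; rewrite opprK (_ : x + c - u = x - u + c) //; ring.
Qed.

Lemma dens_supp X T x : x \notin sadd X (sdiff T T) -> dens X (kernel T) x = 0.
Proof.
move=> nx; apply: big1 => u uX; apply: kernel_supp; apply: contra nx => h.
by apply/saddP; exists u, (x - u); split => //; ring.
Qed.

(* Weighted AM-GM replaces the Cauchy-Schwarz inequality. *)
Lemma sum_norm_le (W : {set G}) (phi : G -> R) (q w e : R) : 0 < e -> 0 < q -> 0 <= w ->
  (forall x, x \notin W -> phi x = 0) -> #|W|%:R <= w ->
  \sum_x phi x ^+ 2 <= q -> w * q <= e ^+ 2 -> \sum_x `|phi x| <= e.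
Proof.
move=> e0 q0 w0 supp cW sq wq.
have h x : `|phi x| <= e / (2 * q) * phi x ^+ 2 + (x \in W)%:R * (q / (2 * e)).
  have eq0 : 0 < e / (2 * q) by rewrite divr_gt0 ?mulr_gt0.
  case: (boolP (x \in W)) => [_|/supp ->]; last by rewrite normr0 expr0n /= mulr0 mul0r addr0.
  rewrite mul1r -real_normK ?num_real //; move: `|phi x| => y.
  rewrite -subr_ge0 (_ : _ - _ = e / (2 * q) * (y - q / e) ^+ 2).
    by rewrite mulr_ge0 ?sqr_ge0 // ltW.
  by field; rewrite !gt_eqF.
apply: le_trans (ler_sum _ (fun x _ => h x)) _.
rewrite big_split /= -mulr_sumr -mulr_suml.
rewrite sum_indicator.
rewrite [leRHS](_ : _ = e / (2 * q) * q + e ^+ 2 / (2 * e)); last by field; rewrite !gt_eqF.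
apply: lerD; first by rewrite ler_wpM2l // divr_ge0 ?mulr_ge0 // ltW.
rewrite mulrA; apply: ler_wpM2r; first by rewrite invr_ge0 mulr_ge0 // ltW.
by apply: le_trans wq; apply: ler_wpM2r; rewrite // ltW.
Qed.

End AutocorrelationKernel.

(** * Almost periods of kernels and of localised convolutions *)

Section AlmostPeriods.
Variable R : realType.

Lemma exists_nat_ge (x : R) : exists2 k : nat, (0 < k)%N & x <= k%:R.
Proof.
exists (Num.bound `|x|).+1 => //; apply: le_trans (ler_norm x) _; apply: ltW.
by apply: lt_le_trans (archi_boundP (normr_ge0 x)) _; rewrite ler_nat.
Qed.

(** The kernel is the average over [T] of the normalised indicator of [-T], so Croot-Sisask applies
    with [S := T]. Its support has size O(K|T|), which turns the L2 bound into an L1 bound. *)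
Lemma kernel_smooth (K e : R) : 0 < K -> 0 < e -> exists2 c : R, 0 < c &
  forall (G : finComNzRingType) (T Z : {set G}), T != set0 -> Z != set0 ->
    #|sdiff T T|%:R <= K * #|T|%:R -> #|sadd T Z|%:R <= K * #|T|%:R ->
  exists T' : {set G}, [/\ T' \subset Z, T' != set0, c * #|Z|%:R <= #|T'|%:R &
     smooth (kernel R T) (sdiff T' T') e].
Proof.
(* An L2 error 8/(k|T|) on a support of size at most 2K|T| gives L1 error [e] once 16K/k <= e^2. *)
move=> K0 e0; have [k k0 hk] := exists_nat_ge (16 * K / e ^+ 2).
exists (2 * K ^+ k)^-1; first by rewrite invr_gt0 mulr_gt0 // exprn_gt0.
move=> G T Z T0 Z0 hTT hTZ.
have Tp : 0 < #|T|%:R :> R by rewrite ltr0n card_gt0.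
have Zp : 0 < #|Z|%:R :> R by rewrite ltr0n card_gt0.
pose f (i : unit) (y : G) : R := ((- y) \in T)%:R / #|T|%:R.
have kp : 0 < k%:R :> R by rewrite ltr0n.
have [T' [T'Z cT' hT']] := croot_sisask f T0 Z0 k0.
have sqf : sqnorm f = #|T|%:R^-1.
  rewrite /sqnorm (bigD1 tt) //= [X in _ + X]big1 ?addr0; last by case.
  rewrite /f (sum_opp (fun y => ((y \in T)%:R / #|T|%:R) ^+ 2)).
  transitivity (\sum_(y in T) (#|T|%:R ^- 2 : R)).
    rewrite [RHS]big_mkcond; apply: eq_bigr => y _; case: ifP => _.
      by rewrite mul1r exprVn.
    by rewrite mul0r expr0n.
  by rewrite sumr_const -mulr_natr; field; rewrite gt_eqF.
have cT'' : #|T|%:R ^+ k * #|Z|%:R <= 2 * #|sadd T Z|%:R ^+ k * #|T'|%:R :> R.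
  by rewrite -!natrX -!natrM ler_nat.
have T'0 : T' != set0.
  apply/eqP => e1; move: cT''; rewrite e1 cards0 mulr0 leNgt mulr_gt0 // exprn_gt0 //.
exists T'; split => //.
  rewrite mulrC ler_pdivrMr ?mulr_gt0 ?exprn_gt0 //.
  rewrite -(ler_pM2l (exprn_gt0 k Tp)); apply: le_trans cT'' _.
  rewrite [leRHS](_ : _ = 2 * (K * #|T|%:R) ^+ k * #|T'|%:R); last by rewrite exprMn; ring.
  apply: ler_wpM2r => //; apply: ler_wpM2l => //; apply: lerXn2r => //; rewrite ?nnegrE //.
  by rewrite mulr_ge0 // ltW.
move=> _ /imset2P [t t' tT' t'T' ->].
have := hT' _ _ tT' t'T'; rewrite sqf.
have avgE x : averaged T f tt x = kernel R T x.
  rewrite /averaged /kernel /f -mulr_suml expr2 invfM mulrA; congr (_ / _ / _).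
  by apply: eq_bigr => s _; rewrite opprB.
rewrite /sqnorm (bigD1 tt) //= [X in _ + X]big1 ?addr0; last by case.
rewrite -(sum_shift t').
have -> : \sum_x (averaged T f tt (x + t' - t) - averaged T f tt (x + t' - t')) ^+ 2 =
    \sum_x (kernel R T (x - (t - t')) - kernel R T x) ^+ 2.
  by apply: eq_bigr => x _; rewrite !avgE addrK (_ : x + t' - t = x - (t - t')) //; ring.
move=> h.
pose D := sdiff T T; pose W := sadd [set t - t'] D :|: D.
apply: (@sum_norm_le _ _ W _ (8 / k%:R * #|T|%:R^-1) (2 * (K * #|T|%:R))) => //.
- by rewrite mulr_gt0 ?divr_gt0 ?invr_gt0.
- by rewrite mulr_ge0 ?mulr_ge0 // ltW.
- move=> x; rewrite inE negb_or sadd1P => /andP [h1 h2].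
  by rewrite !kernel_supp ?subrr // opprB addrA.
- have : (#|W| <= #|D| + #|D|)%N by rewrite -{1}(card_sadd1 (t - t') D) -cardsUI leq_addr.
  by rewrite -(ler_nat R) natrD => hW; apply: le_trans hW _; move: hTT; rewrite -/D; lra.
rewrite (_ : _ * _ = (16 * K) / k%:R); last by field; rewrite !gt_eqF.
by rewrite ler_pdivrMr // [leRHS]mulrC -ler_pdivrMr ?exprn_gt0.
Qed.

(** Counts the representations of [z] in [A + B] whose first summand is near [x], with weight [b].
    It vanishes off [A + B]. *)
Definition local_conv (G : finComNzRingType) (A B : {set G}) (b : G -> R) (x z : G) : R :=
  \sum_(u in A) b (u - x) * ((z - u) \in B)%:R.

(** The family indexed by [x] consists of the functions u -> 1_A(u) b(u - x), averaged over [B]. As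
    the kernel is at most 1/|T|, its total L2 norm is at most |A|/|T| <= 1/c, which is where
    [8 / (c * w)] comes from. *)
Lemma local_conv_periods (K c w : R) : 0 < K -> 0 < c -> 0 < w -> exists2 c' : R, 0 < c' &
  forall (G : finComNzRingType) (A B T Z : {set G}), A != set0 -> #|B| = #|A| ->
    T != set0 -> c * #|A|%:R <= #|T|%:R -> Z != set0 ->
    #|sadd B Z|%:R <= K * #|A|%:R ->
  exists T' : {set G}, [/\ T' \subset Z, T' != set0, c' * #|Z|%:R <= #|T'|%:R &
     {in sdiff T' T', forall t, \sum_x \sum_z
        (local_conv A B (kernel R T) x (z - t) - local_conv A B (kernel R T) x z) ^+ 2
          <= w * #|A|%:R ^+ 2}].
Proof.
move=> K0 c0 w0; have [k k0 hk] := exists_nat_ge (8 / (c * w)).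
exists (2 * K ^+ k)^-1; first by rewrite invr_gt0 mulr_gt0 // exprn_gt0.
move=> G A B T Z A0 cBA T0 cT Z0 hBZ.
have Ap : 0 < #|A|%:R :> R by rewrite ltr0n card_gt0.
have Tp : 0 < #|T|%:R :> R by rewrite ltr0n card_gt0.
have Zp : 0 < #|Z|%:R :> R by rewrite ltr0n card_gt0.
have B0 : B != set0 by rewrite -cards_eq0 cBA cards_eq0.
have kp : 0 < k%:R :> R by rewrite ltr0n.
pose f (x : G) (u : G) : R := (u \in A)%:R * kernel R T (u - x).
have [T' [T'Z cT' hT']] := croot_sisask f B0 Z0 k0.
have cT'' : #|A|%:R ^+ k * #|Z|%:R <= 2 * #|sadd B Z|%:R ^+ k * #|T'|%:R :> R.
  by rewrite -cBA -!natrX -!natrM ler_nat.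
have T'0 : T' != set0.
  by apply/eqP => e1; move: cT''; rewrite e1 cards0 mulr0 leNgt mulr_gt0 // exprn_gt0.
exists T'; split => //.
  rewrite mulrC ler_pdivrMr ?mulr_gt0 ?exprn_gt0 //.
  rewrite -(ler_pM2l (exprn_gt0 k Ap)); apply: le_trans cT'' _.
  rewrite [leRHS](_ : _ = 2 * (K * #|A|%:R) ^+ k * #|T'|%:R); last by rewrite exprMn; ring.
  apply: ler_wpM2r => //; apply: ler_wpM2l => //; apply: lerXn2r => //; rewrite ?nnegrE //.
  by rewrite mulr_ge0 // ltW.
have sqf : sqnorm f <= #|A|%:R / #|T|%:R.
  rewrite /sqnorm exchange_big /=.
  apply: le_trans (_ : \sum_(u : G) (u \in A)%:R * #|T|%:R^-1 <= _); last first.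
    by rewrite -mulr_suml sum_indicator.
  apply: ler_sum => u _; rewrite /f; case: (u \in A); last first.
    by rewrite mul0r big1 // => x _; rewrite mul0r expr0n.
  rewrite mul1r (sum_reflect u (fun x => (1%:R * kernel R T x) ^+ 2)).
  apply: le_trans (_ : \sum_x #|T|%:R^-1 * kernel R T x <= _).
    by apply: ler_sum => x _; rewrite mul1r expr2 ler_wpM2r ?kernel_ge0 ?kernel_le.
  by rewrite -mulr_sumr sum_kernel // mulr1.
have avgE x z : averaged B f x z = local_conv A B (kernel R T) x z / #|A|%:R.
  rewrite /averaged /local_conv cBA; congr (_ / _).
  rewrite !sum_mem -(sum_reflect z); apply: eq_bigr => u _.
  by rewrite /f (_ : z - (z - u) = u); [ring|ring].
move=> _ /imset2P [t t' tT' t'T' ->].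
have := hT' _ _ tT' t'T'; rewrite /sqnorm.
under eq_bigr => x _ do rewrite -(sum_shift t').
have -> : \sum_x \sum_z (averaged B f x (z + t' - t) - averaged B f x (z + t' - t')) ^+ 2 =
    \sum_x (\sum_z (local_conv A B (kernel R T) x (z - (t - t')) - local_conv A B (kernel R T) x z) ^+ 2) * (#|A|%:R^-1) ^+ 2.
  apply: eq_bigr => x _; rewrite mulr_suml; apply: eq_bigr => z _.
  by rewrite !avgE addrK (_ : z + t' - t = z - (t - t')) -?mulrBl ?exprMn //; ring.
rewrite -mulr_suml exprVn ler_pdivrMr ?exprn_gt0 // => h.
apply: le_trans h _; rewrite ler_wpM2r ?exprn_ge0 //.
apply: le_trans (ler_wpM2l _ sqf) _; first by rewrite divr_ge0.
have cw : 0 < c * w by rewrite mulr_gt0.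
have h1 : 8 <= k%:R * (c * w) by rewrite -ler_pdivrMr.
rewrite mulf_div ler_pdivrMr ?mulr_gt0 //.
apply: le_trans (ler_wpM2r (ltW Ap) h1) _.
rewrite -subr_ge0 (_ : _ - _ = k%:R * w * (#|T|%:R - c * #|A|%:R)); last by ring.
by rewrite !mulr_ge0 ?subr_ge0 // ltW.
Qed.

End AlmostPeriods.

(** * Successive refinements of the scale *)

Section Regularity.
Variable R : realType.

Definition bounded_sums (K : R) (G : finComNzRingType) (A B : {set G}) :=
  [/\ A != set0, #|B| = #|A|, #|sadd A A|%:R <= K * #|A|%:R,
      #|sdiff A A|%:R <= K * #|A|%:R & #|sadd B A|%:R <= K * #|A|%:R].

(** [C] holds the almost periods at scale [T], of size comparable to |A|; the finer [T'] serves for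
    averaging. The last error is measured against |C|^2, not |A|^2, since it must be spread over
    fewer than |C| bad centres. *)
Definition refines (c e e' w : R) (G : finComNzRingType) (A B T C T' : {set G}) :=
  [/\ C \subset sdiff A A, 0 \in C, {in C, forall x, - x \in C},
      c * #|A|%:R <= #|C|%:R & smooth (kernel R T) C e] /\
  [/\ T' \subset A, c * #|A|%:R <= #|T'|%:R, smooth (kernel R T) (sdiff T' T') e' &
    {in sdiff T' T', forall t, \sum_x \sum_z
        (local_conv A B (kernel R T) x (z - t) - local_conv A B (kernel R T) x z) ^+ 2
          <= w * #|C|%:R ^+ 2}].

Lemma card_sdiff_ge (G : finComNzRingType) (S : {set G}) : (#|S| <= #|sdiff S S|)%N.
Proof.
have [->|/set0Pn [s sS]] := eqVneq S set0; first by rewrite cards0.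
rewrite -(card_sadd1 (- s) S); apply: subset_leq_card; apply/subsetP => x.
by rewrite sadd1P opprK => xS; apply/imset2P; exists (x + s) s; rewrite ?addrK.
Qed.

Lemma sdiffS (G : finComNzRingType) (A B C D : {set G}) :
  A \subset C -> B \subset D -> sdiff A B \subset sdiff C D.
Proof.
move=> /subsetP AC /subsetP BD; apply/subsetP => x /imset2P [a b aA bB ->].
by apply/imset2P; exists a b; rewrite ?AC ?BD.
Qed.

Lemma refinement_exists (K c e e' w : R) : 0 < K -> 0 < c -> 0 < e -> 0 < e' -> 0 < w ->
  exists2 c' : R, 0 < c' & forall (G : finComNzRingType) (A B T : {set G}),
    bounded_sums K A B -> T \subset A -> c * #|A|%:R <= #|T|%:R ->
    exists C T', refines c' e e' w A B T C T'.
Proof.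
move=> K0 c0 e0 e0' w0.
have Kc : 0 < K / c by rewrite divr_gt0.
have [c1 c1p h1] := kernel_smooth Kc e0.
have [c2 c2p h2] := kernel_smooth Kc e0'.
(* |C| >= c1|A| converts an error relative to |A|^2 into one relative to |C|^2. *)
have w0' : 0 < w * c1 ^+ 2 by rewrite mulr_gt0 ?exprn_gt0.
have [c3 c3p h3] := local_conv_periods K0 c0 w0'.
exists (Num.min c1 (c3 * c2)); first by rewrite lt_min c1p mulr_gt0.
move=> G A B T [A0 cBA hAA hdA hBA] TA cT.
have Ap : 0 < #|A|%:R :> R by rewrite ltr0n card_gt0.
have Tp : 0 < #|T|%:R :> R by apply: lt_le_trans cT; rewrite mulr_gt0.
have T0 : T != set0 by rewrite -card_gt0 -(ltr0n R).
have KA : K * #|A|%:R <= K / c * #|T|%:R.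
  by rewrite -mulrA; apply: ler_wpM2l; [exact: ltW|rewrite ler_pdivlMl].
have hTT : #|sdiff T T|%:R <= K / c * #|T|%:R.
  by apply: le_trans KA; apply: le_trans hdA; rewrite ler_nat subset_leq_card // sdiffS.
have hTA : #|sadd T A|%:R <= K / c * #|T|%:R.
  by apply: le_trans KA; apply: le_trans hAA; rewrite ler_nat subset_leq_card // saddS.
have [S [SA S0 cS smS]] := h1 G T A T0 A0 hTT hTA.
have [Z [ZA Z0 cZ smZ]] := h2 G T A T0 A0 hTT hTA.
have hBZ : #|sadd B Z|%:R <= K * #|A|%:R.
  by apply: le_trans hBA; rewrite ler_nat subset_leq_card // saddS.
have [T' [T'Z T'0 cT' hT']] := h3 G A B T Z A0 cBA T0 cT Z0 hBZ.
have cC : c1 * #|A|%:R <= #|sdiff S S|%:R by apply: le_trans cS _; rewrite ler_nat card_sdiff_ge.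
exists (sdiff S S), T'; split; split => //.
- exact: sdiffS.
- by case/set0Pn: S0 => s sS; apply/imset2P; exists s s; rewrite ?subrr.
- by move=> _ /imset2P [s s' sS s'S ->]; apply/imset2P; exists s' s; rewrite ?opprB.
- by apply: le_trans cC; rewrite ler_wpM2r // ge_min lexx.
- exact: subset_trans ZA.
- apply: le_trans cT'; apply: le_trans (_ : c3 * (c2 * #|A|%:R) <= _).
    by rewrite mulrA ler_wpM2r // ge_min lexx orbT.
  by apply: ler_wpM2l => //; exact: ltW.
- by apply: smooth_sub smZ; exact: sdiffS.
move=> t /hT' h; apply: le_trans h _; rewrite -mulrA -exprMn.
apply: ler_wpM2l; first exact: ltW.
by apply: lerXn2r => //; rewrite nnegrE // mulr_ge0 // ltW.
Qed.

Lemma refines_le (c1 c2 e e' w : R) (G : finComNzRingType) (A B T C T' : {set G}) :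
  c2 <= c1 -> refines c1 e e' w A B T C T' -> refines c2 e e' w A B T C T'.
Proof.
move=> h [[C1 C2 C3 C4 C5] [T1 T2 T3 T4]].
have h' : c2 * #|A|%:R <= c1 * #|A|%:R by rewrite ler_wpM2r.
by split; split => //; exact: le_trans h' _.
Qed.

Lemma refinement_sequence (K e e' w : R) n : 0 < K -> 0 < e -> 0 < e' -> 0 < w ->
  exists2 c : R, 0 < c & forall (G : finComNzRingType) (A B : {set G}),
    bounded_sums K A B -> exists T C : nat -> {set G},
    [/\ T 0%N = A, T n \subset A, c * #|A|%:R <= #|T n|%:R &
      forall i, (i < n)%N -> refines c e e' w A B (T i) (C i) (T i.+1)].
Proof.
move=> K0 e0 e0' w0; elim: n => [|n [c c0 IH]].
  by exists 1 => // G A B _; exists (fun=> A), (fun=> A); split; rewrite ?mul1r.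
have [c' c'0 h] := refinement_exists K0 c0 e0 e0' w0.
exists (Num.min c c'); first by rewrite lt_min c0.
move=> G A B hAB; have [T [C [T0 TnA cT hT]]] := IH _ _ _ hAB.
have [Cn [Tn hn]] := h _ _ _ _ hAB TnA cT.
exists (fun i => if i == n.+1 then Tn else T i), (fun i => if i == n then Cn else C i).
have hn' : refines (Num.min c c') e e' w A B (T n) Cn Tn by apply: refines_le hn; rewrite ge_min lexx orbT.
have [_ [h1 h2 _ _]] := hn'.
split; rewrite ?eqxx // => i; rewrite ltnS leq_eqVlt => /orP [/eqP ->|lin].
  by rewrite !eqxx ltn_eqF.
rewrite (ltn_eqF (ltnW lin : i < n.+1)%N) (ltn_eqF lin) eqSS (ltn_eqF lin).
by apply: refines_le (hT _ lin); rewrite ge_min lexx.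
Qed.

Lemma convex_sq (G : finComNzRingType) (b phi : G -> R) (X : {set G}) :
  (forall x, 0 <= b x) -> \sum_x b x = 1 ->
  (\sum_x b x * phi x) ^+ 2 <= \sum_x b x * phi x ^+ 2.
Proof.
move=> b0 b1; set m := \sum_x b x * phi x.
have : 0 <= \sum_x b x * (phi x - m) ^+ 2.
  by apply: sumr_ge0 => x _; rewrite mulr_ge0 // sqr_ge0.
have -> : \sum_x b x * (phi x - m) ^+ 2 =
    \sum_x b x * phi x ^+ 2 - 2 * m * m + m ^+ 2 * \sum_x b x.
  have e : m * m = \sum_x m * (b x * phi x) by rewrite -mulr_sumr.
  by rewrite -mulrA e !mulr_sumr -sumrB -big_split; apply: eq_bigr => x _ /=; ring.
by rewrite b1; lra.
Qed.

Section LocalConv.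
Variables (G : finComNzRingType) (A B T T' : {set G}) (e' th : R).
Let b := kernel R T.
Let b' := kernel R T'.
Let Gd := [set x | th <= dens A b' x].

Lemma local_conv_out x z : z \notin sadd A B -> local_conv A B b x z = 0.
Proof.
move=> nz; apply: big1 => u uA; case: (boolP (z - u \in B)) => [h|]; last by rewrite mulr0.
by case/negP: nz; apply/saddP; exists u, (z - u); split => //; ring.
Qed.

(* Averaging over the finer kernel replaces [A] by its fine density, which is at
   least [th] on most of the neighbourhood of [x]. *)
Lemma smoothed_local_conv x z : T != set0 -> T' != set0 -> 0 <= th ->
  smooth b (sdiff T' T') e' ->
  th * (dens B b (z - x) - (1 - dens Gd b x)) - e' <=
    \sum_t b' t * local_conv A B b x (z - t).
Proof.
move=> T0 T'0 th0 smb.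
have b0 y : 0 <= b y by exact: kernel_ge0.
have b'0 y : 0 <= b' y by exact: kernel_ge0.
have b1 : \sum_y b y = 1 by exact: sum_kernel.
have b'1 : \sum_y b' y = 1 by exact: sum_kernel.
have b'supp t : b' t != 0 -> t \in sdiff T' T'.
  by move=> h; apply: contraNT h => /kernel_supp h; rewrite /b' h.
have E1 : \sum_t b' t * local_conv A B b x (z - t) =
    \sum_u (z - u \in B)%:R * \sum_t b' t * ((u - t \in A)%:R * b (u - x - t)).
  under [RHS]eq_bigr => u _ do rewrite mulr_sumr.
  rewrite [RHS]exchange_big; apply: eq_bigr => t _ /=.
  rewrite /local_conv sum_mem mulr_sumr -(sum_shift (- t)); apply: eq_bigr => u _.
  have -> : z - t - (u - t) = z - u by ring.
  have -> : u - t - x = u - x - t by ring.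
  by rewrite [RHS]mulrC !mulrA.
have E2 : - e' <= \sum_u (z - u \in B)%:R * \sum_t b' t * ((u - t \in A)%:R * b (u - x - t)) -
     \sum_u (z - u \in B)%:R * \sum_t b' t * ((u - t \in A)%:R * b (u - x)).
  rewrite -sumrB lerNl -sumrN.
  apply: le_trans (_ : \sum_u \sum_t b' t * `|b (u - x - t) - b (u - x)| <= _).
    apply: ler_sum => u _; rewrite -mulrBr -sumrB -mulrN -sumrN.
    apply: le_trans (_ : (z - u \in B)%:R * \sum_t b' t * `|b (u - x - t) - b (u - x)| <= _).
      apply: ler_wpM2l => //; apply: ler_sum => t _; rewrite -mulrBr -mulrN; apply: ler_wpM2l => //.
      rewrite -mulrBr -mulrN; case: (_ \in A); rewrite ?mul0r // mul1r -normrN; exact: ler_norm.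
    rewrite -[leRHS]mul1r; apply: ler_wpM2r; last by case: (_ \in B).
    by apply: sumr_ge0 => t _; rewrite mulr_ge0.
  rewrite exchange_big /= -[leRHS]mul1r -b'1 mulr_suml; apply: ler_sum => t _.
  rewrite -mulr_sumr; have [->|/b'supp ht] := eqVneq (b' t) 0; first by rewrite !mul0r.
  apply: ler_wpM2l => //; apply: le_trans (smb _ ht).
  by rewrite -[leRHS](sum_shift (- x)).
have E3 : th * (dens B b (z - x) - (1 - dens Gd b x)) <=
   \sum_u (z - u \in B)%:R * \sum_t b' t * ((u - t \in A)%:R * b (u - x)).
  have -> : \sum_u (z - u \in B)%:R * \sum_t b' t * ((u - t \in A)%:R * b (u - x)) =
      \sum_u (z - u \in B)%:R * b (u - x) * dens A b' u.
    apply: eq_bigr => u _; rewrite /dens sum_mem -mulrA; congr (_ * _).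
    rewrite mulr_sumr -[RHS](sum_reflect u); apply: eq_bigr => t _.
    by rewrite subKr [RHS]mulrC mulrA; congr (_ * _); exact: mulrC.
  apply: le_trans (_ : \sum_u (z - u \in B)%:R * b (u - x) * (th * (u \in Gd)%:R) <= _); last first.
    apply: ler_sum => u _; apply: ler_wpM2l; first by rewrite mulr_ge0.
    case: (boolP (u \in Gd)) => [|_]; last by rewrite mulr0; apply: sumr_ge0.
    by rewrite inE mulr1.
  rewrite (eq_bigr (fun u => th * ((z - u \in B)%:R * b (u - x) * (u \in Gd)%:R))); last by move=> u _; exact: mulrCA.
  rewrite -mulr_sumr; apply: ler_wpM2l => //.
  have -> : dens B b (z - x) = \sum_u (z - u \in B)%:R * b (u - x).
    rewrite /dens sum_mem -(sum_reflect z); apply: eq_bigr => u _.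
    by rewrite (_ : z - x - (z - u) = u - x) //; ring.
  rewrite [X in _ - (X - _)](_ : 1 = \sum_u b (u - x)); last by rewrite (sum_shift (- x) b).
  have -> : dens Gd b x = \sum_u (u \in Gd)%:R * b (u - x).
    by rewrite /dens sum_mem; apply: eq_bigr => u _; rewrite -[b (x - u)]kernelN opprB.
  rewrite -!sumrB; apply: ler_sum => u _; have := b0 (u - x); move: (b (u - x)) => p p0.
  by case: (_ \in B); case: (_ \in Gd) => /=; lra.
rewrite E1; apply: le_trans (lerD E3 E2) _.
by rewrite addrC subrK.
Qed.

End LocalConv.

End Regularity.

(** * A regular scale and its level-set chains *)

Section SmoothModel.
Variable R : realType.

(** By commutativity of convolution the left side averages [dens A (kernel R T)] over shifts by
    [T' - T'], under which the coarse density is almost invariant. *)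
Lemma dens_refine (G : finComNzRingType) (A T T' : {set G}) (e : R) x : T' != set0 ->
  smooth (kernel R T) (sdiff T' T') e ->
  `|\sum_u dens A (kernel R T') u * kernel R T (x - u) - dens A (kernel R T) x| <= e.
Proof.
move=> T'0; set b := kernel R T; set b' := kernel R T' => smb.
have b'0 y : 0 <= b' y by exact: kernel_ge0.
have b'1 : \sum_y b' y = 1 by exact: sum_kernel.
have b'supp t : b' t != 0 -> t \in sdiff T' T'.
  by move=> h; apply: contraNT h => /kernel_supp h; rewrite /b' h.
have -> : \sum_u dens A b' u * b (x - u) = \sum_t b' t * dens A b (x - t).
  under eq_bigr => u _ do rewrite mulr_suml.
  under [RHS]eq_bigr => u _ do rewrite mulr_sumr.
  rewrite exchange_big [RHS]exchange_big; apply: eq_bigr => w _ /=.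
  rewrite -[LHS](sum_shift w); apply: eq_bigr => t _.
  by rewrite addrK opprD addrA.
rewrite -[dens A b x]mul1r -{1}b'1 mulr_suml -sumrB.
apply: le_trans (ler_norm_sum _ _ _) _; rewrite -[leRHS]mul1r -b'1 mulr_suml.
apply: ler_sum => t _; rewrite -mulrBr normrM ger0_norm //.
have [->|/b'supp ht] := eqVneq (b' t) 0; first by rewrite !mul0r.
apply: ler_wpM2l => //; apply: dens_smooth smb _; rewrite opprK //.
Qed.

Lemma sum_le_card (G : finComNzRingType) (phi : G -> R) (W P : {set G}) (m : R) :
  (forall x, x \notin P -> phi x = 0) -> 0 <= m -> {in W, forall x, phi x <= m} ->
  \sum_(x in W) phi x <= m * #|P|%:R.
Proof.
move=> supp m0 hm; rewrite (bigID (mem P)) /= [X in _ + X]big1 ?addr0; last first.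
  by move=> x /andP [_ /supp].
rewrite mulr_natr -sumr_const; apply: le_trans (_ : \sum_(x in W | x \in P) m <= _).
  by apply: ler_sum => x /andP [/hm].
rewrite [leRHS](bigID (mem W)) /= (eq_bigl (fun x => (x \in P) && (x \in W))); last by move=> x; rewrite andbC.
by rewrite lerDl sumr_ge0.
Qed.

Lemma pigeonhole_decrease (g : nat -> R) (n : nat) (k M : R) :
  (forall i, 0 <= g i) -> g 0%N <= M -> M < n%:R * k ->
  exists2 i, (i < n)%N & g i <= g i.+1 + k.
Proof.
move=> g0 gM Mk.
have [/exists_inP [i _ hi]|no] := boolP [exists i in 'I_n, g i <= g i.+1 + k].
  by exists i.
exfalso.
have h i : (i <= n)%N -> g i + i%:R * k <= g 0%N.
  elim: i => [|i IH] lin; first by rewrite mul0r addr0.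
  have hi : g i.+1 + k < g i.
    by rewrite ltNge; apply: contra no => hi; apply/exists_inP; exists (Ordinal lin).
  have := IH (ltnW lin); rewrite -natr1 mulrDl mul1r; lra.
have := h n (leqnn n); have := g0 n; lra.
Qed.

Lemma complement_mass (i o N eta : R) : i + o = N -> o <= eta * N -> (1 - eta) * N <= i.
Proof. by move=> <-; lra. Qed.

Definition smooth_model_spec (eta c : R) (r : nat) (G : finComNzRingType) (A B : {set G}) :=
  exists (T C : {set G}) (U V : nat -> {set G}),
  [/\ T \subset A, T != set0, C \subset sdiff A A, 0 \in C & {in C, forall x, - x \in C}] /\
  [/\ c * #|A|%:R <= #|C|%:R,
      forall j, (j < r)%N -> sadd (U j) C \subset U j.+1 /\ sadd (V j) C \subset V j.+1,
      U r \subset sadd (sadd A (sdiff A A)) (sdiff A A) & V r \subset sadd B (sdiff A A)] /\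
  [/\ (1 - eta) * #|sadd (U r) (V r)|%:R <= #|sadd A B|%:R,
      (1 - eta) * #|A|%:R <= \sum_(x in U 0%N) dens A (kernel R T) x &
      (1 - eta) * #|A|%:R <= \sum_(x in V 0%N) dens B (kernel R T) x].

Section OneScale.
Variables (G : finComNzRingType) (A B T C T' : {set G}) (K eta c e' th th0 : R) (r : nat).
Let b := kernel R T.
Let b' := kernel R T'.
Let Gd := [set x | th <= dens A b' x].
Let a := dens A b.
Let d := dens B b.
Let h := dens Gd b.
Let P := sadd (sadd A (sdiff A A)) (sdiff A A).
Let N : R := #|A|%:R.
(** Each constant pays for one loss: [2 * e1 * K = eta] bounds the mass of [d] outside [V 0];
    [2 * e3 = e1 / 2] leaves half of [e1] in [neighbourhood]; [e2] makes the sum of [h] outside [H]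
    at most a quarter of [eta * e3 * N]; [om] is what remains of [th0 * e1 / 2] after the smoothing
    error. *)
Let e1 := eta / (2 * K).
Let e3 := e1 / 4.
Let e2 := eta * e3 / (4 * K).
Let om := th0 * e1 / 4.
Hypotheses (K1 : 1 <= K) (eta0 : 0 < eta) (eta1 : eta <= 1).
Hypothesis bnd : bounded_sums K A B.
Hypotheses (cP : #|P|%:R <= K * N) (cQ : #|sadd B (sdiff A A)|%:R <= K * N).
Hypotheses (TA : T \subset A) (T0 : T != set0) (T'0 : T' != set0).
Hypothesis ref : refines c (e3 / r.+2%:R) (th0 * e1 / 4) (om ^+ 2 * eta / 2) A B T C T'.
Hypotheses (th0p : 0 < th0) (th0th : th0 <= th * e2 / 2) (thle : th <= eta / (8 * K)).
Hypothesis pig : #|[set x | th * e2 / 2 <= a x]|%:R <= #|Gd|%:R + eta * e3 / 4 * N.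
Hypothesis c0 : 0 < c.

(** A translation by an element of [C] changes the densities by at most one step of these
    thresholds. There are [r.+2] steps, not [r], because [neighbourhood] moves by up to two more
    elements of [C]. *)
Let U (j : nat) := [set x | 1 - e3 * (1 + j%:R / r.+2%:R) <= h x].
Let V (j : nat) := [set x | e1 * (2 - j%:R / r.+2%:R) <= d x].

Let b0 y : 0 <= b y. Proof. exact: kernel_ge0. Qed.
Let b1 : \sum_y b y = 1. Proof. exact: sum_kernel. Qed.
Let Kp : 0 < K. Proof. exact: lt_le_trans K1. Qed.
Let e1p : 0 < e1. Proof. by rewrite /e1 divr_gt0 ?mulr_gt0. Qed.
Let e1le : e1 <= 1 / 2.
Proof. by rewrite /e1 ler_pdivrMr ?mulr_gt0 //; move: K1 eta1; lra. Qed.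
Let e3p : 0 < e3. Proof. by rewrite /e3 divr_gt0. Qed.
Let e2p : 0 < e2. Proof. exact: divr_gt0 (mulr_gt0 eta0 e3p) (mulr_gt0 (ltr0Sn _ 3) Kp). Qed.
Let thp : 0 < th.
Proof. by have := lt_le_trans th0p th0th; rewrite -mulrA pmulr_lgt0 // divr_gt0. Qed.
Let omp : 0 < om. Proof. exact: divr_gt0 (mulr_gt0 th0p e1p) (ltr0Sn _ 3). Qed.
Let Np : 0 < N.
Proof. by have [A0 _ _ _ _] := bnd; rewrite ltr0n card_gt0. Qed.
Let e2K : e2 * K = eta * e3 / 4.
Proof. by rewrite /e2; field; rewrite gt_eqF. Qed.
Let thK : th * K <= eta / 8.
Proof.
apply: le_trans (ler_wpM2r (ltW Kp) thle) _; rewrite le_eqVlt; apply/orP; left; apply/eqP.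
by field; rewrite gt_eqF.
Qed.
Let th0le : th0 <= th.
Proof.
apply: le_trans th0th _; rewrite -mulrA ler_piMr ?(ltW thp) //.
have h1 : e2 <= e2 * K by rewrite ler_peMr // ltW.
by move: h1 (e1le) eta1 eta0 e3p; rewrite e2K /e3; nra.
Qed.

Let suppd x : x \notin sadd B (sdiff A A) -> d x = 0.
Proof.
move=> nx; apply: dens_supp; apply: contra nx; apply/subsetP.
by apply: saddS => //; exact: sdiffS.
Qed.

Let supp_dens (T1 : {set G}) x : T1 \subset A -> x \notin sadd A (sdiff A A) -> dens A (kernel R T1) x = 0.
Proof.
move=> T1A nx; apply: dens_supp; apply: contra nx; apply/subsetP.
by apply: saddS => //; exact: sdiffS.
Qed.

Let T'A : T' \subset A. Proof. by have [_ []] := ref. Qed.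

Let GdS : Gd \subset sadd A (sdiff A A).
Proof.
apply/subsetP => x; rewrite inE => hx; apply: contraLR (thp) => nx.
by rewrite -leNgt; apply: le_trans hx _; rewrite (supp_dens T'A nx).
Qed.

Let supph x : x \notin P -> h x = 0.
Proof.
move=> nx; apply: dens_supp; apply: contra nx; apply/subsetP.
by apply: saddS GdS _; exact: sdiffS.
Qed.

Let A00 : 0 \in sdiff A A.
Proof. by have [/set0Pn [s sA] _ _ _ _] := bnd; apply/imset2P; exists s s; rewrite ?subrr. Qed.

Let suppa x : x \notin P -> a x = 0.
Proof.
move=> nx; apply: supp_dens TA _; apply: contra nx; apply/subsetP; exact: sub_saddr.
Qed.

Let thstep j : e3 * (1 + j.+1%:R / r.+2%:R) = e3 * (1 + j%:R / r.+2%:R) + e3 / r.+2%:R.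
Proof. by rewrite -natr1; ring. Qed.

Let UC j : sadd (U j) C \subset U j.+1.
Proof.
have [[_ _ Csym _ smC] _] := ref.
apply/subsetP => _ /saddP [x [t [xU tC ->]]]; move: xU; rewrite !inE thstep => hx.
have := dens_smooth Gd x smC (Csym _ tC); rewrite -/h ler_norml => /andP [h1 _].
by move: h1 hx; move: (h _) (h _) (e3 * (1 + _)) (e3 / _) => u v p q; lra.
Qed.

Let VC j : sadd (V j) C \subset V j.+1.
Proof.
have [[_ _ Csym _ smC] _] := ref.
apply/subsetP => _ /saddP [x [t [xV tC ->]]]; move: xV; rewrite !inE => hx.
have := dens_smooth B x smC (Csym _ tC); rewrite -/d ler_norml => /andP [h1 _].
have -> : e1 * (2 - j.+1%:R / r.+2%:R) = e1 * (2 - j%:R / r.+2%:R) - e1 / r.+2%:R by rewrite -natr1; ring.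
have h3 : e3 / r.+2%:R <= e1 / r.+2%:R.
  by rewrite ler_pM2r ?invr_gt0 // /e3; move: (e1p); lra.
by move: h1 hx h3; move: (d _) (d _) (e1 * (2 - _)) (e3 / _) (e1 / _) => u v s p q; lra.
Qed.

Let massV : (1 - eta) * N <= \sum_(x in V 0%N) d x.
Proof.
have [_ cBA _ _ _] := bnd.
have := sum_dens B b1; rewrite -/d cBA -/N (bigID (mem (V 0%N))) /= => hN.
apply: complement_mass hN _.
have := @sum_le_card G d (~: V 0%N) (sadd B (sdiff A A)) (2 * e1) suppd.
rewrite (eq_bigl (fun x => x \notin V 0%N)); last by move=> x; rewrite inE.
move=> /(_ _ _) hs; apply: le_trans (hs _ _) _.
- by rewrite mulr_ge0 // ltW.
- by move=> x; rewrite !inE -ltNge mul0r subr0 mulrC => /ltW.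
apply: le_trans (ler_wpM2l _ cQ) _; first by rewrite mulr_ge0 // ltW.
by rewrite /e1 le_eqVlt; apply/orP; left; apply/eqP; field; rewrite gt_eqF.
Qed.

Let refine x : `|\sum_u dens A b' u * b (x - u) - a x| <= th0 * e1 / 4.
Proof. by have [_ [_ _ sm _]] := ref; exact: dens_refine. Qed.

Let a_le x : a x <= h x + th + th0 * e1 / 4.
Proof.
have := refine x; rewrite ler_norml => /andP [h1 _].
suff h2 : \sum_u dens A b' u * b (x - u) <= h x + th by move: h1 h2; lra.
have -> : th = \sum_u th * b (x - u) by rewrite -mulr_sumr sum_reflect b1 mulr1.
rewrite /h /dens sum_mem -big_split /=; apply: ler_sum => u _; rewrite -mulrDl.
apply: ler_wpM2r; first exact: b0.
have d1 : dens A b' u <= 1 by apply: dens_le1; [move=> y; exact: kernel_ge0|exact: sum_kernel].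
case: (boolP (u \in Gd)) => [_|]; first by apply: le_trans d1 _; rewrite lerDl ltW.
by rewrite inE -ltNge /= => /ltW; rewrite add0r.
Qed.

Let a_ge x : th * h x - th0 * e1 / 4 <= a x.
Proof.
have := refine x; rewrite ler_norml => /andP [_ h1].
suff h2 : th * h x <= \sum_u dens A b' u * b (x - u) by move: h1 h2; lra.
rewrite /h /dens sum_mem mulr_sumr; apply: ler_sum => u _; rewrite mulrA.
apply: ler_wpM2r; first exact: b0.
case: (boolP (u \in Gd)) => [|_]; first by rewrite inE mulr1.
by rewrite mulr0; apply: dens_ge0 => y; exact: kernel_ge0.
Qed.

Let h_le1 x : h x <= 1. Proof. exact: dens_le1. Qed.
Let a_le1 x : a x <= 1. Proof. exact: dens_le1. Qed.

Let tol : th0 * e1 / 4 <= th0 / 8.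
Proof. by move: (e1le) th0p; nra. Qed.

Let H := [set x | e2 <= h x].

Let cardH : #|H|%:R <= #|Gd|%:R + eta * e3 / 4 * N.
Proof.
apply: le_trans pig; rewrite ler_nat subset_leq_card //; apply/subsetP => x; rewrite !inE => hx.
apply: le_trans (a_ge x).
have : th * e2 <= th * h x by rewrite ler_pM2l.
move: tol th0th th0p; move: (th * e2) (th * h x) (th0 * e1) => p q s; lra.
Qed.

(** [h] has total mass |Gd|, and by [cardH] the set [H] has hardly more than |Gd| points, so [1 - h]
    has a small sum over [H]; off [U 0] it exceeds [e3]. *)
Let bad_neighbourhood : #|H :\: U 0%N|%:R <= eta / 2 * N.
Proof.
rewrite -(ler_pM2l e3p).
apply: le_trans (_ : \sum_(x in H) (1 - h x) <= _).
  rewrite mulr_natr -sumr_const [leRHS](bigID (mem (U 0%N))) /= addrC.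
  rewrite (eq_bigl (fun x => (x \in H) && (x \notin U 0%N))); last by move=> x; rewrite /= in_setD andbC.
  rewrite ler_wpDr ?sumr_ge0 //; first by move=> x _; rewrite subr_ge0.
  apply: ler_sum => x /andP [_]; rewrite inE -ltNge mul0r addr0 mulr1.
  by move=> /ltW; lra.
rewrite sumrB sumr_const.
have := sum_dens Gd b1; rewrite -/h (bigID (mem H)) /= => hsum.
have hout : \sum_(x | x \notin H) h x <= e2 * (K * N).
  have := @sum_le_card G h (~: H) P e2 supph (ltW e2p).
  rewrite (eq_bigl (fun x => x \notin H)); last by move=> x; rewrite inE.
  move=> hs; apply: le_trans (hs _) _; first by move=> x; rewrite !inE -ltNge => /ltW.
  by apply: ler_wpM2l => //; exact: ltW.
have -> : e3 * (eta / 2 * N) = eta * e3 / 4 * N + e2 * (K * N).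
  by rewrite [e2 * _]mulrA e2K; move: (e3) => q; field.
move: hsum hout cardH; move: (\sum_(x in H) h x) (\sum_(x | x \notin H) h x) (#|H|%:R : R) (#|Gd|%:R : R) => p q s s'.
by rewrite -mulr_natr; move: (eta * e3 / 4 * N) (e2 * (K * N)) => ? ?; lra.
Qed.

Let massU : (1 - eta) * N <= \sum_(x in U 0%N) a x.
Proof.
have := sum_dens A b1; rewrite -/a -/N (bigID (mem (U 0%N))) /= => hN.
apply: complement_mass hN _; rewrite (bigID (mem H)) /=.
have h1 : \sum_(x | (x \notin U 0%N) && (x \in H)) a x <= eta / 2 * N.
  apply: le_trans bad_neighbourhood; rewrite -sum1_card natr_sum.
  rewrite [leRHS](eq_bigl (fun x => (x \notin U 0%N) && (x \in H))); last by move=> x; rewrite in_setD.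
  by apply: ler_sum => x _; exact: a_le1.
have h2 : \sum_(x | (x \notin U 0%N) && (x \notin H)) a x <= eta / 2 * N.
  have := @sum_le_card G a (~: (U 0%N :|: H)) P (e2 + th + th0 * e1 / 4) suppa.
  rewrite (eq_bigl (fun x => (x \notin U 0%N) && (x \notin H))); last by move=> x; rewrite in_setC in_setU negb_or.
  move=> hs; apply: le_trans (hs _ _) _.
  - by rewrite !addr_ge0 // ltW.
  - move=> x; rewrite !inE => /norP [_]; rewrite -ltNge => /ltW hx.
    by apply: le_trans (a_le x) _; rewrite !lerD2r.
  apply: le_trans (ler_wpM2l _ cP) _; first by rewrite !addr_ge0 // ltW.
  rewrite mulrA ler_pM2r // !mulrDl e2K.
  have h3 : th0 * e1 / 4 * K <= th * K.
    rewrite ler_pM2r //; move: tol th0le th0p; lra.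
  by move: thK h3 eta0 e1le; rewrite /e3; nra.
by apply: le_trans (lerD h1 h2) _; rewrite -mulrDl -splitr.
Qed.

Let good x := \sum_z (\sum_t b' t * local_conv A B b x (z - t) - local_conv A B b x z) ^+ 2
  <= om ^+ 2 * eta * #|C|%:R.

Let Cp : 0 < #|C|%:R :> R.
Proof. by have [[_ C00 _ _ _] _] := ref; rewrite ltr0n card_gt0; apply/set0Pn; exists 0. Qed.

Let few_bad : (#|[set x | ~~ good x]| < #|C|)%N.
Proof.
have [_ [_ _ _ hper]] := ref.
have b'1 : \sum_y b' y = 1 by exact: sum_kernel.
have b'0 y : 0 <= b' y by exact: kernel_ge0.
pose err x := \sum_z (\sum_t b' t * local_conv A B b x (z - t) - local_conv A B b x z) ^+ 2.
have tot : \sum_x err x <= om ^+ 2 * eta / 2 * #|C|%:R ^+ 2.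
  apply: le_trans (_ : \sum_x \sum_z \sum_t b' t * (local_conv A B b x (z - t) - local_conv A B b x z) ^+ 2 <= _).
    apply: ler_sum => x _; apply: ler_sum => z _.
    apply: le_trans (convex_sq _ setT b'0 b'1); rewrite le_eqVlt; apply/orP; left; apply/eqP.
    congr (_ ^+ 2); under [RHS]eq_bigr => t _ do rewrite mulrBr.
    by rewrite sumrB -mulr_suml b'1 mul1r.
  rewrite (eq_bigr (fun x => \sum_t b' t * \sum_z (local_conv A B b x (z - t) - local_conv A B b x z) ^+ 2)); last first.
    by move=> x _; rewrite exchange_big /=; apply: eq_bigr => t _; rewrite mulr_sumr.
  rewrite exchange_big /= -[leRHS]mul1r -[X in _ <= X * _]b'1 mulr_suml; apply: ler_sum => t _.
  rewrite -mulr_sumr; have [->|h1] := eqVneq (b' t) 0; first by rewrite !mul0r.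
  apply: ler_wpM2l => //.
  apply: (hper t); apply: contraNT h1 => /kernel_supp h1.
  by rewrite /b' h1.
rewrite ltnNge; apply/negP => hC.
have : om ^+ 2 * eta * #|C|%:R * #|C|%:R <= \sum_x err x.
  apply: le_trans (_ : om ^+ 2 * eta * #|C|%:R * #|[set x | ~~ good x]|%:R <= _).
    rewrite ler_wpM2l ?ler_nat //.
    exact: ltW (mulr_gt0 (mulr_gt0 (exprn_gt0 2 omp) eta0) Cp).
  rewrite mulr_natr -sumr_const [leRHS](bigID (mem [set x | ~~ good x])) /=.
  rewrite ler_wpDr //; first by apply: sumr_ge0 => x _; apply: sumr_ge0 => z _; exact: sqr_ge0.
  by apply: ler_sum => x; rewrite inE -ltNge => /ltW.
have := mulr_gt0 (mulr_gt0 (exprn_gt0 2 omp) eta0) (exprn_gt0 2 Cp).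
move: tot; rewrite expr2; move: (\sum_x err x) => X; move: (om * om) (#|C|%:R : R) => p q.
nra.
Qed.

(** With fewer than |C| bad centres, some [x + t] with t in [C] is good, and [y - t] compensates.
    For u in [C] with [x + y + u] outside [A + B] the localised convolution is 0 while its smoothing
    is at least [om]; goodness allows at most eta|C| such u. *)
Let neighbourhood x y : x \in U r -> y \in V r ->
  (1 - eta) * #|C|%:R <= #|[set t in C | x + y + t \in sadd A B]|%:R.
Proof.
move=> xU yV.
have [[_ C00 Csym _ _] [_ _ smT' _]] := ref.
have [t tC ht] : exists2 t, t \in C & good (x + t).
  apply/exists_inP; apply: contraT => /exists_inPn no.
  have := few_bad; rewrite ltnNge => /negP []; rewrite -(card_sadd1 x C).
  apply: subset_leq_card; apply/subsetP => z; rewrite sadd1P inE => /no.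
  by rewrite addrC subrK.
set x' := x + t; set y' := y - t.
have x'U : x' \in U r.+1 by apply: (subsetP (UC r)); rewrite mem_sadd.
have y'V : y' \in V r.+1 by apply: (subsetP (VC r)); rewrite mem_sadd // Csym.
set D := sadd A B; rewrite mulrBl mul1r lerBlDr.
have {1}-> : #|C|%:R = #|[set t in C | x + y + t \in D]|%:R + #|[set t in C | x + y + t \notin D]|%:R :> R.
  rewrite -natrD -(cardsID [set t | x + y + t \in D] C); congr ((_ + _)%:R); apply: eq_card => u.
    by rewrite !inE.
  by rewrite !inE andbC.
rewrite lerD2l -(ler_pM2l (exprn_gt0 2 omp)) [leRHS]mulrA; apply: le_trans (ht : _ <= om ^+ 2 * eta * #|C|%:R).
rewrite mulr_natr -sumr_const -(sum_shiftl (x + y)) [leRHS](bigID (mem [set t in C | x + y + t \notin D])) /=.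
rewrite ler_wpDr //; first by apply: sumr_ge0 => u _; exact: sqr_ge0.
apply: ler_sum => u; rewrite inE => /andP [uC nD].
rewrite local_conv_out // subr0.
apply: lerXn2r; rewrite ?nnegrE ?(ltW omp) //.
  apply: sumr_ge0 => s _; rewrite mulr_ge0 ?kernel_ge0 // sumr_ge0 // => v _.
  by rewrite mulr_ge0 ?kernel_ge0.
apply: le_trans (smoothed_local_conv A B x' (x + y + u) T0 T'0 (ltW thp) smT').
have hd : e1 <= d (x + y + u - x').
  have -> : x + y + u - x' = y' + u by rewrite /x' /y'; ring.
  have : y' + u \in V r.+2 by apply: (subsetP (VC r.+1)); rewrite mem_sadd.
  by rewrite inE divff ?pnatr_eq0 // => hx; apply: le_trans hx; rewrite [2 - 1](_ : _ = 1) ?mulr1 //; ring.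
have hh : 1 - h x' <= e1 / 2.
  have h3 : e3 * (1 + r.+1%:R / r.+2%:R) <= e3 * 2.
    by rewrite ler_pM2l // (_ : 2 = 1 + 1) // lerD2l ler_pdivrMr // mul1r ler_nat.
  by move: x'U h3; rewrite inE; move: (h x') (e3 * (1 + _)) => u' p; rewrite /e3; lra.
rewrite -/d -/h /om.
have : th0 * (e1 / 2) <= th * (d (x + y + u - x') - (1 - h x')).
  apply: ler_pM; [exact: ltW|exact: ltW (divr_gt0 e1p (ltr0Sn _ 1))|exact: th0le|].
  by move: hd hh; move: (d _) (h x') => p q; lra.
by move: (th * _) => p; lra.
Qed.

(** Double counting of the pairs (z, t) with t in [C] and z + t in [A + B]: each t accounts for at
    most |A + B| of them. *)
Let sumUV : (1 - eta) * #|sadd (U r) (V r)|%:R <= #|sadd A B|%:R.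
Proof.
rewrite -(ler_pM2r Cp).
apply: le_trans (_ : \sum_(z in sadd (U r) (V r)) (1 - eta) * #|C|%:R <= _).
  by rewrite sumr_const -[leRHS]mulr_natr mulrAC lexx.
apply: le_trans (_ : \sum_(z in sadd (U r) (V r)) #|[set t in C | z + t \in sadd A B]|%:R <= _).
  by apply: ler_sum => _ /saddP [x [y [xU yV ->]]]; exact: neighbourhood.
rewrite -natr_sum -natrM ler_nat.
apply: (@leq_trans (\sum_z \sum_(t in C) ((z + t)%R \in sadd A B))%N).
  rewrite [X in (_ <= X)%N](bigID (mem (sadd (U r) (V r)))) /=; apply: leq_trans (leq_addr _ _).
  apply: leq_sum => z _; rewrite -sum1_card big_mkcond [X in (_ <= X)%N]big_mkcond /=.
  by apply: leq_sum => t _; rewrite inE; case: (t \in C) => //; case: (_ \in _).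
rewrite exchange_big /= mulnC -sum_nat_const; apply: leq_sum => t _.
by rewrite (sum_shift t (fun z => (z \in sadd A B) : nat)) -sum1_card [X in (_ <= X)%N]big_mkcond /=; apply: leq_sum => z _; case: (_ \in _).
Qed.

Lemma one_scale_model : smooth_model_spec eta c r A B.
Proof.
have [[h1 h2 h3 h4 _] _] := ref.
exists T, C, U, V; split; first by split.
split; last by split.
split => //.
  apply/subsetP => x; rewrite inE => hx; apply: contraT => /supph hx0.
  have h5 : e3 * (1 + r%:R / r.+2%:R) <= e3 * 2.
    by rewrite ler_pM2l // (_ : 2 = 1 + 1) // lerD2l ler_pdivrMr // mul1r ler_nat leqW.
  by move: hx h5 e1le e1p; rewrite hx0; move: (e3 * (_ + _)) => p; rewrite /e3; lra.
apply/subsetP => x; rewrite inE => hx; apply: contraT => /suppd hx0.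
have h6 : r%:R / r.+2%:R <= 1 :> R by rewrite ler_pdivrMr // mul1r ler_nat leqW.
have h7 : e1 * (r%:R / r.+2%:R) <= e1 * 1 by rewrite ler_pM2l.
by move: hx h7 e1p; rewrite hx0 mulrBr; move: (e1 * (_ / _)) => p; lra.
Qed.

End OneScale.

Theorem smooth_model (K eta : R) (r : nat) : 1 <= K -> 0 < eta -> eta <= 1 -> exists2 c : R, 0 < c &
  forall (G : finComNzRingType) (A B : {set G}), bounded_sums K A B ->
    #|sadd (sadd A (sdiff A A)) (sdiff A A)|%:R <= K * #|A|%:R ->
    #|sadd B (sdiff A A)|%:R <= K * #|A|%:R ->
    smooth_model_spec eta c r A B.
Proof.
move=> K1 eta0 eta1.
have Kp : 0 < K by exact: lt_le_trans K1.
pose e1 := eta / (2 * K); pose e3 := e1 / 4; pose e2 := eta * e3 / (4 * K).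
have e1p : 0 < e1 by rewrite /e1 divr_gt0 ?mulr_gt0.
have e3p : 0 < e3 by rewrite /e3 divr_gt0.
have e2p : 0 < e2 by exact: divr_gt0 (mulr_gt0 eta0 e3p) (mulr_gt0 (ltr0Sn _ 3) Kp).
have e1le : e1 <= 1 / 2 by rewrite /e1 ler_pdivrMr ?mulr_gt0 //; move: K1 eta1; lra.
have e2le : e2 / 2 <= 1.
  have h1 : e2 <= e2 * K by rewrite ler_peMr // ltW.
  have e2K : e2 * K = eta * e3 / 4 by rewrite /e2; field; rewrite gt_eqF.
  by move: h1 e1le eta1 eta0 e3p; rewrite e2K /e3; nra.
pose k := eta * e3 / 4; have kp : 0 < k by exact: divr_gt0 (mulr_gt0 eta0 e3p) (ltr0Sn _ 3).
(* The level sets have at most K|A| points, so among more than K/k scales one step does not lose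
   more than k|A|. *)
have [n n0 hn] := exists_nat_ge ((K + 1) / k).
have hn' : K < n%:R * k.
  by apply: lt_le_trans (_ : K + 1 <= _); [rewrite ltrDl|rewrite -ler_pdivrMr].
(* Thresholds grow geometrically with the fineness, so that the coarse level set at threshold [th i]
   is the one [one_scale_model] compares with the fine level set at [th i.+1]. The smallest, [th 0],
   sets all tolerances beforehand. *)
pose th (i : nat) := eta / (8 * K) * (e2 / 2) ^+ (n - i).
have p8 : 0 < eta / (8 * K) by exact: divr_gt0 eta0 (mulr_gt0 (ltr0Sn _ 7) Kp).
have e22 : 0 < e2 / 2 by exact: divr_gt0 e2p (ltr0Sn _ 1).
have thp i : 0 < th i by exact: mulr_gt0 p8 (exprn_gt0 _ e22).
have th_le i : th i <= eta / (8 * K).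
  by apply: ler_piMr; [exact: ltW|apply: exprn_ile1 => //; exact: ltW].
have th0_le i : th 0%N <= th i.
  rewrite ler_pM2l // subn0.
  by apply: ler_wiXn2l; rewrite ?leq_subr // ltW.
have thS i : (i < n)%N -> th i = th i.+1 * e2 / 2.
  move=> lin; rewrite /th -(subnSK lin) exprSr; move: (eta / _) (_ ^+ _) => p q.
  by rewrite !mulrA.
pose om := th 0%N * e1 / 4.
have omp : 0 < om by exact: divr_gt0 (mulr_gt0 (thp 0%N) e1p) (ltr0Sn _ 3).
have [c cp hseq] := @refinement_sequence R K (e3 / r.+2%:R) (th 0%N * e1 / 4) (om ^+ 2 * eta / 2) n Kp
  (divr_gt0 e3p (ltr0Sn _ r.+1)) omp (divr_gt0 (mulr_gt0 (exprn_gt0 2 omp) eta0) (ltr0Sn _ _)).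
exists c => // G A B bnd cP cQ.
have [T [C [T0A _ _ href]]] := hseq _ _ _ bnd.
have [A0 _ _ _ _] := bnd.
have Np : 0 < #|A|%:R :> R by rewrite ltr0n card_gt0.
have TA i : (i <= n)%N -> T i \subset A /\ T i != set0.
  case: i => [_|i lin]; first by rewrite T0A.
  have [_ [h1 h2 _ _]] := href i lin; split => //.
  by rewrite -card_gt0 -(ltr0n R); apply: lt_le_trans h2; rewrite mulr_gt0.
pose g i : R := #|[set x | th i <= dens A (kernel R (T i)) x]|%:R.
have gp i : 0 <= g i by rewrite /g.
have g0K : g 0%N <= K * #|A|%:R.
  apply: le_trans cP; rewrite ler_nat subset_leq_card //.
  apply/subsetP => x; rewrite inE T0A => hx.
  have A00 : 0 \in sdiff A A by case/set0Pn: A0 => s sA; apply/imset2P; exists s s; rewrite ?subrr.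
  apply: (subsetP (sub_saddr _ A00)); apply: contraT => /(dens_supp R) h0.
  by move: hx; rewrite h0 leNgt thp.
have Kn : K * #|A|%:R < n%:R * (k * #|A|%:R) by rewrite mulrA ltr_pM2r.
have [i lin hi] := pigeonhole_decrease gp g0K Kn.
have [TiA Ti0] := TA i (ltnW lin).
have [_ Ti10] := TA i.+1 lin.
apply: (@one_scale_model G A B (T i) (C i) (T i.+1) K eta c (th i.+1) (th 0%N) r) => //.
- exact: href.
- by rewrite -thS.
by move: hi; rewrite /g thS.
Qed.

End SmoothModel.

(** * Critical pairs in cyclic groups *)

Section Shrink.
Variables (R : realFieldType) (G : finComNzRingType).
Implicit Types (B C E F X Y Z : {set G}).

Lemma card_setD_add X Y : (#|X :\: Y| + #|Y| = #|X :|: Y|)%N.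
Proof.
rewrite addnC -(cardsID Y (X :|: Y)); congr (_ + _)%N; apply: eq_card => x; rewrite !inE.
  by case: (x \in X); case: (x \in Y).
by case: (x \in X); case: (x \in Y).
Qed.

Lemma sadd_submodular Z X Y :
  (#|sadd Z (X :&: Y)| + #|sadd Z (X :|: Y)| <= #|sadd Z X| + #|sadd Z Y|)%N.
Proof.
rewrite saddU addnC -(cardsUI (sadd Z X)) leq_add2l; apply: subset_leq_card.
by rewrite subsetI !saddS // ?subsetIl ?subsetIr.
Qed.

Lemma sum_card_inter_shift F : (\sum_t #|F :&: sadd [set t] F| = #|F| ^ 2)%N.
Proof.
have E t : #|F :&: sadd [set t] F| = (\sum_(x in F) ((x - t)%R \in F))%N.
  rewrite -sum1_card big_mkcond [RHS]big_mkcond /=; apply: eq_bigr => x _.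
  by rewrite inE sadd1P; case: (x \in F); case: (_ \in F).
under eq_bigr => t _ do rewrite E.
rewrite exchange_big /= -mulnn -[RHS]sum_nat_const; apply: eq_bigr => x _.
rewrite -[RHS]sum1_card [RHS]big_mkcond /= (reindex_inj (inv_inj (subKr x))) /=.
by apply: eq_bigr => t _; rewrite subKr; case: (_ \in _).
Qed.

Lemma shrink_step C E F (eps x : R) : 0 \in C -> generating C -> E != set0 -> F != set0 ->
  0 < eps -> eps < 1 -> #|E|%:R + #|F|%:R <= (1 - eps) * #|G|%:R ->
  #|sadd (sadd E (sadd C C)) F|%:R <= #|E|%:R + #|F|%:R + x -> x <= eps / 8 * #|F|%:R ->
  exists2 F' : {set G}, F' \subset F &
    [/\ (1 / 2) * #|F|%:R <= #|F'|%:R :> R, #|F'|%:R <= (1 - eps / 4) * #|F|%:R &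
      #|sadd (sadd E (sadd C C)) F'|%:R <= #|E|%:R + #|F'|%:R + 2 * x].
Proof.
move=> C0 gC E0 F0 eps0 eps1 hEF hx xF; set Z := sadd E (sadd C C).
have Fp : 0 < #|F|%:R :> R by rewrite ltr0n card_gt0.
have Ep : 0 < #|E|%:R :> R by rewrite ltr0n card_gt0.
have FG : #|F|%:R <= #|G|%:R :> R by rewrite ler_nat max_card.
have CE X : sadd Z X = sadd (sadd E (sadd X C)) C.
  rewrite -[RHS]saddA -[sadd (sadd X C) C]saddA /Z -saddA; congr (sadd E _); exact: saddC.
have lowZ X : X != set0 -> #|E|%:R + #|X|%:R <= #|G|%:R :> R -> #|E|%:R + #|X|%:R <= #|sadd Z X|%:R :> R.
  move=> X0 h; have := card_sadd_generating C0 gC E0 X0.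
  rewrite -(ler_nat R) (minn_idPr _); last by rewrite -(ler_nat R) natrD.
  rewrite natrD => h'; apply: le_trans h' _; rewrite ler_nat subset_leq_card // CE saddS //.
  by apply: saddS => //; exact: sub_saddr.
have FC : #|sadd F C|%:R <= #|F|%:R + x.
  have Cn0 : C != set0 by apply/set0Pn; exists 0.
  have := card_sadd_generating C0 gC E0 (sadd_neq0 F0 Cn0).
  rewrite -CE geq_min => /orP []; rewrite -(ler_nat R).
    by move: hx hEF xF FG Fp; rewrite -/Z; nra.
  by rewrite natrD; move: hx; rewrite -/Z; lra.
pose r t := #|F :&: sadd [set t] F|.
pose S := [set t | (1 - eps / 4) * #|F|%:R < (r t)%:R].
have S0 : 0 \in S.
  rewrite inE /r (_ : sadd [set 0] F = F) ?setIid; last by rewrite saddC sadd0.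
  by rewrite gtr_pMl //; lra.
have [t tS [c cC tc]] : exists2 t, t \in S & exists2 c, c \in C & t + c \notin S.
  case: (boolP (sadd S C \subset S)) => [SC|/subsetPn [_ /saddP [t [c [tS cC ->]]] h]]; last by exists t => //; exists c.
  have ST := gC _ S0 SC.
  have : \sum_(t : G) (1 - eps / 4) * #|F|%:R <= \sum_t (r t)%:R :> R.
    by apply: ler_sum => t _; have : t \in S; [rewrite ST inE|rewrite inE => /ltW].
  have -> : \sum_(t : G) (1 - eps / 4) * #|F|%:R = (1 - eps / 4) * #|F|%:R * #|G|%:R :> R.
    by rewrite sumr_const -[LHS]mulr_natr; congr (_ * _%:R); exact: eq_card.
  rewrite -natr_sum sum_card_inter_shift natrX expr2 mulrAC ler_pM2r // => h; exfalso.
  by move: h hEF Ep; nra.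
exists (F :&: sadd [set (t + c)%R] F); first exact: subsetIl.
set F' := F :&: _; set X := F :|: sadd [set (t + c)%R] F.
have cX : #|X|%:R + #|F'|%:R = 2 * #|F|%:R :> R.
  by rewrite -natrD cardsUI card_sadd1 natrD; ring.
have rt : #|F|%:R * (1 - eps / 4) < (r t)%:R by move: tS; rewrite inE mulrC.
have rtc : #|F'|%:R <= (1 - eps / 4) * #|F|%:R by move: tc; rewrite inE -leNgt.
have rr : (r t)%:R <= #|F'|%:R + x.
  apply: le_trans (_ : #|F'|%:R + (#|sadd F C|%:R - #|F|%:R) <= _); last by move: FC; lra.
  rewrite addrA lerBrDr -!natrD ler_nat.
  have h1 : (#|F :&: sadd [set t] F| <= #|F'| + #|sadd [set t] F :\: sadd [set (t + c)%R] F|)%N.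
    apply: (@leq_trans #|F' :|: (sadd [set t] F :\: sadd [set (t + c)%R] F)|); last by rewrite cardsU leq_subr.
    apply: subset_leq_card; apply/subsetP => u; rewrite !inE => /andP [-> ->] /=.
    by rewrite andbT; case: (_ \in _).
  have h2 : (#|sadd [set t] F :\: sadd [set (t + c)%R] F| + #|F| <= #|sadd F C|)%N.
    rewrite -(card_sadd1 (t + c) F) -(card_sadd1 t (sadd F C)) card_setD_add.
    apply: subset_leq_card; apply/subUsetP; split.
      by apply: saddS => //; exact: sub_saddr.
    apply/subsetP => u; rewrite !sadd1P => h; apply/saddP; exists (u - (t + c)), c; split => //; ring.
  by apply: leq_trans (leq_add h1 (leqnn _)) _; rewrite -addnA leq_add2l.
have eF : eps * #|F|%:R <= #|F|%:R by rewrite ger_pMl // ltW.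
have eFG : eps * #|F|%:R <= eps * #|G|%:R by rewrite ler_pM2l.
have eG : 0 <= eps * #|G|%:R by rewrite mulr_ge0 // ltW.
have F'lo : 1 / 2 * #|F|%:R <= #|F'|%:R :> R.
  by move: rt rr xF eF; lra.
have X0 : X != set0 by case/set0Pn: F0 => u uF; apply/set0Pn; exists u; rewrite inE uF.
have XG : #|E|%:R + #|X|%:R <= #|G|%:R :> R by move: cX rt rr xF hEF eFG eG; lra.
split => //.
have := sadd_submodular Z F (sadd [set (t + c)%R] F).
rewrite -(ler_nat R) !natrD -/F' -/X.
have -> : #|sadd Z (sadd [set (t + c)%R] F)| = #|sadd Z F|.
  by rewrite [sadd [set _] F]saddC saddA saddC card_sadd1.
have := lowZ X X0 XG; move: cX hx; rewrite -/Z; lra.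
Qed.

(** Each round at most doubles the defect and removes a proportion of [F] between [eps / 4] and 1/2;
    the last hypothesis keeps the defect admissible through all [m] rounds. *)
Lemma shrink C E F (eps x : R) (m : nat) : 0 \in C -> generating C -> E != set0 -> F != set0 ->
  0 < eps -> eps < 1 -> #|E|%:R + #|F|%:R <= (1 - eps) * #|G|%:R -> 0 <= x ->
  #|sadd (sadd E (sadd C C)) F|%:R <= #|E|%:R + #|F|%:R + x ->
  2 ^+ m * x <= eps / 8 * ((1 / 2) ^+ m * #|F|%:R) ->
  exists2 F' : {set G}, F' != set0 &
    [/\ (1 / 2) ^+ m * #|F|%:R <= #|F'|%:R :> R, #|F'|%:R <= (1 - eps / 4) ^+ m * #|F|%:R &
      #|sadd (sadd E (sadd C C)) F'|%:R <= #|E|%:R + #|F'|%:R + 2 ^+ m * x].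
Proof.
move=> C0 gC E0 F0 eps0 eps1 hEF x0 hx hm.
have Fp : 0 < #|F|%:R :> R by rewrite ltr0n card_gt0.
have hi i : (i <= m)%N -> exists2 F' : {set G}, F' \subset F &
    [/\ (1 / 2) ^+ i * #|F|%:R <= #|F'|%:R :> R, #|F'|%:R <= (1 - eps / 4) ^+ i * #|F|%:R &
      #|sadd (sadd E (sadd C C)) F'|%:R <= #|E|%:R + #|F'|%:R + 2 ^+ i * x].
  elim: i => [|i IH] lim; first by exists F => //; rewrite !expr0 !mul1r.
  have [F1 F1F [h1 h2 h3]] := IH (ltnW lim).
  have F1p : 0 < #|F1|%:R :> R by apply: lt_le_trans h1; rewrite mulr_gt0 ?exprn_gt0 ?divr_gt0.
  have F10 : F1 != set0 by rewrite -card_gt0 -(ltr0n R).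
  have cF1 : #|F1|%:R <= #|F|%:R :> R by rewrite ler_nat subset_leq_card.
  have h4 : 2 ^+ i * x <= eps / 8 * #|F1|%:R.
    apply: le_trans (_ : 2 ^+ m * x <= _).
      by apply: ler_wpM2r => //; apply: ler_weXn2l; [lra|exact: ltnW].
    apply: le_trans hm _; rewrite ler_pM2l ?divr_gt0 //; apply: le_trans h1.
    by rewrite ler_pM2r //; apply: ler_wiXn2l; [lra|lra|exact: ltnW].
  have hEF1 : #|E|%:R + #|F1|%:R <= (1 - eps) * #|G|%:R by move: hEF cF1; lra.
  have [F2 F2F1 [k1 k2 k3]] := shrink_step C0 gC E0 F10 eps0 eps1 hEF1 h3 h4.
  exists F2; first exact: subset_trans F1F.
  split.
  - apply: le_trans k1; rewrite exprS -mulrA ler_wpM2l //; lra.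
  - apply: le_trans k2 _; rewrite exprS -mulrA ler_wpM2l //; lra.
  - by rewrite exprS -mulrA.
have [F' _ [h1 h2 h3]] := hi m (leqnn m).
exists F' => //; rewrite -card_gt0 -(ltr0n R).
by apply: lt_le_trans h1; rewrite mulr_gt0 ?exprn_gt0 ?divr_gt0.
Qed.

End Shrink.

(** * Linear growth of iterated sumsets *)

Section Growth.
Variable G : finComNzRingType.
Implicit Types (B C E F X Y Z : {set G}) (s t : G).

(** Half of the symmetric difference of [E] and [s + E]; subadditive and even in [s]. *)
Definition period_defect E s := #|sadd [set s] E :\: E|.

Lemma period_defectD E s t : (period_defect E (s + t)%R <= period_defect E s + period_defect E t)%N.
Proof.
rewrite /period_defect -(card_sadd1 t (sadd [set s] E :\: E)).
apply: (@leq_trans #|sadd [set t] (sadd [set s] E :\: E) :|: (sadd [set t] E :\: E)|); last by rewrite cardsU leq_subr.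
apply: subset_leq_card; apply/subsetP => u; rewrite !inE !sadd1P !inE !sadd1P => /andP [-> h] /=.
by rewrite (_ : u - t - s = u - (s + t)) ?h; [case: (_ \in _)|ring].
Qed.

Lemma period_defectN E s : period_defect E (- s) = period_defect E s.
Proof.
rewrite /period_defect -(card_sadd1 s (sadd [set - s] E :\: E)).
have -> : sadd [set s] (sadd [set - s] E :\: E) = E :\: sadd [set s] E.
  by apply/setP => u; rewrite !(inE, sadd1P) opprK subrK.
by apply/eqP; rewrite -(eqn_add2l #|E :&: sadd [set s] E|) cardsID setIC cardsID card_sadd1.
Qed.

(** With t = b/e this reads (1 + 2t)^i <= 1 + 4it for 4it <= 1. *)
Lemma bernoulli_le (e b i : nat) : (4 * i * b <= e -> (e + 2 * b) ^ i * e <= e ^ i * (e + 4 * i * b))%N.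
Proof.
elim: i => [|i IH] h; first by rewrite !expn0 !mul1n; lia.
have {}IH := IH ltac:(nia).
rewrite [((_ + _) ^ _)%N]expnS -mulnA; apply: leq_trans (leq_mul (leqnn _) IH) _.
rewrite mulnCA [(e ^ i.+1)%N]expnSr -[X in (_ <= X)%N]mulnA leq_mul2l; apply/orP; right.
nia.
Qed.

(** Petridis gives [X] inside [E] with |X + iB| <= |X| + 4ib; comparing with the lower bound |X + iB
    + C| >= |X| + |iB| and cancelling |X| leaves |iB| = O(ib). Conversely each further copy of [B]
    contains [B0 + C] and adds at least b elements. The size hypotheses keep every sumset below
    |G|. *)
Lemma linear_growth C E B0 n : 0 \in C -> generating C -> E != set0 -> 0 \in B0 ->
  let B := sadd B0 C in let b := #|B0| in
  (#|sadd (sadd E (sadd C C)) B0| <= #|E| + 2 * b)%N ->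
  (4 * n.+2 * b <= #|E|)%N -> (#|E| + 4 * n.+2 * b < #|G|)%N ->
  forall i, (i <= n)%N -> [/\ (i * b <= #|smul i B|)%N, (#|smul i B| <= 4 * i.+1 * b)%N &
    {in smul i B, forall s, (period_defect E s <= 2 * i * b)%N}].
Proof.
move=> C0 gC E0 B00 B b hE hbE hG.
have b0 : (0 < b)%N by rewrite /b card_gt0; apply/set0Pn; exists 0.
have B0n : B0 != set0 by apply/set0Pn; exists 0.
have BB0 : B != set0 by apply: sadd_neq0 => //; apply/set0Pn; exists 0.
have CB : C \subset B by rewrite /B saddC; exact: sub_saddr.
have EB : (#|sadd E B| <= #|E| + 2 * b)%N.
  apply: leq_trans hE; apply: subset_leq_card.
  rewrite -saddA [sadd (sadd C C) B0]saddC [sadd B0 (sadd C C)]saddA.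
  by apply: saddS => //; exact: sub_saddr.
have [X [X0 XE hX]] := petridis_smul B E0.
have E0' : (0 < #|E|)%N by rewrite card_gt0.
have XEc : (#|X| <= #|E|)%N by exact: subset_leq_card.
have up i : (i <= n.+1)%N -> (#|sadd X (smul i B)| <= #|X| + 4 * i * b)%N.
  move=> lin.
  have h1 : (4 * i * b <= #|E|)%N by nia.
  have h2 := bernoulli_le h1.
  have h3 : (#|sadd E B| ^ i <= (#|E| + 2 * b) ^ i)%N by case: (i) => // k; rewrite leq_exp2r.
  have h4 := leq_trans (hX i) (leq_mul h3 (leqnn #|X|)).
  have h5 : (#|E| ^ i * (#|sadd X (smul i B)| * #|E|) <= #|E| ^ i * ((#|E| + 4 * i * b) * #|X|))%N.
    apply: (@leq_trans ((#|E| + 2 * b) ^ i * #|X| * #|E|)%N).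
      by rewrite mulnA leq_mul2r [(_ ^ i * _)%N]mulnC h4 orbT.
    by rewrite mulnAC [in X in (_ <= X)%N]mulnA leq_mul2r h2 orbT.
  move: h5; rewrite leq_pmul2l ?expn_gt0 ?E0' // => h5.
  by rewrite -(leq_pmul2r E0'); apply: leq_trans h5 _; nia.
have upper i : (i <= n)%N -> (#|smul i B| <= 4 * i.+1 * b)%N.
  move=> lin; have := card_sadd_generating C0 gC X0 (smul_neq0 i BB0).
  have h1 : (#|sadd (sadd X (smul i B)) C| <= #|X| + 4 * i.+1 * b)%N.
    by apply: leq_trans (up i.+1 lin); apply: subset_leq_card; rewrite -saddA saddS //= saddS.
  have h2 : (#|X| + 4 * i.+1 * b < #|G|)%N by nia.
  move=> h3; have := leq_trans h3 h1; rewrite geq_min => /orP []; lia.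
move=> i lin; split; last 1 first.
- have one s : s \in B -> (period_defect E s <= 2 * b)%N.
    move=> sB; rewrite -(leq_add2l #|E|); apply: leq_trans EB.
    rewrite /period_defect addnC card_setD_add.
    apply: subset_leq_card; apply/subUsetP; split; first exact: sadd1_sub.
    by apply: sub_saddr; apply: (subsetP CB).
  elim: i {lin} => [|i IH] s /=.
    move=> /set1P ->; rewrite /period_defect (_ : sadd [set 0] E = E) ?setDv ?cards0 //.
    by rewrite saddC sadd0.
  move=> /saddP [u [v [/IH hu /one hv ->]]]; apply: leq_trans (period_defectD _ _ _) _; lia.
- elim: i lin => [|i IH] lin; first by rewrite mul0n.
  have := card_sadd_generating C0 gC (smul_neq0 i BB0) B0n.
  rewrite -saddA -/B -[sadd (smul i B) B]/(smul i.+1 B).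
  have := upper _ lin; have := IH (ltnW lin).
  move=> h1 h2; rewrite geq_min => /orP []; nia.
exact: upper.
Qed.

End Growth.

(** * Fourier analysis on Z/L *)

Lemma cos_2pi_div_lt1 (R : realType) (N : nat) : (1 < N)%N -> cos (pi *+ 2 / N%:R) < 1 :> R.
Proof.
move=> N1; have Np : 0 < N%:R :> R by rewrite ltr0n; exact: ltnW.
have pip : 0 < pi :> R by exact: pi_gt0.
have tp : 0 < pi *+ 2 / N%:R :> R by rewrite divr_gt0 // mulrn_wgt0.
rewrite -[ltRHS]cos0 ltr_cos // in_itv /= ?lexx ?(ltW pip) // (ltW tp) /=.
by rewrite ler_pdivrMr // mulr_natr ler_wpMn2l // ltW.
Qed.

Section Characters.
Variables (R : realType) (p : nat).
Let L := p.+2.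
Let G := 'Z_L.
Implicit Types (x y xi : G) (X B : {set G}) (r : G -> R).

Definition angle : R := pi *+ 2 / L%:R.
(** [ec] and [es] are the real and imaginary parts of exp(2 pi i x / L), which keeps the analysis in
    the real field. *)
Definition ec x : R := cos (angle * (x : nat)%:R).
Definition es x : R := sin (angle * (x : nat)%:R).


Lemma angleL : angle * L%:R = pi *+ 2.
Proof. by rewrite /angle divfK // gt_eqF. Qed.

Lemma cos_modn (m : nat) : cos (angle * (m %% L)%:R) = cos (angle * m%:R).
Proof.
rewrite [in RHS](divn_eq m L) natrD natrM mulrDr mulrCA angleL addrC mulr_natl.
by rewrite (periodicn (@cosD2pi R)).
Qed.

Lemma sin_modn (m : nat) : sin (angle * (m %% L)%:R) = sin (angle * m%:R).
Proof.
rewrite [in RHS](divn_eq m L) natrD natrM mulrDr mulrCA angleL addrC mulr_natl.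
by rewrite (periodicn (@sinD2pi R)).
Qed.

Lemma ecD x y : ec (x + y) = ec x * ec y - es x * es y.
Proof. by rewrite /ec /= cos_modn natrD mulrDr cosD. Qed.

Lemma esD x y : es (x + y) = es x * ec y + ec x * es y.
Proof. by rewrite /es /= sin_modn natrD mulrDr sinD. Qed.

Lemma ec0 : ec 0 = 1. Proof. by rewrite /ec mulr0 cos0. Qed.
Lemma es0 : es 0 = 0. Proof. by rewrite /es mulr0 sin0. Qed.

Lemma ec_es x : ec x ^+ 2 + es x ^+ 2 = 1. Proof. exact: cos2Dsin2. Qed.

Lemma norm_ec x : `|ec x| <= 1. Proof. exact: cos_max. Qed.
Lemma norm_es x : `|es x| <= 1. Proof. exact: sin_max. Qed.

Lemma esN x : es (- x) = - es x.
Proof.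
have h1 := ecD x (- x); have h2 := esD x (- x).
rewrite subrr ec0 in h1; rewrite subrr es0 in h2.
have h3 := ec_es x.
have : es (- x) * (ec x ^+ 2 + es x ^+ 2) = - es x.
  rewrite (_ : _ * _ = ec x * (es x * ec (- x) + ec x * es (- x)) -
    es x * (ec x * ec (- x) - es x * es (- x))); last by ring.
  by rewrite -h1 -h2; ring.
by rewrite h3 mulr1.
Qed.

Lemma ecN x : ec (- x) = ec x.
Proof.
have h1 := ecD x (- x); have h2 := esD x (- x).
rewrite subrr ec0 in h1; rewrite subrr es0 in h2.
have h3 := ec_es x.
have : ec (- x) * (ec x ^+ 2 + es x ^+ 2) = ec x.
  rewrite (_ : _ * _ = es x * (es x * ec (- x) + ec x * es (- x)) +
    ec x * (ec x * ec (- x) - es x * es (- x))); last by ring.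
  by rewrite -h1 -h2; ring.
by rewrite h3 mulr1.
Qed.

(* Closeness to [1] of [cos] translates into closeness to [0] on the circle. *)
Lemma arc_of_ec (N : nat) x : (1 < N)%N -> cos (pi *+ 2 / N%:R) < ec x ->
  (N * x < L)%N \/ (N * (L - x) < L)%N.
Proof.
move=> N1.
have Np : 0 < N%:R :> R by rewrite ltr0n; exact: ltnW.
have pip : 0 < pi :> R by exact: pi_gt0.
have inpi (t : R) : 0 <= t -> t * 2 <= 1 -> pi *+ 2 * t \in `[0, pi].
  by move=> t0 t1; rewrite in_itv /=; apply/andP; split; rewrite -mulr_natl; nra.
have h0 : pi *+ 2 / N%:R \in `[(0 : R), pi].
  by apply: inpi; rewrite ?invr_ge0 // ler_pdivrMl // mulr1 ler_nat.
have key (m : nat) : (m * 2 <= L)%N -> cos (pi *+ 2 / N%:R) < cos (angle * m%:R) -> (N * m < L)%N.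
  move=> hm; rewrite /angle -mulrA ltr_cos //; last first.
    apply: inpi; first by rewrite mulr_ge0 // invr_ge0.
    by rewrite -mulrA ler_pdivrMl // mulr1 -natrM ler_nat.
  rewrite ltr_pM2l; last by rewrite mulrn_wgt0.
  by rewrite ltr_pdivrMl // ltr_pdivlMr // -natrM ltr_nat mulnC.
case: (leqP (x * 2)%N L) => hx hc; first by left; apply: key.
right; apply: key; first by lia.
move: hc; rewrite /ec; congr (_ < _).
have xL : (x <= L)%N by exact: ltnW (ltn_ord x).
rewrite -[LHS]cosN -(cosD2pi) natrB // mulrBr angleL; congr cos; lra.
Qed.

(** Shifting the summation variable rotates the pair of cosine and sine sums by the angle of [m]; a
    rotation other than the identity fixes only 0. That [ec m] is not 1 follows from [arc_of_ec]
    with N = L. *)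
Lemma sum_character m : \sum_(xi : G) ec (xi * m) = if m == 0 then L%:R else 0.
Proof.
case: eqP => [->|/eqP m0].
  under eq_bigr => xi _ do rewrite mulr0 ec0.
  by rewrite sumr_const; congr (_ *+ _); rewrite card_ord.
set c := LHS; set s := \sum_(xi : G) es (xi * m).
have hc : c = c * ec m - s * es m.
  rewrite {1}/c -(sum_shift 1) !mulr_suml -sumrB; apply: eq_bigr => xi _.
  by rewrite mulrDl mul1r ecD.
have hs : s = s * ec m + c * es m.
  rewrite {1}/s -(sum_shift 1) !mulr_suml -big_split; apply: eq_bigr => xi _ /=.
  by rewrite mulrDl mul1r esD.
have ne1 : ec m != 1.
  apply: contra_neq m0 => e1.
  have mL : (m < L)%N := ltn_ord m.
  have [] := @arc_of_ec L m isT.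
  - by rewrite e1; exact: cos_2pi_div_lt1.
  - by move=> h; apply: val_inj => /=; nia.
  by move=> h; exfalso; nia.
have : (1 - ec m) * (c ^+ 2 + s ^+ 2) = 0 by nra.
move/eqP; rewrite mulf_eq0 subr_eq0 eq_sym (negPf ne1) /= => /eqP h.
have := sqr_ge0 c; have := sqr_ge0 s => s0 c0.
have : c ^+ 2 = 0 by lra.
by move/eqP; rewrite sqrf_eq0 => /eqP.
Qed.

(** The squared modulus of the unnormalised Fourier coefficient of [r] at [xi]. *)
Definition spectrum r xi : R := (\sum_x r x * ec (xi * x)) ^+ 2 + (\sum_x r x * es (xi * x)) ^+ 2.

Lemma parseval r : \sum_xi spectrum r xi = L%:R * \sum_x r x ^+ 2.
Proof.
have E xi : spectrum r xi = \sum_x \sum_y r x * r y * ec (xi * (x - y)).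
  rewrite /spectrum !expr2 !mulr_suml -big_split; apply: eq_bigr => x _ /=.
  rewrite !mulr_sumr -big_split; apply: eq_bigr => y _ /=.
  by rewrite mulrBr ecD ecN esN; ring.
under eq_bigr => xi _ do rewrite E.
rewrite exchange_big mulr_sumr; apply: eq_bigr => x _ /=.
rewrite exchange_big (bigD1 x) //= -mulr_sumr subrr sum_character eqxx.
rewrite big1 ?addr0 ?expr2 ?[_ * L%:R]mulrC // => y yx.
by rewrite -mulr_sumr sum_character subr_eq0 eq_sym (negPf yx) mulr0.
Qed.

Lemma spectrum_ge0 r xi : 0 <= spectrum r xi.
Proof. by rewrite addr_ge0 ?sqr_ge0. Qed.

Definition indic X x : R := (x \in X)%:R.

Definition reps X (z : G) : R := \sum_(x in X) indic X (z - x).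

Lemma spectrum_reps X xi : spectrum (reps X) xi = spectrum (indic X) xi ^+ 2.
Proof.
have E (phi : G -> R) : \sum_z reps X z * phi z = \sum_x \sum_y indic X x * indic X y * phi (x + y).
  under eq_bigr => z _ do rewrite /reps sum_mem mulr_suml.
  rewrite exchange_big; apply: eq_bigr => x _ /=.
  rewrite -[LHS](sum_shiftl x); apply: eq_bigr => y _.
  by rewrite addrC addKr.
rewrite /spectrum !E.
set c := \sum_x indic X x * ec (xi * x); set s := \sum_x indic X x * es (xi * x).
have -> : \sum_x \sum_y indic X x * indic X y * ec (xi * (x + y)) = c ^+ 2 - s ^+ 2.
  rewrite !expr2 !mulr_suml -sumrB; apply: eq_bigr => x _.
  rewrite !mulr_sumr -sumrB; apply: eq_bigr => y _.
  by rewrite mulrDr ecD; ring.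
have -> : \sum_x \sum_y indic X x * indic X y * es (xi * (x + y)) = s * c + c * s.
  rewrite !mulr_suml -big_split; apply: eq_bigr => x _ /=.
  rewrite !mulr_sumr -big_split; apply: eq_bigr => y _ /=.
  by rewrite mulrDr esD; ring.
by ring.
Qed.

Lemma sum_reps X : \sum_z reps X z = #|X|%:R ^+ 2.
Proof.
rewrite exchange_big /=; transitivity (\sum_(x in X) (#|X|%:R : R)).
  by apply: eq_bigr => x _; rewrite (sum_shift (- x) (indic X)) sum_indicator.
by rewrite sumr_const -[LHS]mulr_natr.
Qed.

Lemma reps_supp X z : z \notin sadd X X -> reps X z = 0.
Proof.
move=> nz; apply: big1 => x xX; rewrite /indic; case: (boolP (_ \in _)) => // h.
by case/negP: nz; apply/saddP; exists x, (z - x); split => //; ring.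
Qed.

Lemma energy_ge X : X != set0 -> #|X|%:R ^+ 4 <= #|sadd X X|%:R * \sum_z reps X z ^+ 2.
Proof.
move=> X0.
have Np : 0 < #|sadd X X|%:R :> R by rewrite ltr0n card_gt0 sadd_neq0.
set m : R := #|X|%:R ^+ 2 / #|sadd X X|%:R.
have : 0 <= \sum_(z in sadd X X) (reps X z - m) ^+ 2.
  by apply: sumr_ge0 => z _; exact: sqr_ge0.
have out (phi : R -> R) : phi 0 = 0 -> \sum_(z in sadd X X) phi (reps X z) = \sum_z phi (reps X z).
  move=> phi0; rewrite [RHS](bigID (mem (sadd X X))) /= [X in _ + X]big1 ?addr0 // => z /reps_supp ->.
  by [].
have -> : \sum_(z in sadd X X) (reps X z - m) ^+ 2 =
   \sum_(z in sadd X X) reps X z ^+ 2 - 2 * m * (\sum_(z in sadd X X) reps X z) + m ^+ 2 *+ #|sadd X X|.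
  rewrite mulr_sumr -sumr_const -sumrB -big_split; apply: eq_bigr => z _ /=; ring.
rewrite (out (fun t => t ^+ 2)) ?expr0n // (out id) // sum_reps -mulr_natr.
move: (\sum_z _) => S; rewrite /m => h.
rewrite mulrC -ler_pdivrMr //; rewrite -subr_ge0; congr (_ <= _): h.
by field; rewrite gt_eqF.
Qed.

(** The fourth moment of the Fourier coefficients is L times the additive energy, hence at least
    L|X|^4/|X + X|. The zero frequency contributes |X|^4, at most half of it, and Parseval bounds
    the rest by the largest other coefficient times L|X|. *)
Lemma large_character X : X != set0 -> (2 * #|sadd X X| <= L)%N ->
  exists2 xi : G, xi != 0 & #|X|%:R ^+ 3 <= 2 * #|sadd X X|%:R * spectrum (indic X) xi.
Proof.
move=> X0 hL.
have [/exists_inP [xi xi0 h]|no] := boolP [exists xi in [pred u : G | u != 0],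
    #|X|%:R ^+ 3 <= 2 * #|sadd X X|%:R * spectrum (indic X) xi]; first by exists xi.
exfalso.
have Xp : 0 < #|X|%:R :> R by rewrite ltr0n card_gt0.
have Sp : 0 < #|sadd X X|%:R :> R by rewrite ltr0n card_gt0 sadd_neq0.
set q : R := 2 * #|sadd X X|%:R; have qp : 0 < q by rewrite mulr_gt0.
pose F := spectrum (indic X).
have small xi : xi != 0 -> q * F xi <= #|X|%:R ^+ 3.
  move=> xi0; apply: ltW; rewrite ltNge; apply: contra no => h.
  by apply/exists_inP; exists xi.
have F0 : F 0 = #|X|%:R ^+ 2.
  rewrite /F /spectrum; under eq_bigr => x _ do rewrite mul0r ec0 mulr1.
  under [X in _ + X ^+ 2]eq_bigr => x _ do rewrite mul0r es0 mulr0.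
  by rewrite sum_indicator big1 // expr0n addr0.
have sF : \sum_xi F xi = L%:R * #|X|%:R.
  rewrite parseval; congr (_ * _); rewrite -[RHS]sum_indicator.
  by apply: eq_bigr => x _; rewrite /indic; case: (_ \in _); rewrite ?expr1n ?expr0n.
have sF2 : \sum_xi F xi ^+ 2 = L%:R * \sum_z reps X z ^+ 2.
  by rewrite -parseval; apply: eq_bigr => xi _; rewrite spectrum_reps.
have up : q * \sum_xi F xi ^+ 2 <= q * #|X|%:R ^+ 4 + #|X|%:R ^+ 3 * (L%:R * #|X|%:R - #|X|%:R ^+ 2).
  have rest : \sum_(xi | xi != 0) F xi = L%:R * #|X|%:R - #|X|%:R ^+ 2.
    by rewrite -sF [X in _ = X - _](bigD1 0) //= F0 addrAC subrr add0r.
  rewrite (bigD1 0) //= F0 -exprM mulrDr lerD2l -rest !mulr_sumr; apply: ler_sum => xi xi0.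
  by rewrite expr2 mulrA ler_wpM2r ?spectrum_ge0 ?small.
have lo := energy_ge X0.
have hL' : q <= L%:R by rewrite /q -natrM ler_nat.
move: up; rewrite sF2; move: lo; move: (\sum_z reps X z ^+ 2) => E.
have X4 := exprn_gt0 4 Xp; have X5 := exprn_gt0 5 Xp.
rewrite /q in qp hL' *; move: (#|sadd X X|%:R : R) Sp qp hL' => S Sp qp hL' lo up.
have h1 : L%:R * (2 * #|X|%:R ^+ 4) <= 2 * S * (L%:R * E).
  by rewrite (_ : 2 * S * (L%:R * E) = L%:R * (2 * (S * E))) ?ler_pM2l //; ring.
have h2 : 2 * S * #|X|%:R ^+ 4 <= L%:R * #|X|%:R ^+ 4 by rewrite ler_pM2r.
move: up h1 h2 X5; rewrite !exprS !expr0; move: (#|X|%:R : R) => t; nra.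
Qed.

(** Translating [X] by [b] multiplies the coefficient by a phase of angle theta, with |exp(i theta)
    - 1|^2 = 2 (1 - cos theta), but changes each of its two real parts by at most twice the
    defect. *)
Lemma rotation_bound X xi b :
  spectrum (indic X) xi * (1 - ec (xi * b)) <= 4 * #|sadd [set b] X :\: X|%:R ^+ 2.
Proof.
set d := #|_|; set F := spectrum _ _.
pose c := \sum_x indic X x * ec (xi * x); pose s := \sum_x indic X x * es (xi * x).
pose c' := c * ec (xi * b) - s * es (xi * b); pose s' := s * ec (xi * b) + c * es (xi * b).
have cE (phi : G -> R) : \sum_x indic X x * phi (x + b) = \sum_(y in sadd [set b] X) phi y.
  rewrite [RHS]sum_mem -[RHS](sum_shift b); apply: eq_bigr => x _.
  by rewrite sadd1P addrK.
have c'E : c' = \sum_(y in sadd [set b] X) ec (xi * y).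
  rewrite -(cE (fun y => ec (xi * y))) /c' /c /s !mulr_suml -sumrB; apply: eq_bigr => x _.
  by rewrite mulrDr ecD; ring.
have s'E : s' = \sum_(y in sadd [set b] X) es (xi * y).
  rewrite -(cE (fun y => es (xi * y))) /s' /c /s !mulr_suml -big_split; apply: eq_bigr => x _ /=.
  by rewrite mulrDr esD; ring.
have dsym : #|X :\: sadd [set b] X| = d.
  by apply/eqP; rewrite -(eqn_add2l #|X :&: sadd [set b] X|) cardsID setIC cardsID card_sadd1.
have diff (phi : G -> R) : (forall x, `|phi x| <= 1) ->
    `|\sum_(y in sadd [set b] X) phi y - \sum_x indic X x * phi x| <= 2 * d%:R.
  move=> hphi; rewrite -sum_mem.
  rewrite (bigID (mem X)) /= [X in _ - X](bigID (mem (sadd [set b] X))) /=.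
  rewrite [X in _ - (X + _)](eq_bigl (fun y => (y \in sadd [set b] X) && (y \in X))); last by move=> y; rewrite andbC.
  rewrite opprD addrACA subrr add0r; apply: le_trans (ler_normB _ _) _.
  have bd (P : {set G}) : `|\sum_(y in P) phi y| <= #|P|%:R.
    apply: le_trans (ler_norm_sum _ _ _) _; rewrite -sum1_card natr_sum; exact: ler_sum.
  have -> : 2 * d%:R = #|sadd [set b] X :\: X|%:R + #|X :\: sadd [set b] X|%:R :> R by rewrite dsym -/d; ring.
  apply: lerD.
    by apply: le_trans (bd _); rewrite (eq_bigl (mem (sadd [set b] X :\: X))) // => y; rewrite /= in_setD andbC.
  by apply: le_trans (bd _); rewrite (eq_bigl (mem (X :\: sadd [set b] X))) // => y; rewrite /= in_setD andbC.
have h1 : `|c' - c| <= 2 * d%:R by rewrite c'E; apply: diff => x; exact: norm_ec.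
have h2 : `|s' - s| <= 2 * d%:R by rewrite s'E; apply: diff => x; exact: norm_es.
have sq (t u : R) : `|t| <= u -> t ^+ 2 <= u ^+ 2.
  by move=> h; rewrite -real_normK ?num_real // lerXn2r // nnegrE // (le_trans _ h).
have := sq _ _ h1; have := sq _ _ h2.
have -> : F = c ^+ 2 + s ^+ 2 by [].
have e := ec_es (xi * b); rewrite /c' /s'; move: (ec _) (es _) e (c) (s) (d%:R : R) => u v e a w t g1 g2.
have : 2 * ((a ^+ 2 + w ^+ 2) * (1 - u)) = (a * u - w * v - a) ^+ 2 + (w * u + a * v - w) ^+ 2.
  have -> : (a * u - w * v - a) ^+ 2 + (w * u + a * v - w) ^+ 2 = (a ^+ 2 + w ^+ 2) * (u ^+ 2 + v ^+ 2 + 1 - 2 * u) by ring.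
  by rewrite e; ring.
by move: g1 g2; lra.
Qed.

End Characters.

Lemma circle_lift (P Q : bool) (L t u v : nat) : (0 < L)%N -> u = ((t + v) %% L)%N ->
  (t < L)%N -> (u < L)%N -> (v < L)%N ->
  let sv (P : bool) (w : nat) : int := if P then w%:Z else w%:Z - L%:Z in
  (`|sv P v|%N * 2 < L)%N -> (`|sv Q u|%N * 2 < L)%N -> sv P v <= sv Q u -> t%:Z = sv Q u - sv P v.
Proof.
move=> L0 e ht hu hv /=.
have hq := divn_eq (t + v) L; rewrite -e in hq.
have q2 : ((t + v) %/ L < 2)%N by rewrite ltn_divLR //; lia.
have {}hq : (t + v = u \/ t + v = L + u)%N.
  by move: hq q2; case: ((t + v) %/ L)%N => [|[|//]] ->; [left|right]; lia.
by case: P; case: Q; case: hq => hq; lia.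
Qed.

Lemma mul_diff_lt (N L t : nat) (u v : int) :
  (`|u|%N * N < L)%N -> (`|v|%N * N < L)%N -> t%:Z = u - v -> (N * t < 2 * L)%N.
Proof.
move=> h1 h2 h; have : (t <= `|u| + `|v|)%N by lia.
move=> /(leq_mul (leqnn N)) h3; apply: leq_ltn_trans h3 _.
by rewrite mulnDr mulnC [(N * _)%N]mulnC; lia.
Qed.

(** * Rectification: almost periods lie on a short arc *)

Section ShortArc.
Variable R : realType.

(** A large coefficient at [xi] forces the phase of [xi * b] to be small for each b that hardly
    moves [X]. Measuring from the leftmost such point puts all residues on the nonnegative side. *)
Lemma short_arc (N : nat) : (1 < N)%N -> exists2 nu : R, 0 < nu &
  forall (p : nat) (X B : {set 'Z_p.+2}), X != set0 -> B != set0 ->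
    (#|sadd X X| <= 12 * #|X|)%N -> (2 * #|sadd X X| <= p.+2)%N ->
    {in B, forall b, #|sadd [set b] X :\: X|%:R <= nu * #|X|%:R} ->
  exists2 xi : 'Z_p.+2, xi != 0 & exists2 b0, b0 \in B &
     {in B, forall b, (N * (xi * (b - b0))%R < 2 * p.+2)%N}.
Proof.
move=> N1.
have Np : 0 < N%:R :> R by rewrite ltr0n; exact: ltnW.
have pip : 0 < pi :> R by exact: pi_gt0.
pose k : R := 1 - cos (pi *+ 2 / N%:R).
have kp : 0 < k. by rewrite subr_gt0; exact: cos_2pi_div_lt1.
(* The bound reached is 1 - cos <= 96 nu^2, which is below [k]. *)
pose nu := Num.min 1 (k / 200).
have nup : 0 < nu by rewrite lt_min divr_gt0 ?ltr01.
have nu1 : nu <= 1 by rewrite /nu ge_min lexx.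
have nuk : nu <= k / 200 by rewrite /nu ge_min lexx orbT.
exists nu => // p X B X0 B0 h12 hL hB.
have Xp : 0 < #|X|%:R :> R by rewrite ltr0n card_gt0.
have Sp : 0 < #|sadd X X|%:R :> R by rewrite ltr0n card_gt0 sadd_neq0.
have [xi xi0 hxi] := large_character R X0 hL.
exists xi => //.
have arc b : b \in B -> (N * (xi * b)%R < p.+2)%N \/ (N * (p.+2 - (xi * b)%R) < p.+2)%N.
  move=> bB; apply: (@arc_of_ec R p N) => //.
  have h1 := rotation_bound R X xi b; have h2 := hB _ bB.
  have h3 : #|sadd [set b] X :\: X|%:R ^+ 2 <= (nu * #|X|%:R) ^+ 2 :> R.
    by rewrite lerXn2r // nnegrE // mulr_ge0 // ltW.
  have h4 : #|sadd X X|%:R <= 12 * #|X|%:R :> R by rewrite -natrM ler_nat.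
  have u1 : 0 <= 1 - ec R (xi * b) by rewrite subr_ge0; exact: cos_le1.
  have h5 : #|X|%:R ^+ 3 * (1 - ec R (xi * b)) <= 2 * #|sadd X X|%:R * (4 * (nu * #|X|%:R) ^+ 2).
    apply: le_trans (ler_wpM2r u1 hxi) _; rewrite -[leLHS]mulrA; apply: ler_wpM2l; first by rewrite mulr_ge0.
    by apply: le_trans h1 _; rewrite ler_pM2l.
  have h6 : #|X|%:R ^+ 3 * (1 - ec R (xi * b)) <= #|X|%:R ^+ 3 * (96 * nu ^+ 2).
    apply: le_trans h5 _; have -> : #|X|%:R ^+ 3 * (96 * nu ^+ 2) = 2 * (12 * #|X|%:R) * (4 * (nu * #|X|%:R) ^+ 2) :> R by ring.
    apply: ler_wpM2r; first by rewrite mulr_ge0 ?sqr_ge0.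
    by rewrite ler_pM2l.
  move: h6; rewrite ler_pM2l ?exprn_gt0 // => h6.
  have : 1 - ec R (xi * b) < k by move: h6 nuk nu1 nup kp; nra.
  by rewrite /k; lra.
pose sv (b : 'Z_p.+2) : int := if (N * (xi * b)%R < p.+2)%N then ((xi * b)%R : nat)%:Z
   else ((xi * b)%R : nat)%:Z - (p.+2)%:Z.
have svb b : b \in B -> (`|sv b|%N * N < p.+2)%N.
  move=> /arc; rewrite /sv; case: ifP => [h _|_ [//|h]]; first by rewrite absz_nat mulnC.
  have := ltn_ord (xi * b)%R; move: h; rewrite [(Zp_trunc _).+2]/= ; move: (nat_of_ord (xi * b)%R) => t; nia.
have [b1 b1B] : exists b, b \in B by apply/set0Pn.
pose b0 := [arg min_(b < b1 in B) sv b]%O.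
have [b0B hmin] : b0 \in B /\ {in B, forall b, sv b0 <= sv b}.
  by rewrite /b0; case: Order.TotalTheory.arg_minP.
exists b0 => // b bB.
have h1 := svb _ b0B; have h2 := svb _ bB; have h3 := hmin _ bB.
have : (((xi * (b - b0))%R : nat)%:Z = sv b - sv b0)%R.
  have e : nat_of_ord (xi * b)%R = ((nat_of_ord (xi * (b - b0))%R + nat_of_ord (xi * b0)%R) %% p.+2)%N.
    by rewrite {1}(_ : xi * b = xi * (b - b0) + xi * b0) //; ring.
  have lt1 := ltn_ord (xi * (b - b0))%R; have lt2 := ltn_ord (xi * b)%R; have lt3 := ltn_ord (xi * b0)%R.
  have h1' : (`|sv b0|%N * 2 < p.+2)%N by apply: leq_ltn_trans h1; rewrite leq_mul2l N1 orbT.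
  have h2' : (`|sv b|%N * 2 < p.+2)%N by apply: leq_ltn_trans h2; rewrite leq_mul2l N1 orbT.
  exact: (circle_lift (ltn0Sn _) e lt1 lt2 lt3 h1' h2' h3).
exact: mul_diff_lt h2 h1.
Qed.

End ShortArc.

(** * A subgroup of Z/L x Z/(LY) from small doubling *)

HB.instance Definition _ (A B : finComNzRingType) := Finite.on (A * B)%type.

Lemma pair_mulrn (A B : nmodType) (a : A) (b : B) k : (a, b) *+ k = (a *+ k, b *+ k).
Proof. by elim: k => // k IH; rewrite !mulrS IH. Qed.

Section Strip.
Variables p q : nat.
Let L := p.+2.
Let M := q.+2.
Let G := 'Z_p.+2.
Let K := 'Z_q.+2.
Let Xi : finComNzRingType := (G * K)%type.
Variables (xi : G) (B : {set G}) (j Yb : nat) (t : G).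

Definition level (x : G) : nat := (xi * x)%R.

Let y := level.
Let Y := (j * Yb)%N.
Let S := smul j B.
Hypotheses (B0 : 0 \in B) (tB : t \in B) (yt : level t = Yb).
Hypothesis ymax : {in B, forall b, (level b <= Yb)%N}.
Hypotheses (Yb0 : (0 < Yb)%N) (smallY : (8 * j * Yb < L)%N) (j63 : (63 <= j)%N).
Hypothesis MLY : M = (L * (j * Yb))%N.
Hypothesis dbl : (20 * #|sadd S S| <= 41 * #|S|)%N.

Let y_mod a b : y (a + b) = ((y a + y b) %% L)%N.
Proof. by rewrite /y /level mulrDr. Qed.

Let yD a b : (y a + y b < L)%N -> y (a + b) = (y a + y b)%N.
Proof. by move=> h; rewrite y_mod modn_small. Qed.

Let y_smul k s : (k <= 2 * j)%N -> s \in smul k B -> (y s <= k * Yb)%N.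
Proof.
elim: k s => [|k IH] s kj /=.
  by move=> /set1P ->; rewrite /y /level mulr0.
move=> /saddP [a [b [/IH ha /ymax hb ->]]]; have {}ha := ha (ltnW kj).
rewrite -/y in hb; rewrite yD; first by rewrite mulSn; lia.
apply: leq_ltn_trans smallY; nia.
Qed.

Let t_smul k : t *+ k \in smul k B.
Proof. by elim: k => [|k IH]; rewrite ?mulr0n ?set11 // mulrSr mem_sadd. Qed.

Let y_mult k : (k <= 2 * j)%N -> y (t *+ k) = (k * Yb)%N.
Proof.
elim: k => [|k IH] kj; first by rewrite mulr0n /y /level mulr0.
rewrite mulrSr yD IH ?(ltnW kj) // [y t]yt; first by rewrite mulSn addnC.
by apply: leq_ltn_trans smallY; nia.
Qed.

Let Y0 : (0 < Y)%N. Proof. by rewrite /Y; nia. Qed.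
Let Y8 : (8 * Y < L)%N. Proof. by rewrite /Y mulnA. Qed.
Let ML : M = (L * Y)%N. Proof. exact: MLY. Qed.

(** Levels add without wrapping on [S + S], so lifting to the graph of the level preserves the
    additive structure of [S]. The modulus [M = L * Y] is chosen so that the lift [wh] of the top
    element [w] has order dividing L. *)
Let iota (x : G) : Xi := (x, (y x)%:R).
Let w := t *+ j.
Let wh := iota w.
Let yw : y w = Y. Proof. by rewrite y_mult //; lia. Qed.
Let wS : w \in S. Proof. exact: t_smul. Qed.
Let S0 : 0 \in S. Proof. exact: smul_0in. Qed.
Let yS s : s \in S -> (y s <= Y)%N. Proof. by apply: y_smul; lia. Qed.

Let iotaD a b : (y a + y b < L)%N -> iota (a + b) = iota a + iota b.
Proof. by move=> h; rewrite /iota yD // natrD. Qed.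

Let iotaSS a b : a \in S -> b \in S -> iota (a + b) = iota a + iota b.
Proof. by move=> /yS ha /yS hb; apply: iotaD; lia. Qed.

Let iota_inj : injective iota. Proof. by move=> a b []. Qed.

Let Sh : {set Xi} := [set iota s | s in S].
(** The cyclic group spanned by [wh]. Working modulo [W] identifies the two ends 0 and [w] of [S],
    that is, reduces [S] modulo its own length. *)
Let W : {set Xi} := [set wh *+ (k : 'I_L) | k : 'I_L].
Let Th : {set Xi} := [set iota s | s in sadd S S].
Let Shat := sadd Sh W.

Let ThE : Th = sadd Sh Sh.
Proof.
apply/setP => z; apply/imsetP/saddP.
  move=> [_ /saddP [a [b [aS bS ->]]] ->]; exists (iota a), (iota b).
  by rewrite iotaSS // !imset_f.
move=> [_ [_ [/imsetP [a aS ->] /imsetP [b bS ->] ->]]].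
by exists (a + b); rewrite ?mem_sadd // iotaSS.
Qed.

Let whL : wh *+ L = 0.
Proof.
have e1 : w *+ L = 0 by rewrite -mulr_natr pchar_Zp ?mulr0.
have e2 : (Y%:R : K) *+ L = 0 by rewrite -mulrnA mulnC -ML; exact: pchar_Zp.
by rewrite /wh /iota yw pair_mulrn e1 e2.
Qed.

Let memW k : wh *+ k \in W.
Proof.
apply/imsetP; exists (inord (k %% L)) => //; rewrite inordK ?ltn_mod //.
by rewrite {1}(divn_eq k L) mulrnDr mulnC mulrnA whL mul0rn add0r.
Qed.

Let W0 : 0 \in W. Proof. exact: (memW 0). Qed.

Let WW : sadd W W = W.
Proof.
apply/eqP; rewrite eqEsubset sub_saddr // andbT; apply/subsetP => z.
by move=> /saddP [_ [_ [/imsetP [k _ ->] /imsetP [l _ ->] ->]]]; rewrite -mulrnDr memW.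
Qed.

Let cardW : (#|W| <= L)%N.
Proof. by apply: leq_trans (leq_imset_card _ _) _; rewrite card_ord. Qed.

Let ShatE : sadd Shat Shat = sadd Th W.
Proof.
by rewrite /Shat ThE saddA -[sadd (sadd Sh W) Sh]saddA [sadd W Sh]saddC saddA -saddA WW.
Qed.

Let valK (k : nat) : ((k%:R : K) : nat) = (k %% M)%N.
Proof. by rewrite val_Zp_nat. Qed.

(** Each coset of [W] that meets [Sh] leaves it within two steps of [wh], since two steps add 2Y to
    a level and all levels of [S] are at most Y. *)
Let exits : (#|Shat| <= L * #|sadd [set wh] Sh :\: Sh|)%N.
Proof.
set D := _ :\: Sh.
apply: (@leq_trans #|sadd D W|).
  apply: subset_leq_card; apply/subsetP => z /saddP [_ [_ [/imsetP [s sS ->] /imsetP [k _ ->] ->]]].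
  have Wneg u l : u \in sadd D [set wh *+ l] -> u \in sadd D W.
    by apply/subsetP; apply: saddS => //; rewrite sub1set memW.
  have back n (u : Xi) : (n <= L)%N -> u + wh *+ n \in D -> u + wh *+ k \in sadd D W.
    move=> nL uD; apply/saddP; exists (u + wh *+ n), (wh *+ (k + (L - n))); split => //.
    by rewrite -addrA -mulrnDr addnCA subnKC // mulrnDr whL addr0.
  have [h|h] := boolP (iota s + wh \in Sh); last first.
    apply: (back 1%N) => //; rewrite mulr1n inE h sadd1P addrK imset_f //.
  apply: (back 2%N) => //.
  rewrite inE sadd1P mulr2n addrA addrK h andbT.
  apply/negP => /imsetP [u uS] /(congr1 snd) e.
  have {}e : ((y s + Y + Y)%:R : K) = (y u)%:R by rewrite !natrD -yw.
  have := congr1 (@nat_of_ord _) e; rewrite !valK.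
  have hs := yS sS; have hu := yS uS.
  rewrite !modn_small ?ML; move: Y0 Y8; clear -hs hu; nia.
apply: leq_trans (card_sadd_le _ _) _.
by rewrite mulnC leq_mul2r cardW orbT.
Qed.

Let card_Th : #|Th| = #|sadd S S|. Proof. exact: card_imset. Qed.
Let card_Sh : #|Sh| = #|S|. Proof. exact: card_imset. Qed.

(* Modulo the difference of its two ends, [2S] loses at least one element per
   class of [S] and all of the classes outside [S] count. *)
Let card_2Shat : (#|sadd Shat Shat| + L * #|S| <= L * #|sadd S S|)%N.
Proof.
rewrite ShatE; set A := Sh :|: sadd [set wh] Sh.
have whSh : wh \in Sh by apply: imset_f.
have Sh0 : 0 \in Sh.
  by apply/imsetP; exists 0 => //; rewrite /iota /y /level mulr0.
have AT : A \subset Th.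
  by rewrite ThE; apply/subUsetP; split; [exact: sub_saddr|exact: sadd1_sub].
have sub : sadd Th W \subset Shat :|: sadd (Th :\: A) W.
  apply/subsetP => z /saddP [a [b [aT bW ->]]]; rewrite inE.
  have [aA|aA] := boolP (a \in A); last by rewrite [X in _ || X]mem_sadd ?orbT // inE aA.
  apply/orP; left; move: aA; rewrite inE sadd1P => /orP [h|h]; first exact: mem_sadd.
  have -> : a + b = (a - wh) + (wh + b) by ring.
  by rewrite mem_sadd // -WW mem_sadd // -[wh]mulr1n.
have h1 : (#|sadd Th W| <= #|Shat| + #|sadd (Th :\: A) W|)%N.
  by apply: leq_trans (subset_leq_card sub) _; rewrite cardsU leq_subr.
have h2 : (#|sadd (Th :\: A) W| <= #|Th :\: A| * L)%N.
  by apply: leq_trans (card_sadd_le _ _) _; rewrite leq_mul2l cardW orbT.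
have h3 : #|Th :\: A| = (#|sadd S S| - #|A|)%N by rewrite cardsD (setIidPr AT) card_Th.
have h4 : (#|A| = #|S| + #|sadd [set wh] Sh :\: Sh|)%N.
  by rewrite /A -card_Sh addnC card_setD_add setUC.
have h5 : (#|A| <= #|sadd S S|)%N by rewrite -card_Th subset_leq_card.
move: h1 h2 exits h5; rewrite h3 h4.
move: #|sadd Th W| #|Shat| #|sadd (Th :\: A) W| #|sadd S S| #|S| #|sadd [set wh] Sh :\: Sh| => a b c d e f.
by clear; nia.
Qed.

Let top := [set s in S | y s == Y].

(** Elements of top level may coincide modulo [W] with others. They are few: adding the multiples of
    [t] up to 63 spreads them over 64 distinct levels of [S + S]. *)
Let card_top : (64 * #|top| <= #|sadd S S|)%N.
Proof.
pose f (z : G * 'I_64) := z.1 + t *+ (z.2 : nat).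
have fy s (i : 'I_64) : s \in top -> y (s + t *+ i) = (Y + i * Yb)%N.
  rewrite inE => /andP [sS /eqP ys]; have := ltn_ord i => hi.
  have ij : (i <= j)%N by lia.
  have hy : y (t *+ i) = (i * Yb)%N by apply: y_mult; lia.
  have hY : (i * Yb <= Y)%N by rewrite leq_mul2r ij orbT.
  by rewrite yD ys hy //; move: Y8 hY; clear; lia.
have fi : {in setX top setT &, injective f}.
  move=> [s i] [s' i']; rewrite !in_setX /= !in_setT !andbT => st st' e.
  have := congr1 y e; rewrite /f /= !fy // => /eqP; rewrite eqn_add2l eqn_pmul2r // => /eqP ii.
  have {}ii : i = i' by apply: val_inj.
  by move: e; rewrite /f /= ii => /addIr ->.
have := card_in_imset fi; rewrite cardsX cardsT card_ord mulnC => <-.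
apply: subset_leq_card; apply/subsetP => _ /imsetP [[s i] + ->].
rewrite in_setX inE /= => /andP [/andP [sS _] _]; apply: mem_sadd => //.
by apply: (subsetP (smul_sub B0 (_ : i <= j)%N)); rewrite ?t_smul //; have := ltn_ord i; lia.
Qed.

Let card_Shat_ge : (L * #|S| <= #|Shat| + L * #|top|)%N.
Proof.
pose f (z : G * 'I_L) : Xi := iota z.1 + wh *+ (z.2 : nat).
have fE s (k : 'I_L) : f (s, k) = (s + w *+ k, (y s + k * Y)%:R).
  by rewrite /f /wh /iota yw pair_mulrn natrD natrM mulr_natl.
have fi : {in setX (S :\: top) setT &, injective f}.
  move=> [s k] [s' k']; rewrite !in_setX /= !in_setT !andbT !fE => h h' e.
  have e1 : s + w *+ k = s' + w *+ k' := congr1 fst e.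
  have e2 : (y s + k * Y)%:R = (y s' + k' * Y)%:R :> K := congr1 snd e.
  have lt u : u \in S :\: top -> (y u < Y)%N.
    by rewrite !inE => /andP [] /negP h1 uS; rewrite ltn_neqAle yS // andbT; apply/negP => h2; apply: h1; rewrite uS.
  have := congr1 (@nat_of_ord _) e2; rewrite !valK.
  have hk := ltn_ord k; have hk' := ltn_ord k'; have l1 := lt _ h; have l2 := lt _ h'.
  have hM (a b : nat) : (a < Y)%N -> (b < L)%N -> (a + b * Y < M)%N by rewrite ML; nia.
  rewrite !modn_small ?hM // => e3.
  have kk : (k : nat) = k'.
    have := congr1 (fun n => n %/ Y)%N e3.
    by rewrite ![(_ + _ * Y)%N]addnC !divnMDl // !divn_small // !addn0.
  have {}kk : k = k' by apply: val_inj.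
  by move: e1; rewrite kk => /addIr ->.
have := card_in_imset fi; rewrite cardsX cardsT card_ord => h.
have {h} : (#|S :\: top| * L <= #|Shat|)%N.
  rewrite -h; apply: subset_leq_card; apply/subsetP => _ /imsetP [[s k] + ->].
  rewrite in_setX in_setD => /andP [/andP [_ sS] _]; apply: mem_sadd; first exact: imset_f.
  exact: memW.
have : #|S| = (#|S :\: top| + #|top|)%N.
  rewrite -(cardsID top S) addnC; congr (_ + #|pred_of_set _|)%N.
  by apply/setIidPr/subsetP => s; rewrite inE => /andP [].
nia.
Qed.

Let D := sdiff Shat Shat.
(** In units of L|S|: |top| counts for at most 41/1280, so |Shat| is at least 1239/1280, while |Shat
    + Shat| is at most 21/20. *)
Let card_bounds : [/\ (2 * #|sadd Shat Shat| < 3 * #|Shat|)%N &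
   (#|Shat| ^ 2 * 10 <= 11 * (L * #|S|) * (2 * #|Shat| - #|sadd Shat Shat|))%N].
Proof.
have h1 := card_2Shat; have h2 := card_top; have h3 := card_Shat_ge; have h4 := dbl.
have S1 : (0 < #|S|)%N by rewrite card_gt0; apply/set0Pn; exists 0.
have hS : (#|Shat| <= L * #|S|)%N.
  apply: leq_trans (card_sadd_le _ _) _.
  by rewrite card_Sh mulnC leq_mul2r cardW orbT.
have L0 : (0 < L)%N by [].
have S1' : (0 < L * #|S|)%N by rewrite muln_gt0.
have h5 : (20 * (L * #|sadd S S|) <= 41 * (L * #|S|))%N by nia.
have h6 : (64 * (L * #|top|) <= L * #|sadd S S|)%N by nia.
move: h1 h3 h5 h6 hS S1'.
move: (L * #|S|)%N (L * #|sadd S S|)%N (L * #|top|)%N #|Shat| #|sadd Shat Shat| => a b c d e.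
move=> g1 g2 g3 g4 g5 g6; have g7 : (1280 * a <= 1280 * d + 41 * a)%N by lia.
have g8 : (20 * e <= 21 * a)%N by lia.
split; first by lia.
have g9 : (10 * d <= 11 * (2 * d - e))%N by lia.
by rewrite expnS expn1; nia.
Qed.

Let D_group : [/\ 0 \in D, {in D &, forall a b, a - b \in D} & (10 * #|D| <= 11 * (L * #|S|))%N].
Proof.
have [h1 h2] := card_bounds.
have Sn : Shat != set0.
  apply/set0Pn; exists (iota 0 + 0); apply: mem_sadd => //; exact: imset_f.
have [g1 g2 g3] := small_doubling_subgroup Sn h1.
split => //.
have pos : (0 < 2 * #|Shat| - #|sadd Shat Shat|)%N by lia.
rewrite -(leq_pmul2r pos); apply: leq_trans h2; rewrite -mulnA mulnC leq_mul2r.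
by rewrite g3 orbT.
Qed.

Let natM (n : nat) : ((n %% M)%:R : G) = n%:R.
Proof.
have L0 : (L%:R : G) = 0 by exact: pchar_Zp.
have M0 : (M%:R : G) = 0 by rewrite ML natrM L0 mul0r.
by rewrite [in RHS](divn_eq n M) natrD natrM M0 mulr0 add0r.
Qed.

(** Modulo L the second coordinate is [xi] times the first. This passes from [Sh] and [W] to all of
    [D], and excludes elements (0, m) with 0 < m < L. *)
Let rel (z : Xi) := xi * z.1 == (nat_of_ord z.2)%:R.

Let relB a b : rel a -> rel b -> rel (a - b).
Proof.
rewrite /rel => /eqP ha /eqP hb; apply/eqP; rewrite mulrBr ha hb.
have : (nat_of_ord (a - b).2)%:R + (nat_of_ord b.2)%:R = (nat_of_ord a.2)%:R :> G.
  rewrite -natrD -natM; congr (_%:R).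
  have -> : ((nat_of_ord (a - b)%R.2 + nat_of_ord b.2) %% M)%N = nat_of_ord ((a - b).2 + b.2) by [].
  by congr nat_of_ord; rewrite -[RHS](subrK b.2).
by move=> <-; rewrite addrK.
Qed.

Let rel_iota x : rel (iota x).
Proof. by rewrite /rel /iota /= -[nat_of_ord _]/(nat_of_ord ((y x)%:R : K)) valK natM natr_Zp. Qed.

Let D0 : 0 \in D. Proof. by have [] := D_group. Qed.
Let DB : {in D &, forall a b, a - b \in D}. Proof. by have [] := D_group. Qed.
Let DN a : a \in D -> - a \in D.
Proof. by move=> aD; rewrite -[- a]add0r DB. Qed.
Let DD a b : a \in D -> b \in D -> a + b \in D.
Proof. by move=> aD bD; rewrite -[b]opprK DB // DN. Qed.
Let DM a k : a \in D -> a *+ k \in D.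
Proof. by move=> aD; elim: k => [|k IH]; rewrite ?mulr0n // mulrS DD. Qed.

Let rel0 : rel 0. Proof. by rewrite /rel mulr0. Qed.

Let relD z : z \in D -> rel z.
Proof.
have relN a : rel a -> rel (- a) by move=> ha; rewrite -[- a]add0r; exact: relB.
have relA a b : rel a -> rel b -> rel (a + b).
  by move=> ha hb; rewrite -[b]opprK; apply: relB => //; exact: relN.
have h : {in Shat, forall u, rel u}.
  move=> _ /saddP [_ [_ [/imsetP [s _ ->] /imsetP [k _ ->] ->]]].
  have hw : rel wh by exact: rel_iota.
  apply: (relA _ _ (rel_iota _)).
  elim: (nat_of_ord k) => [|i IH]; first by rewrite mulr0n.
  by rewrite mulrS; exact: (relA _ _ hw IH).
by move=> /imset2P [a b /h ha /h hb ->]; exact: relB.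
Qed.

Let ShD z : z \in Sh -> z \in D.
Proof.
move=> zS; apply/imset2P; exists z (0 + 0); rewrite ?addr0 ?subr0 //; last first.
  rewrite -[X in X \in _](addr0 0); apply: mem_sadd => //.
  by apply/imsetP; exists 0 => //; rewrite /iota /y /level mulr0.
by rewrite -[z]addr0 mem_sadd.
Qed.

Let whD : wh \in D. Proof. by apply: ShD; apply: imset_f. Qed.
Let YM : (Y < M)%N. Proof. by rewrite ML; move: Y0 Y8; clear; nia. Qed.

Let pos_level m := (0 < m)%N && [exists x : G, ((x, m%:R) : Xi) \in D].
Let ex_level : exists m, pos_level m.
Proof.
exists Y; rewrite /pos_level Y0; apply/existsP; exists w.
by have := whD; rewrite /wh /iota yw.
Qed.

(** [d] is the least positive height in the group [D], [v] a point at that height and [H] the fibre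
    at height 0; every height in [D] is a multiple of [d]. Since |H| Y/d is nearly |S|, the set [S]
    fills most of the strip of heights at most Y, so [S + S] contains all of [D] at heights slightly
    above Y. *)
Lemma strip : exists (v : G) (H : {set G}) (I : nat),
  [/\ (0 < I)%N, 0 \in H & {in H &, forall a b, a - b \in H}] /\
  [/\ (forall i, (0 < i < I)%N -> v *+ i \notin H),
      (forall i h, (i < I)%N -> h \in H -> v *+ i + h \in sdiff (sadd S S) (sadd S S)) &
      (#|S| <= 8 * I * #|H|)%N].
Proof.
case: (ex_minnP ex_level) => d /andP [d0 /existsP [v vD]] dmin.
pose vd : Xi := (v, d%:R).
pose H := [set x : G | ((x, 0) : Xi) \in D].
have vdM k : vd *+ k = (v *+ k, (k * d)%:R).
  by rewrite /vd pair_mulrn -mulrnA mulnC.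
have Ddiv z : z \in D -> (d %| nat_of_ord z.2)%N /\ z.1 - v *+ (nat_of_ord z.2 %/ d) \in H.
  case: z => [x m] zD; set n := nat_of_ord m.
  have mn : m = n%:R by rewrite natr_Zp.
  have h : ((x - v *+ (n %/ d), (n %% d)%:R) : Xi) \in D.
    have := DB zD (DM (n %/ d) vD); rewrite -/vd vdM; congr (_ \in D); congr pair.
    by rewrite /= mn {1}(divn_eq n d) natrD addrC addKr.
  have dn : (n %% d = 0)%N.
    apply/eqP; rewrite eqn0Ngt; apply/negP => pos.
    have := dmin (n %% d)%N; rewrite /pos_level pos => /(_ _); rewrite leqNgt ltn_mod d0 => hh.
    by have : false by apply: hh; apply/existsP; exists (x - v *+ (n %/ d)).
  by split; [rewrite /dvdn dn|rewrite inE; move: h; rewrite dn].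
have valsmall n : (n < M)%N -> nat_of_ord (n%:R : K) = n by move=> h; rewrite valK modn_small.
have dY : (d %| Y)%N.
  by have [h _] := Ddiv _ whD; move: h; rewrite /wh /iota yw /= -[nat_of_ord _]/(nat_of_ord (Y%:R : K)) valsmall.
pose e := (Y %/ d)%N.
have Yde : Y = (e * d)%N by rewrite /e divnK.
have tS : t \in S by apply: (subsetP (smul_sub B0 (_ : 1 <= j)%N)); rewrite ?smul1 // (leq_trans _ j63).
have dYb : (d %| Yb)%N.
  have [h _] := Ddiv _ (ShD (imset_f _ tS)).
  by move: h; rewrite /iota /y yt /= -[nat_of_ord _]/(nat_of_ord (Yb%:R : K)) valsmall // (leq_ltn_trans _ YM) // /Y leq_pmull // (leq_trans _ j63).
(* [d] divides the level of [t] in [S], so [e >= j]. *)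
have ej : (63 <= e)%N.
  have : (d <= Yb)%N by exact: dvdn_leq.
  by move: Yde j63 d0; rewrite /Y; clear; nia.
have H0 : 0 \in H by rewrite inE.
have H1 : (0 < #|H|)%N by rewrite card_gt0; apply/set0Pn; exists 0.
have HB : {in H &, forall a b, a - b \in H}.
  by move=> a b; rewrite !inE => aD bD; have := DB aD bD; congr (_ \in D); congr pair; rewrite /= subrr.
have cardD : (#|H| * (L * e) <= #|D|)%N.
  pose f (u : G * 'I_(L * e)) : Xi := (u.1, 0) + vd *+ (u.2 : nat).
  have fE x (k : 'I_(L * e)) : f (x, k) = (x + v *+ k, (k * d)%:R).
    by rewrite /f vdM; congr pair; rewrite /= add0r.
  have fi : {in setX H setT &, injective f}.
    move=> [x k] [x' k'] _ _; rewrite !fE => eq.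
    have e1 : x + v *+ k = x' + v *+ k' := congr1 fst eq.
    have e2 : (k * d)%:R = (k' * d)%:R :> K := congr1 snd eq.
    have := congr1 (@nat_of_ord _) e2; rewrite !valsmall; last 2 first.
    - by rewrite ML Yde mulnA ltn_pmul2r.
    - by rewrite ML Yde mulnA ltn_pmul2r.
    move=> /eqP; rewrite eqn_pmul2r // => /eqP kk; have {}kk : k = k' by apply: val_inj.
    by move: e1; rewrite kk => /addIr ->.
  have := card_in_imset fi; rewrite cardsX cardsT card_ord => <-.
  apply: subset_leq_card; apply/subsetP => _ /imsetP [[x k] + ->].
  by rewrite in_setX inE => /andP [xH _]; apply: DD => //; exact: DM.
pose St n := [set z in D | (nat_of_ord z.2 <= n * d)%N].
have cardSt n : (#|St n| <= #|H| * n.+1)%N.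
  pose f (z : Xi) : G * 'I_n.+1 := (z.1 - v *+ (nat_of_ord z.2 %/ d), inord (nat_of_ord z.2 %/ d)).
  have fi : {in St n &, injective f}.
    move=> [x m] [x' m']; rewrite !inE => /andP [zD hm] /andP [zD' hm'] eq.
    have e1 : x - v *+ (m %/ d) = x' - v *+ (m' %/ d) := congr1 fst eq.
    have := congr1 (fun u => nat_of_ord (snd u)) eq; rewrite /f /= !inordK ?ltnS ?leq_divLR //; last 2 first.
    - by have [] := Ddiv _ zD'.
    - by have [] := Ddiv _ zD.
    move=> e2; have mm : m = m'.
      apply: val_inj; have [dm _] := Ddiv _ zD; have [dm' _] := Ddiv _ zD'.
      by rewrite /= -(divnK dm) -(divnK dm') e2.
    by move: e1; rewrite mm => /addIr ->.
  rewrite -(card_in_imset fi); apply: (@leq_trans #|setX H [set: 'I_n.+1]|); last by rewrite cardsX cardsT card_ord.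
  apply: subset_leq_card; apply/subsetP => _ /imsetP [z zSt ->]; apply/setXP; split; last by rewrite inE.
  by move: zSt; rewrite inE => /andP [/Ddiv [_ h] _]; exact: h.
have ShSt n : (e <= n)%N -> Sh \subset St n.
  move=> en; apply/subsetP => z zS; rewrite inE (ShD zS) /=.
  move: zS => /imsetP [s sS ->]; rewrite /iota /= -[nat_of_ord _]/(nat_of_ord ((y s)%:R : K)).
  have hs := yS sS; rewrite valsmall ?(leq_ltn_trans hs YM) //; apply: leq_trans hs _.
  by rewrite Yde leq_mul2r en orbT.
have S_le : (#|S| <= #|H| * e.+1)%N.
  by rewrite -card_Sh; apply: leq_trans (cardSt e); apply: subset_leq_card; exact: ShSt.
have He : (10 * (#|H| * e) <= 11 * #|S|)%N.
  have [_ _ h] := D_group; have L0 : (0 < L)%N by [].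
  rewrite -(leq_pmul2l L0); move: h cardD; move: #|D| #|S| #|H| => ? ? ?; clear; nia.
(* [Sh] and [z - Sh] both lie in the strip of heights at most (e + k)d, which has at most |H|(e + k
   + 1) < 2|S| points, so they meet. *)
have claim k h : (k <= e %/ 4)%N -> h \in H -> v *+ (e + k) + h \in sadd S S.
  move=> ke hH; pose z : Xi := (h, 0) + vd *+ (e + k).
  have zE : z = (h + v *+ (e + k), ((e + k) * d)%:R) by rewrite /z vdM; congr pair; rewrite /= add0r.
  have zD : z \in D by apply: DD; [move: hH; rewrite inE|exact: DM].
  have ekM : ((e + k) * d < M)%N.
    have : (k * d <= Y)%N by rewrite Yde leq_mul2r (leq_trans ke (leq_div _ _)) orbT.
    by rewrite mulnDl -Yde ML; move: Y0 Y8; clear; nia.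
  pose Sz := [set z - u | u in Sh].
  have cSz : #|Sz| = #|S| by rewrite card_imset ?card_Sh // => a b /addrI /oppr_inj.
  have SzSt : Sz \subset St (e + k)%N.
    apply/subsetP => _ /imsetP [u uS ->]; rewrite inE (DB zD (ShD uS)) andTb.
    move: uS => /imsetP [s sS ->]; rewrite zE.
    have hs := yS sS.
    have ys : (y s <= (e + k) * d)%N by apply: leq_trans hs _; rewrite Yde leq_mul2r leq_addr orbT.
    rewrite -[X in (X <= _)%N]/(nat_of_ord (((e + k) * d)%:R - (y s)%:R : K)) -natrB // valsmall ?leq_subr //.
    exact: leq_ltn_trans (leq_subr _ _) ekM.
  have ne : Sh :&: Sz != set0.
    rewrite -card_gt0 lt0n; apply/negP => /eqP c0.
    have := cardsUI Sh Sz; rewrite c0 addn0 card_Sh cSz => cU.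
    have : (#|Sh :|: Sz| <= #|H| * (e + k).+1)%N.
      apply: leq_trans (cardSt _); apply: subset_leq_card; apply/subUsetP; split => //.
      by apply: ShSt; exact: leq_addr.
    have k4 : (4 * k <= e)%N by rewrite mulnC -leq_divRL.
    by move: cU He H1 ej k4; move: #|S| #|H| #|_| => ? ? ?; clear; nia.
  have /set0Pn [u] := ne; rewrite inE => /andP [/imsetP [s sS us] /imsetP [u' /imsetP [s' s'S us'] uz]].
  have zz : z = iota (s + s').
    by rewrite iotaSS // -us -us' uz subrK.
  have := congr1 fst zz; rewrite zE /= => e1.
  by rewrite [_ + h]addrC -[X in X \in _]/(h + v *+ (e + k)) [X in X \in _]e1 mem_sadd.
(* Differences of elements at heights e + i and e, with i at most e/4, give all of [v *+ i + h]. *)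
exists v, H, (e %/ 4).+1; split; first by split.
split.
- move=> i /andP [i0 iI]; apply/negP => iH.
  have : ((0, (i * d)%:R) : Xi) \in D.
    have iD : ((v *+ i, 0) : Xi) \in D by move: iH; rewrite inE.
    have := DB (DM i vD) iD; rewrite -/vd vdM; congr (_ \in D); congr pair; rewrite /= ?subrr //.
    by rewrite subr0.
  have idY : (i * d <= Y)%N by rewrite Yde leq_mul2r (leq_trans (iI : (i <= e %/ 4)%N) (leq_div _ _)) orbT.
  move=> /relD; rewrite /rel /= mulr0 -[nat_of_ord _]/(nat_of_ord ((i * d)%:R : K)).
  rewrite valsmall ?(leq_ltn_trans idY YM) // => /eqP /(congr1 (@nat_of_ord _)).
  rewrite val_Zp_nat //= modn_small; first by move=> /esym/eqP; rewrite muln_eq0 !eqn0Ngt i0 d0.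
  by apply: leq_ltn_trans idY _; move: Y8 Y0; clear; lia.
- move=> i h iI hH; apply/imset2P; exists (v *+ (e + i) + h) (v *+ (e + 0) + 0).
  + by apply: claim.
  + by apply: claim.
  by rewrite addn0 mulrnDr; ring.
apply: leq_trans S_le _; rewrite mulnC; apply: leq_mul => //.
by move: ej; move: (e) => n; clear; lia.
Qed.

End Strip.

(** * Numerical choices for the critical pair *)

Section Constants.
Variable R : realType.

Lemma bernoulli_geometric (x : R) (m : nat) : 0 <= x -> x <= 1 -> (1 - x) ^+ m * (1 + m%:R * x) <= 1.
Proof.
move=> x0 x1; elim: m => [|m IH]; first by rewrite expr0 mul0r addr0 mulr1.
apply: le_trans IH; rewrite exprSr -mulrA; apply: ler_wpM2l; first by rewrite exprn_ge0 // subr_ge0.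
rewrite -natr1; have : 0 <= m%:R :> R by []; move: (m%:R : R) => k; nra.
Qed.

Lemma exists_small_power (x t : R) : 0 < x -> x <= 1 -> 0 < t -> exists m : nat, (1 - x) ^+ m <= t.
Proof.
move=> x0 x1 t0; have [m m0 hm] := exists_nat_ge ((t * x)^-1).
exists m; have h := bernoulli_geometric m (ltW x0) x1.
have tx : 0 < t * x by rewrite mulr_gt0.
have h1 : 1 <= m%:R * (t * x) by rewrite -ler_pdivrMr // mul1r.
have h2 : 0 <= (1 - x) ^+ m by rewrite exprn_ge0 // subr_ge0.
have h3 : 0 <= (1 - x) ^+ m * (m%:R * (t * x) - 1) by rewrite mulr_ge0 // subr_ge0.
move: h h2 h3; move: ((1 - x) ^+ m) (m%:R : R) => y k; nra.
Qed.

Lemma exists_ratio_power : exists m, (5 * 40 ^ m < 41 ^ m)%N.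
Proof.
have h m : (40 ^ m * (40 + m) <= 41 ^ m * 40)%N.
  elim: m => [|m IH]; first by rewrite !expn0.
  rewrite !expnS; have : (0 < 40 ^ m)%N by rewrite expn_gt0.
  by move: IH; move: (40 ^ m)%N (41 ^ m)%N => a b; nia.
suff [m hm] : exists m, (200 < m)%N.
  exists m; have := h m; have : (0 < 40 ^ m)%N by rewrite expn_gt0.
  by move: (40 ^ m)%N (41 ^ m)%N => a b; nia.
by exists 201%N.
Qed.

(** If every doubling of the index multiplied [s] by more than 41/20, then s(64 2^m) would exceed
    (41/20)^m 64b; the linear bound is at most 5 2^m 64b, and (41/40)^m > 5. The start 64 ensures
    the 63 multiples needed by [card_top]. *)
Lemma dyadic_doubling (s : nat -> nat) (b m : nat) : (5 * 40 ^ m < 41 ^ m)%N -> (0 < b)%N ->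
  (64 * b <= s 64)%N -> (s (2 ^ (6 + m))%N <= 4 * (2 ^ (6 + m)).+1 * b)%N ->
  exists2 i, (i < m)%N & (20 * s (2 * 2 ^ (6 + i)) <= 41 * s (2 ^ (6 + i)))%N.
Proof.
move=> hm b0 lo up.
have [/existsP [i hi]|no] := boolP [exists i : 'I_m, 20 * s (2 * 2 ^ (6 + i)) <= 41 * s (2 ^ (6 + i))]%N.
  by exists (i : nat).
exfalso.
have h k : (k <= m)%N -> (41 ^ k * (64 * b) <= 20 ^ k * s (2 ^ (6 + k)))%N.
  elim: k => [|k IH] km; first by rewrite !expn0 !mul1n addn0.
  have : (41 * s (2 ^ (6 + k)) < 20 * s (2 * 2 ^ (6 + k)))%N.
    by rewrite ltnNge; apply: contra no => hk; apply/existsP; exists (Ordinal km).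
  have -> : (2 ^ (6 + k.+1) = 2 * 2 ^ (6 + k))%N by rewrite addnS expnS.
  rewrite (expnS 41) (expnS 20); move: (IH (ltnW km)).
  move: (41 ^ k)%N (20 ^ k)%N (s _) (s _) (64 * b)%N => p q v u w; clear => h1 h2.
  have h3 : (q * (41 * u) <= q * (20 * v))%N by rewrite leq_mul2l (ltnW h2) orbT.
  have -> : (41 * p * w = 41 * (p * w))%N by rewrite mulnA.
  have -> : (20 * q * v = q * (20 * v))%N by rewrite mulnA [(q * 20)%N]mulnC.
  by apply: leq_trans h3; rewrite [X in (_ <= X)%N]mulnCA leq_mul2l h1.
have := h m (leqnn m); rewrite expnD in up *; move: up hm.
have -> : (40 ^ m = 20 ^ m * 2 ^ m)%N by rewrite -expnMn.
have : (0 < 2 ^ m)%N by rewrite expn_gt0.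
have : (0 < 20 ^ m)%N by rewrite expn_gt0.
rewrite [(2 ^ 6)%N]/=; move: (20 ^ m)%N (2 ^ m)%N (41 ^ m)%N (s _) => p q r u; clear -b0.
move=> p0 q0 up hm h2.
have h3 : (p * u <= p * (5 * (64 * q) * b))%N by rewrite leq_mul2l; apply/orP; right; nia.
nia.
Qed.

End Constants.

(** * The structure of critical pairs *)

Section CriticalPair.
Variable R : realType.

Lemma smul_shift (G : finComNzRingType) (u : G) (B : {set G}) k :
  smul k (sadd [set u] B) = sadd [set u *+ k] (smul k B).
Proof.
elim: k => [|k IH] /=.
  by rewrite mulr0n sadd0.
rewrite IH mulrSr.
have -> : [set u *+ k + u] = sadd [set u *+ k] [set u].
  by apply/setP => x; rewrite sadd1P !inE subr_eq addrC.
by rewrite -!saddA; congr sadd; rewrite saddA [sadd (smul k B) _]saddC -saddA.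
Qed.

Lemma card_smul_shift (G : finComNzRingType) (u : G) (B : {set G}) k :
  #|smul k (sadd [set u] B)| = #|smul k B|.
Proof. by rewrite smul_shift card_sadd1. Qed.

Lemma short_increment (s : nat -> nat) (J b : nat) : (0 < J)%N ->
  {homo s : i j / (i <= j)%N} -> (s (2 * J) <= 12 * J * b)%N ->
  exists2 j, (J <= j < 2 * J)%N & (s j.+1 <= s j + 12 * b)%N.
Proof.
move=> J0 mono up.
have [/existsP [i hi]|no] := boolP [exists i : 'I_J, s (J + i).+1 <= s (J + i) + 12 * b]%N.
  by exists (J + i)%N => //; have := ltn_ord i; lia.
exfalso.
have h k : (k <= J)%N -> (s J + k * (12 * b).+1 <= s (J + k))%N.
  elim: k => [|k IH] kJ; first by rewrite addn0 mul0n addn0.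
  have : (s (J + k) + 12 * b < s (J + k).+1)%N.
    by rewrite ltnNge; apply: contra no => hk; apply/existsP; exists (Ordinal kJ).
  by have := IH (ltnW kJ); rewrite addnS; lia.
have := h J (leqnn J); rewrite addnn -mul2n; nia.
Qed.

(** Two multiples of [B] are used. A long one, [X], hardly moves under [B] and produces the
    character [xi]; a bounded one, [smul j' B], has doubling at most 41/20 and goes into [strip],
    after a translation that makes all levels small. *)
Lemma critical_strip (m : nat) : (5 * 40 ^ m < 41 ^ m)%N -> exists n : nat,
  forall (p : nat) (E B0 C : {set 'Z_p.+2}), 0 \in C -> generating C -> E != set0 -> B0 != set0 ->
    (#|sadd (sadd E (sadd C C)) B0| <= #|E| + 2 * #|B0|)%N ->
    (4 * n.+2 * #|B0| <= #|E|)%N -> (#|E| + 4 * n.+2 * #|B0| < p.+2)%N ->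
  exists (v : 'Z_p.+2) (H : {set 'Z_p.+2}) (I : nat),
  [/\ (0 < I)%N, 0 \in H & {in H &, forall a b, a - b \in H}] /\
  [/\ (forall i, (0 < i < I)%N -> v *+ i \notin H),
      (forall i h, (i < I)%N -> h \in H -> (period_defect E (v *+ i + h)%R <= 8 * 2 ^ (6 + m) * #|B0|)%N) &
      (#|B0| <= 8 * I * #|H|)%N].
Proof.
move=> hm; set J := (2 ^ (6 + m))%N.
have J0 : (0 < J)%N by rewrite expn_gt0.
(* Levels below 2L/(16J + 2) satisfy [8 * j' * Yb < L] for all j' <= J. *)
have N1 : (1 < 16 * J + 2)%N by lia.
have [nu nu0 harc] := short_arc R N1.
(* For j >= J2 an increment of 12b is at most [nu] times jb <= |X|. *)
have [J2 J20 hJ2] := exists_nat_ge (12 / nu).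
(* Room for the index 2j with j < 2 J2, and for 2j' with j' <= J. *)
exists (4 * J2 + 2 * J)%N => p E F C C0 gC E0 F0.
set n := (4 * J2 + 2 * J)%N => hE hn hL.
have [f fF] : exists f, f \in F by apply/set0Pn.
pose B0 := sadd [set - f] F.
have cB0 : #|B0| = #|F| by rewrite card_sadd1.
have B00 : 0 \in B0 by rewrite sadd1P opprK add0r.
have hE' : (#|sadd (sadd E (sadd C C)) B0| <= #|E| + 2 * #|B0|)%N.
  by rewrite cB0 /B0 [sadd [set - f] F]saddC saddA saddC card_sadd1.
rewrite -cB0 in hn hL *; set b := #|B0|.
have cG : #|'Z_p.+2| = p.+2 by rewrite card_ord.
have hL' : (#|E| + 4 * n.+2 * b < #|'Z_p.+2|)%N by rewrite cG.
have grow := linear_growth C0 gC E0 B00 hE' hn hL'.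
set B := sadd B0 C in grow.
have b0 : (0 < b)%N by rewrite card_gt0; apply/set0Pn; exists 0.
have B0n : 0 \in B by rewrite -(addr0 0) mem_sadd.
have Bn : B != set0 by apply/set0Pn; exists 0.
have mono : {homo (fun k => #|smul k B|) : i j / (i <= j)%N}.
  by move=> i j ij; apply: subset_leq_card; exact: smul_sub.
have up2 : (#|smul (2 * J2) B| <= 12 * J2 * b)%N.
  have [_ h _] := grow (2 * J2)%N (ltac:(rewrite /n; clear; lia)).
  by apply: leq_trans h _; rewrite leq_mul2r; apply/orP; right; move: J20; clear; lia.
have [j /andP [j1 j2] hj] := short_increment J20 mono up2.
set X := smul j B.
have jn : (j <= n)%N by move: j2; rewrite /n; clear; lia.
have j2n : (2 * j <= n)%N by move: j2; rewrite /n; clear; lia.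
have [Xlo _ _] := grow j jn; have [_ X2up _] := grow (2 * j)%N j2n.
have XX : sadd X X = smul (2 * j) B by rewrite mul2n -addnn smulD.
have X0 : X != set0 by exact: smul_neq0.
have X12 : (#|sadd X X| <= 12 * #|X|)%N.
  rewrite XX; apply: leq_trans X2up _; apply: (@leq_trans (12 * (j * b))%N); last by rewrite leq_mul2l Xlo orbT.
  by rewrite mulnA leq_mul2r; apply/orP; right; move: j1 J20; clear; lia.
have Xsmall : (2 * #|sadd X X| <= p.+2)%N.
  rewrite XX; have h : (4 * (2 * j).+1 * b <= 4 * n.+2 * b)%N.
    by rewrite leq_mul2r; apply/orP; right; move: j2n; clear; lia.
  by move: X2up h hn hL; rewrite -/b; move: (4 * n.+2 * b)%N (4 * (2 * j).+1 * b)%N #|E| #|_| => ? ? ? ?; clear; lia.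
have Xshift : {in B, forall u, #|sadd [set u] X :\: X|%:R <= nu * #|X|%:R}.
  move=> u uB.
  have h1 : (#|sadd [set u] X :\: X| <= 12 * b)%N.
    rewrite -(leq_add2l #|X|) addnC card_setD_add; apply: leq_trans hj; apply: subset_leq_card.
    apply/subUsetP; split; first exact: sadd1_sub.
    by apply: smul_sub.
  apply: le_trans (_ : (12 * b)%:R <= _); first by rewrite ler_nat.
  apply: le_trans (_ : nu * (j * b)%:R <= _); last by rewrite ler_pM2l // ler_nat.
  rewrite !natrM mulrA; apply: ler_wpM2r => //.
  move: hJ2; rewrite ler_pdivrMr // mulrC => hJ2; apply: le_trans hJ2 _.
  by rewrite ler_pM2l // ler_nat.
have [xi xi0 [u0 u0B harc']] := harc _ _ _ X0 Bn X12 Xsmall Xshift.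
pose B' := sadd [set - u0] B.
have B'0 : 0 \in B' by rewrite sadd1P opprK add0r.
have arcB' u : u \in B' -> ((16 * J + 2) * level xi u < 2 * p.+2)%N.
  by rewrite sadd1P opprK => /harc'; rewrite addrK.
have [t tB' tmax] : exists2 t, t \in B' & {in B', forall u, (level xi u <= level xi t)%N}.
  by case: (arg_maxnP (fun u => level xi u) B'0) => t tB' h; exists t.
set Yb := level xi t.
(* Otherwise [xi] annihilates [B'], hence [C], hence the whole group, although [xi] is not 0. *)
have Yb0 : (0 < Yb)%N.
  rewrite lt0n; apply/negP => /eqP Y0.
  have B'z u : u \in B' -> xi * u = 0.
    by move=> /tmax; rewrite -/Yb Y0 leqn0 => /eqP h; apply: val_inj; exact: h.
  have CB : C \subset B by rewrite /B saddC; exact: sub_saddr.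
  have Cz c : c \in C -> xi * c = 0.
    move=> cC; have h1 := B'z (c - u0); have h2 := B'z (- u0).
    rewrite -[c](subrK u0) mulrDr h1; last by rewrite sadd1P opprK subrK (subsetP CB).
    by rewrite add0r -[u0]opprK mulrN h2 ?oppr0 // sadd1P opprK addNr.
  have := gC [set x | xi * x == 0]; rewrite inE mulr0 eqxx => /(_ isT) h.
  have : 1 \in [set x | xi * x == 0].
    rewrite h ?inE //; apply/subsetP => _ /saddP [x [c [+ cC ->]]].
    by rewrite !inE mulrDr (Cz c cC) addr0.
  by rewrite inE mulr1 (negPf xi0).
have s64 : (64 * b <= #|smul 64 B|)%N.
  have h : (64 <= n)%N.
    apply: (@leq_trans (2 ^ 6 * 2 ^ m)%N).
      by apply: (@leq_trans (2 ^ 6)%N) => //; rewrite leq_pmulr // expn_gt0.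
    by rewrite -expnD -/J /n; clear; lia.
  by have [] := grow 64 h.
have sJ : (#|smul J B| <= 4 * J.+1 * b)%N.
  by have [] := grow J (ltac:(rewrite /n; clear; lia)).
have [i im hi] := @dyadic_doubling (fun k => #|smul k B|) b m hm b0 s64 sJ.
set j' := (2 ^ (6 + i))%N in hi.
have j'J : (j' <= J)%N by rewrite leq_exp2l // leq_add2l ltnW.
have j'63 : (63 <= j')%N.
  rewrite /j' expnD; apply: (@leq_trans (2 ^ 6)%N) => //.
  by rewrite leq_pmulr // expn_gt0.
have small : (8 * j' * Yb < p.+2)%N.
  have h1 : (16 * j' * Yb <= (16 * J + 2) * Yb)%N.
    by rewrite leq_mul2r; apply/orP; right; move: j'J; clear; lia.
  by have h2 := arcB' _ tB'; move: h1 h2; rewrite -/Yb; move: ((16 * J + 2) * Yb)%N; clear; nia.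
have dbl : (20 * #|sadd (smul j' B') (smul j' B')| <= 41 * #|smul j' B'|)%N.
  by rewrite -smulD addnn -mul2n !card_smul_shift.
have MLY : ((p.+2 * (j' * Yb) - 2).+2 = p.+2 * (j' * Yb))%N.
  have : (0 < j' * Yb)%N by rewrite muln_gt0 Yb0 andbT; apply: leq_trans j'63.
  by move: (j' * Yb)%N; clear; nia.
have [v [H [I [[I0 H0 HB] [h1 h2 h3]]]]] :=
  strip B'0 tB' (erefl Yb) tmax Yb0 small j'63 MLY dbl.
exists v, H, I; split => //; split => //.
  move=> k h kI hH; have := h2 k h kI hH; rewrite -!smulD !smul_shift.
  move=> /imset2P [x y]; rewrite !sadd1P addnn -mul2n => xS yS ->.
  set w := (- u0) *+ (2 * j'); rewrite -/w in xS yS.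
  have -> : x - y = (x - w) + - (y - w) by ring.
  have j'n : (2 * j' <= n)%N by move: j'J; rewrite /n; clear; lia.
  have [_ _ pd] := grow _ j'n.
  apply: leq_trans (period_defectD _ _ _) _; rewrite period_defectN.
  apply: leq_trans (leq_add (pd _ xS) (pd _ yS)) _.
  have : (j' * b <= J * b)%N by rewrite leq_mul2r j'J orbT.
  by clear; nia.
apply: leq_trans h3; rewrite card_smul_shift.
have j'n : (j' <= n)%N by move: j'J; rewrite /n; clear; lia.
have [lo _ _] := grow _ j'n; apply: leq_trans lo.
by rewrite leq_pmull // (leq_trans _ j'63).
Qed.

Theorem critical_pair (eps eta : R) : 0 < eps -> eps < 1 -> 0 < eta ->
  exists2 d1 : R, 0 < d1 & exists2 c : R, 0 < c &
  forall (p : nat) (E F C : {set 'Z_p.+2}), 0 \in C -> generating C -> E != set0 -> F != set0 ->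
    #|E|%:R <= 4 * #|F|%:R :> R -> #|F|%:R <= 4 * #|E|%:R :> R ->
    #|E|%:R + #|F|%:R <= (1 - eps) * p.+2%:R ->
    #|sadd (sadd E (sadd C C)) F|%:R <= (1 + d1) * (#|E|%:R + #|F|%:R) ->
  exists (v : 'Z_p.+2) (H : {set 'Z_p.+2}) (I : nat),
  [/\ (0 < I)%N, 0 \in H & {in H &, forall a b, a - b \in H}] /\
  [/\ (forall i, (0 < i < I)%N -> v *+ i \notin H),
      (forall i h, (i < I)%N -> h \in H -> (period_defect E (v *+ i + h))%:R <= eta * #|E|%:R) &
      c * #|E|%:R <= I%:R * #|H|%:R].
Proof.
move=> eps0 eps1 eta0.
have [m hm] := exists_ratio_power.
have [n hstrip] := critical_strip hm.
set J := (2 ^ (6 + m))%N in hstrip.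
have J0 : 0 < J%:R :> R by rewrite ltr0n expn_gt0.
(* The first bound leaves room in [E] and in the group for linear growth up to [n]; the second makes
   the defect [8 * J * #|B0|] at most [eta * #|E|]. *)
pose tau := Num.min (eps / (4 * n.+2%:R)) (eta / (8 * J%:R)).
have tau0 : 0 < tau by rewrite lt_min !divr_gt0 // mulr_gt0.
have tau1 : tau <= eps / (4 * n.+2%:R) by rewrite ge_min lexx.
have tau2 : tau <= eta / (8 * J%:R) by rewrite ge_min lexx orbT.
have e4 : 0 < eps / 4 by rewrite divr_gt0.
have e4' : eps / 4 <= 1 by lra.
have [k hk] := exists_small_power e4 e4' (divr_gt0 tau0 (ltr0Sn R 3)).
have h2k : 0 < (1 / 2 : R) ^+ k by rewrite exprn_gt0 // divr_gt0.
have p2k : 0 < (2 : R) ^+ k by rewrite exprn_gt0.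
(* As |E| <= 4|F|, the defect is at most 5 d1 |F|, and [k] doublings bring it exactly to the limit
   allowed by [shrink]. The 32 below is 8 from [strip] times 4 from |E| <= 4|F|. *)
pose d1 := eps / 40 * ((1 / 2) ^+ k / 2 ^+ k).
have d10 : 0 < d1 by rewrite mulr_gt0 ?divr_gt0.
exists d1 => //; exists ((1 / 2) ^+ k / 32); first by rewrite divr_gt0.
move=> p E F C C0 gC E0 F0 EF FE hEF hcrit.
have Fp : 0 < #|F|%:R :> R by rewrite ltr0n card_gt0.
have Ep : 0 < #|E|%:R :> R by rewrite ltr0n card_gt0.
have cG : #|'Z_p.+2| = p.+2 by rewrite card_ord.
pose x : R := d1 * (#|E|%:R + #|F|%:R).
have x0 : 0 <= x by rewrite mulr_ge0 ?addr_ge0 // ltW.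
have xle : x <= 5 * d1 * #|F|%:R.
  by rewrite /x -mulrA mulrCA ler_pM2l //; move: EF; lra.
have h2x : 2 ^+ k * x <= eps / 8 * ((1 / 2) ^+ k * #|F|%:R).
  apply: le_trans (ler_wpM2l (ltW p2k) xle) _; rewrite /d1 le_eqVlt; apply/orP; left; apply/eqP.
  by field; rewrite gt_eqF.
have hEF' : #|E|%:R + #|F|%:R <= (1 - eps) * #|'Z_p.+2|%:R by rewrite cG.
have hx : #|sadd (sadd E (sadd C C)) F|%:R <= #|E|%:R + #|F|%:R + x.
  by apply: le_trans hcrit _; rewrite /x; lra.
have [B0 B00 [b1 b2 b3]] := shrink C0 gC E0 F0 eps0 eps1 hEF' x0 hx h2x.
have Bp : 0 < #|B0|%:R :> R by rewrite ltr0n card_gt0.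
have bE : #|B0|%:R <= tau * #|E|%:R.
  apply: le_trans b2 _; apply: le_trans (ler_wpM2r (ltW Fp) hk) _.
  by rewrite -mulrA ler_pM2l // ler_pdivrMl.
have B3 : (#|sadd (sadd E (sadd C C)) B0| <= #|E| + 2 * #|B0|)%N.
  rewrite -(ler_nat R) natrD natrM; apply: le_trans b3 _.
  have : eps / 8 * ((1 / 2) ^+ k * #|F|%:R) <= #|B0|%:R.
    by apply: le_trans b1; rewrite ler_piMl ?mulr_ge0 ?(ltW h2k) //; lra.
  by move: h2x; lra.
have n4 : 0 < 4 * n.+2%:R :> R by rewrite mulr_gt0.
have nb : 4 * n.+2%:R * #|B0|%:R <= eps * #|E|%:R.
  apply: le_trans (ler_wpM2l (ltW n4) bE) _; rewrite mulrA ler_pM2r // mulrC -ler_pdivlMr //.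
have nat1 : (4 * n.+2 * #|B0| <= #|E|)%N.
  by rewrite -(ler_nat R) !natrM; apply: le_trans nb _; rewrite ler_piMl // ltW.
have EL : #|E|%:R < (1 - eps) * p.+2%:R by move: hEF Fp; lra.
have nat2 : (#|E| + 4 * n.+2 * #|B0| < p.+2)%N.
  rewrite -(ltr_nat R) natrD !natrM; apply: le_lt_trans (lerD (lexx _) nb) _.
  have : eps * #|E|%:R <= eps * p.+2%:R by rewrite ler_pM2l // ler_nat; have := max_card E; rewrite cG.
  by move: EL; lra.
have [v [H [I [hI [h1 h2 h3]]]]] := hstrip p E B0 C C0 gC E0 B00 B3 nat1 nat2.
exists v, H, I; split => //; split => //.
  move=> i h iI hH; apply: le_trans (_ : (8 * J * #|B0|)%:R <= _); first by rewrite ler_nat h2.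
  have J8 : 0 < 8 * J%:R :> R by rewrite mulr_gt0.
  rewrite natrM natrM; apply: le_trans (ler_wpM2l (ltW J8) bE) _.
  by rewrite mulrA ler_pM2r // mulrC -ler_pdivlMr.
have : #|B0|%:R <= 8 * (I%:R * #|H|%:R) :> R by rewrite mulrA -!natrM ler_nat.
have : (1 / 2) ^+ k * #|E|%:R <= (1 / 2) ^+ k * (4 * #|F|%:R) :> R by rewrite ler_pM2l.
by move: b1; move: ((1 / 2) ^+ k) => z; lra.
Qed.

End CriticalPair.

(** * Two-dimensional progressions in lattices *)

Section ReducedBasis.
Implicit Types (a b c u x : int) (I M m : nat).

Lemma nearest_multiple a b : b != 0 -> exists t : int, (2 * absz (a + t * b)%R <= `|b|)%N.
Proof.
move=> b0.
have h : forall n, (`|a| <= n)%N -> exists t : int, (2 * absz (a + t * b)%R <= `|b|)%N.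
  move=> n; clear -b0; elim: n a => [|n IH] a an.
    by exists 0; rewrite mul0r addr0; lia.
  have [small|big] := leqP (2 * `|a|)%N `|b|%N; first by exists 0; rewrite mul0r addr0.
  have [ab|ab] := leP 0 (a * b).
    have [t ht] := IH (a - b) (ltac:(clear IH; nia)); exists (t - 1).
    by rewrite (_ : a + (t - 1) * b = a - b + t * b) //; ring.
  have [t ht] := IH (a + b) (ltac:(clear IH; nia)); exists (t + 1).
  by rewrite (_ : a + (t + 1) * b = a + b + t * b) //; ring.
exact: (h `|a|%N).
Qed.

Lemma double_half_mul (y z k n : nat) : (2 * y <= z)%N -> (2 * (z * k) * (y * k) <= (z * k) ^ 2 + n)%N.
Proof.
move=> h; apply: leq_trans (leq_addr _ _).
have -> : (2 * (z * k) * (y * k) = z * k * (2 * y * k))%N by lia.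
by rewrite -mulnn leq_mul2l leq_mul2r h !orbT.
Qed.

Lemma abs_comb_mul (a b c d : int) (k : nat) :
  (absz (a * b + c * d)%R * k <= `|a| * (`|b| * k) + `|c| * (`|d| * k))%N.
Proof.
rewrite !mulnA -mulnDl leq_mul2r -!abszM; apply/orP; right.
by move: (a * b) (c * d) => p q; lia.
Qed.

Lemma minimal_nat (P : nat -> Prop) : (exists n, P n) -> exists2 n, P n & forall k, P k -> (n <= k)%N.
Proof.
have h N : forall n, (n <= N)%N -> P n -> exists2 n, P n & forall k, P k -> (n <= k)%N.
  elim: N => [|N IH] n nN Pn.
    by exists n => // k _; move: nN; rewrite leqn0 => /eqP ->.
  have [[k [kn Pk]]|no] := boolp.pselect (exists k, (k < n)%N /\ P k).
    by apply: (IH k) => //; rewrite -ltnS; exact: leq_trans kn nN.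
  exists n => // k Pk; rewrite leqNgt; apply/negP => kn; apply: no; by exists k.
by move=> [n Pn]; exact: (h n n).
Qed.

(** Lagrange-Gauss reduction of the lattice of points (i, iu + k lam) for the norm max(M|i|, I|x|),
    whose scaled determinant is lam I M: a shortest vector is primitive, is completed to a basis,
    and the second vector is reduced modulo the first. *)
Lemma reduced_lattice_basis (lam I M : nat) u : (0 < lam)%N -> (0 < I)%N -> (0 < M)%N ->
  exists i1 k1 i2 k2 : int, exists m1 m2 : nat,
  [/\ i1 * k2 - k1 * i2 = 1, (0 < m1)%N, (0 < m2)%N & (m1 * m2 <= 2 * (lam * (I * M)))%N] /\
  [/\ (`|i1| * M <= m1)%N, (absz (i1 * u + k1 * lam%:Z)%R * I <= m1)%N,
      (`|i2| * M <= m2)%N & (absz (i2 * u + k2 * lam%:Z)%R * I <= m2)%N].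
Proof.
move=> lam0 I0 M0.
pose nrm i k := maxn (`|i| * M) (absz (i * u + k * lam%:Z)%R * I).
pose P m := exists i k : int, ((i != 0) || (k != 0)) /\ nrm i k = m.
have nrm0 (i k : int) : (i != 0) || (k != 0) -> (0 < nrm i k)%N.
  move=> ik; rewrite /nrm leq_max; apply/orP; have [i0|i0] := eqVneq i 0.
    right; rewrite i0 mul0r add0r muln_gt0 I0 andbT absz_gt0 mulf_neq0 //; last by case: (lam) lam0.
    by move: ik; rewrite i0 eqxx.
  by left; rewrite muln_gt0 absz_gt0 i0.
have [m [i1 [k1 [ik m1E]]] mmin] : exists2 m, P m & forall k, P k -> (m <= k)%N.
  by apply: minimal_nat; exists (nrm 1 0), 1, 0.
have min i k : (i != 0) || (k != 0) -> (m <= nrm i k)%N by move=> h; apply: mmin; exists i, k.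
have m0 : (0 < m)%N by rewrite -m1E; exact: nrm0.
have g1 : gcdz i1 k1 = 1.
  have [s hs] : exists s, i1 = s * gcdz i1 k1 by apply/dvdzP; exact: dvdz_gcdl.
  have [t ht] : exists t, k1 = t * gcdz i1 k1 by apply/dvdzP; exact: dvdz_gcdr.
  have g0 : gcdz i1 k1 != 0 by rewrite gcdz_eq0 negb_and.
  have st : (s != 0) || (t != 0).
    by apply: contraTT ik => /norP [/negPn/eqP s0 /negPn/eqP t0]; rewrite hs ht s0 t0 !mul0r eqxx.
  have := min s t st.
  have gp : 0 <= gcdz i1 k1 by [].
  move: m1E m0 g0 gp hs ht; move: (gcdz i1 k1) => g m1E m0 g0 gp hs ht.
  have -> : m = (`|g| * nrm s t)%N.
    rewrite -m1E /nrm maxnMr hs ht (_ : s * g * u + t * g * lam%:Z = (s * u + t * lam%:Z) * g); last by ring.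
    by rewrite !abszM; congr maxn; rewrite [in RHS]mulnA; congr (_ * _)%N; rewrite mulnC.
  by move=> h; have := nrm0 _ _ st; nia.
have [i2' [k2' det']] : exists i k : int, i1 * k - k1 * i = 1.
  have [a [b hab]] := Bezoutz i1 k1.
  by exists (- b), a; rewrite -g1 -hab; ring.
have shift t : i1 * (k2' + t * k1) - k1 * (i2' + t * i1) = 1 by rewrite -det'; ring.
pose x1 := i1 * u + k1 * lam%:Z.
have m1 : m = maxn (`|i1| * M) (`|x1| * I) by rewrite -m1E.
have main i2 k2 : i1 * k2 - k1 * i2 = 1 -> let x2 := i2 * u + k2 * lam%:Z in
    (2 * m * (`|i2| * M) <= m ^ 2 + 2 * (lam * (I * M)))%N ->
    (2 * m * (`|x2| * I) <= m ^ 2 + 2 * (lam * (I * M)))%N ->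
    exists i1 k1 i2 k2 : int, exists m1 m2 : nat,
  [/\ i1 * k2 - k1 * i2 = 1, (0 < m1)%N, (0 < m2)%N & (m1 * m2 <= 2 * (lam * (I * M)))%N] /\
  [/\ (`|i1| * M <= m1)%N, (absz (i1 * u + k1 * lam%:Z)%R * I <= m1)%N,
      (`|i2| * M <= m2)%N & (absz (i2 * u + k2 * lam%:Z)%R * I <= m2)%N].
  move=> det x2 h1 h2; exists i1, k1, i2, k2, m, (nrm i2 k2).
  have ik2 : (i2 != 0) || (k2 != 0).
    rewrite -negb_and; apply/negP => /andP [/eqP z1 /eqP z2].
    by move: det; rewrite z1 z2 !mulr0 subrr.
  have h3 : (2 * m * nrm i2 k2 <= m ^ 2 + 2 * (lam * (I * M)))%N.
    by rewrite /nrm; case: (leqP (`|i2| * M)%N (absz (i2 * u + k2 * lam%:Z)%R * I)%N).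
  have h4 := min _ _ ik2.
  split; first split=> //; first exact: nrm0.
    have h5 : (m * m <= m * nrm i2 k2)%N by rewrite leq_mul2l h4 orbT.
    by move: h3 h5; rewrite -mulnn -!mulnA; move: (m * m)%N (m * nrm i2 k2)%N => p q; clear; lia.
  split; [by rewrite m1 leq_maxl|by rewrite m1 leq_maxr|exact: leq_maxl|exact: leq_maxr].
have det2 i2 k2 : i1 * k2 - k1 * i2 = 1 -> i1 * (i2 * u + k2 * lam%:Z) - x1 * i2 = lam%:Z.
  by move=> det; rewrite -[RHS]mul1r -det /x1; ring.
(* The coordinate that realises the norm of the first vector is reduced by a nearest multiple; the
   determinant then bounds the other coordinate. *)
have [big|big] := leqP (`|i1| * M)%N (`|x1| * I)%N.
- have mx : m = (`|x1| * I)%N by rewrite m1; apply/maxn_idPr.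
  have x10 : x1 != 0 by apply: contraTneq m0 => x10; rewrite mx x10.
  have [t ht] := nearest_multiple (i2' * u + k2' * lam%:Z) x10.
  pose i2 := i2' + t * i1; pose k2 := k2' + t * k1.
  have x2E : i2 * u + k2 * lam%:Z = i2' * u + k2' * lam%:Z + t * x1 by rewrite /i2 /k2 /x1; ring.
  rewrite -x2E in ht; have d2 := det2 _ _ (shift t); rewrite -/i2 -/k2 in d2.
  apply: (main i2 k2 (shift t)); rewrite -/i2 -/k2.
    move: d2 ht big; rewrite mx; move: (i2 * u + _) => x2; clear -I0 M0.
    move=> d2 ht big.
    have h1 : (`|x1| * `|i2| <= `|i1| * `|x2| + lam)%N by rewrite -!abszM; lia.
    have h2 : (2 * (`|x1| * `|i2|) <= `|i1| * `|x1| + 2 * lam)%N.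
      have h3 : (`|i1| * (2 * `|x2|) <= `|i1| * `|x1|)%N by rewrite leq_mul2l ht orbT.
      by move: h1 h3; rewrite mulnCA; move: (`|i1| * `|x2|)%N (`|i1| * `|x1|)%N (`|x1| * `|i2|)%N => p q r; lia.
    have h4 : (2 * (`|x1| * `|i2|) * (I * M) <= (`|i1| * `|x1| + 2 * lam) * (I * M))%N by rewrite leq_mul2r h2 orbT.
    have h5 : (`|i1| * M * (`|x1| * I) <= `|x1| * I * (`|x1| * I))%N by rewrite leq_mul2r big orbT.
    have e1 : (2 * (`|x1| * I) * (`|i2| * M) = 2 * (`|x1| * `|i2|) * (I * M))%N by lia.
    have e2 : ((`|i1| * `|x1| + 2 * lam) * (I * M) = `|i1| * M * (`|x1| * I) + 2 * (lam * (I * M)))%N by lia.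
    by rewrite e1 -mulnn; apply: leq_trans h4 _; rewrite e2 leq_add2r.
  by rewrite mx; exact: double_half_mul.
- have mx : m = (`|i1| * M)%N by rewrite m1; apply/maxn_idPl; exact: ltnW.
  have i10 : i1 != 0 by apply: contraTneq m0 => i10; rewrite mx i10.
  have [t ht] := nearest_multiple i2' i10.
  pose i2 := i2' + t * i1; pose k2 := k2' + t * k1.
  have d2 := det2 _ _ (shift t); rewrite -/i2 -/k2 in d2 ht *.
  apply: (main i2 k2 (shift t)); rewrite -/i2 -/k2.
    by rewrite mx; exact: double_half_mul.
  move: d2 ht big; rewrite mx; move: (i2 * u + _) => x2; clear -I0 M0.
  move=> d2 ht /ltnW big.
  have h1 : (`|i1| * `|x2| <= `|x1| * `|i2| + lam)%N by rewrite -!abszM; lia.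
  have h2 : (2 * (`|i1| * `|x2|) <= `|x1| * `|i1| + 2 * lam)%N.
    have h3 : (`|x1| * (2 * `|i2|) <= `|x1| * `|i1|)%N by rewrite leq_mul2l ht orbT.
    by move: h1 h3; rewrite mulnCA; move: (`|i1| * `|x2|)%N (`|x1| * `|i1|)%N (`|x1| * `|i2|)%N => p q r; lia.
  have h4 : (2 * (`|i1| * `|x2|) * (I * M) <= (`|x1| * `|i1| + 2 * lam) * (I * M))%N by rewrite leq_mul2r h2 orbT.
  have h5 : (`|x1| * I * (`|i1| * M) <= `|i1| * M * (`|i1| * M))%N by rewrite leq_mul2r big orbT.
  have e1 : (2 * (`|i1| * M) * (`|x2| * I) = 2 * (`|i1| * `|x2|) * (I * M))%N by lia.
  have e2 : ((`|x1| * `|i1| + 2 * lam) * (I * M) = `|x1| * I * (`|i1| * M) + 2 * (lam * (I * M)))%N by lia.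
  by rewrite e1 -mulnn; apply: leq_trans h4 _; rewrite e2 leq_add2r.
Qed.

(** Side lengths about IM/(2 m_i) keep combinations inside the box, and m1 m2 <= 2 lam I M makes
    their product at least IM/(8 lam). A vanishing sum forces i = 0 by [dist], then k = 0, and
    unimodularity gives l1 = l2 = 0. *)
Lemma lattice_progression (lam I M : nat) u : (0 < lam)%N -> (0 < I)%N -> (0 < M)%N ->
  (forall i : int, i != 0 -> (`|i| < I)%N -> ~~ (lam%:Z %| i * u)%Z) ->
  exists x1 x2 : int, exists L1 L2 : nat,
  [/\ (0 < L1)%N, (0 < L2)%N & (I * M <= 8 * lam * (L1 * L2))%N] /\
  (forall l1 l2 : int, (`|l1| < L1)%N -> (`|l2| < L2)%N ->
     (exists2 i : int, (`|i| < I)%N & (lam%:Z %| l1 * x1 + l2 * x2 - i * u)%Z) /\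
     [/\ (absz (l1 * x1 + l2 * x2)%R <= M)%N & l1 * x1 + l2 * x2 = 0 -> l1 = 0 /\ l2 = 0]).
Proof.
move=> lam0 I0 M0 dist.
have [i1 [k1 [i2 [k2 [m1 [m2 [[det m10 m20 mm] [h1 h2 h3 h4]]]]]]]] := reduced_lattice_basis u lam0 I0 M0.
set x1 := i1 * u + _ in h2; set x2 := i2 * u + _ in h4.
set D := (I * M)%N in mm; have D0 : (0 < D)%N by rewrite muln_gt0 I0.
(* The predecessor makes two halves add up to strictly less than [D], hence |i| < I strictly. *)
pose L1 := (D.-1 %/ (2 * m1)).+1; pose L2 := (D.-1 %/ (2 * m2)).+1.
have len m : (0 < m)%N -> (D <= 2 * m * (D.-1 %/ (2 * m)).+1)%N.
  move=> m0; have h : (0 < 2 * m)%N by rewrite muln_gt0.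
  by have := ltn_ceil D.-1 h; rewrite mulnC; case: (D) D0 => // n _ /=.
have len' m l : (0 < m)%N -> (l < (D.-1 %/ (2 * m)).+1)%N -> (2 * (l * m) <= D.-1)%N.
  by move=> m0; rewrite ltnS leq_divRL ?muln_gt0 //; move: D.-1 => n; clear; nia.
exists x1, x2, L1, L2; split.
  split=> //.
  have l1 := len _ m10; have l2 := len _ m20; rewrite -/L1 in l1; rewrite -/L2 in l2.
  have h : (D * D <= D * (8 * lam * (L1 * L2)))%N.
    apply: leq_trans (leq_mul l1 l2) _.
    have -> : (2 * m1 * L1 * (2 * m2 * L2) = 4 * (L1 * L2) * (m1 * m2))%N by clear; lia.
    apply: leq_trans (leq_mul (leqnn _) mm) _; apply: eq_leq; rewrite -/D.
    by move: (L1) (L2) (D); clear; lia.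
  by rewrite -(leq_pmul2l D0).
move=> l1 l2 hl1 hl2.
have b1 := len' _ _ m10 hl1; have b2 := len' _ _ m20 hl2.
have iI : (absz (l1 * i1 + l2 * i2)%R < I)%N.
  rewrite -(ltn_pmul2r M0) -/D.
  have := abs_comb_mul l1 i1 l2 i2 M.
  have g1 : (`|l1| * (`|i1| * M) <= `|l1| * m1)%N by rewrite leq_mul2l h1 orbT.
  have g2 : (`|l2| * (`|i2| * M) <= `|l2| * m2)%N by rewrite leq_mul2l h3 orbT.
  by move: g1 g2 b1 b2 D0; move: (`|l1| * m1)%N (`|l2| * m2)%N (`|l1| * _)%N (`|l2| * _)%N => ? ? ? ?; clear; lia.
have xM : (absz (l1 * x1 + l2 * x2)%R <= M)%N.
  rewrite -(leq_pmul2r I0) [(M * I)%N]mulnC -/D.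
  have := abs_comb_mul l1 x1 l2 x2 I.
  have g1 : (`|l1| * (`|x1| * I) <= `|l1| * m1)%N by rewrite leq_mul2l h2 orbT.
  have g2 : (`|l2| * (`|x2| * I) <= `|l2| * m2)%N by rewrite leq_mul2l h4 orbT.
  by move: g1 g2 b1 b2 D0; move: (`|l1| * m1)%N (`|l2| * m2)%N (`|l1| * _)%N (`|l2| * _)%N => ? ? ? ?; clear; lia.
have xE : l1 * x1 + l2 * x2 = (l1 * i1 + l2 * i2) * u + (l1 * k1 + l2 * k2) * lam%:Z by rewrite /x1 /x2; ring.
split.
  exists (l1 * i1 + l2 * i2) => //; rewrite xE addrC addKr; exact: dvdz_mull.
split=> // x0.
have i0 : l1 * i1 + l2 * i2 = 0.
  apply/eqP; apply: contraT => ne; have := dist _ ne iI.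
  have -> : (l1 * i1 + l2 * i2) * u = - ((l1 * k1 + l2 * k2) * lam%:Z) by apply/eqP; rewrite -addr_eq0 -xE x0.
  by rewrite -mulNr dvdz_mull.
have k0 : l1 * k1 + l2 * k2 = 0.
  move: x0; rewrite xE i0 mul0r add0r => /eqP; rewrite mulf_eq0 => /orP [/eqP //|].
  by move=> /eqP h; move: lam0; case: (lam) h.
split.
  rewrite -[l1]mulr1 -det (_ : l1 * _ = k2 * (l1 * i1 + l2 * i2) - i2 * (l1 * k1 + l2 * k2)); last by ring.
  by rewrite i0 k0 !mulr0 subrr.
rewrite -[l2]mulr1 -det (_ : l2 * _ = i1 * (l1 * k1 + l2 * k2) - k1 * (l1 * i1 + l2 * i2)); last by ring.
by rewrite i0 k0 !mulr0 subrr.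
Qed.

End ReducedBasis.

(** * A discrete Prekopa-Leindler inequality *)

Section Prekopa.

Variable R : realType.

Local Open Scope fset_scope.
Local Open Scope ring_scope.

(** The indices of the windows that the sum of the k-th and l-th windows can meet. *)
Definition near_sums (X Y : {fset int}) : {fset int} :=
  [fset (k + l)%R | k in X, l in Y] `|` [fset (k + l + 1)%R | k in X, l in Y].

Lemma near_sumsP (X Y : {fset int}) z :
  reflect (exists k l, [/\ k \in X, l \in Y & (z = k + l \/ z = k + l + 1)%R])
    (z \in near_sums X Y).
Proof.
rewrite inE; apply: (iffP orP) => [[|]|[k] [l] [kX lY [->|->]]].
- by case/imfset2P => k kX [l lY ->]; exists k, l; split=> //; left.
- by case/imfset2P => k kX [l lY ->]; exists k, l; split=> //; right.
- by left; apply/imfset2P; exists k => //; exists l.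
- by right; apply/imfset2P; exists k => //; exists l.
Qed.

Lemma fset_arg_min (X : {fset int}) (f : int -> R) : X != fset0 ->
  exists2 x, x \in X & forall y, y \in X -> f x <= f y.
Proof.
case/fset0Pn => x0 x0X.
case: (arg_minP (P := predT) (fun x : X => f (val x)) (i0 := [` x0X]) erefl).
move=> x _ xmin; exists (val x); first exact: valP.
by move=> y yX; apply: (xmin [` yX]).
Qed.

Lemma fset_arg_max (X : {fset int}) (f : int -> R) : X != fset0 ->
  exists2 x, x \in X & forall y, y \in X -> f y <= f x.
Proof.
move=> X0; have [x xX xmin] := fset_arg_min (fun x => - f x) X0.
by exists x => // y /xmin; rewrite lerN2.
Qed.

(** The shift by 1 separates [X + min Y] from [max X + Y + 1], so the bound is |X| + |Y| rather than
    |X| + |Y| - 1: the exact form of one-dimensional Brunn-Minkowski. *)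
Lemma card_near_sums (X Y : {fset int}) : X != fset0 -> Y != fset0 ->
  (#|` X| + #|` Y| <= #|` near_sums X Y|)%N.
Proof.
move=> X0 Y0.
have [k0 k0X kmax] := fset_arg_max (fun x => x%:~R) X0.
have [l0 l0Y lmin] := fset_arg_min (fun x => x%:~R) Y0.
have c1 : #|` [fset (k + l0)%R | k in X]| = #|` X|.
  by apply: card_imfset => x y /addIr.
have c2 : #|` [fset (k0 + l + 1)%R | l in Y]| = #|` Y|.
  by apply: card_imfset => x y /addIr /addrI.
rewrite -c1 -c2 -cardfsUI.
have -> : [fset (k + l0)%R | k in X] `&` [fset (k0 + l + 1)%R | l in Y] = fset0.
  apply/fsetP => z; rewrite in_fset0 inE; apply/negP => /andP[].
  case/imfsetP => k kX -> /imfsetP [l lY] e.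
  by move: (kmax _ kX) (lmin _ lY); rewrite !ler_int; move/eqP: e; lia.
rewrite cardfs0 addn0; apply: fsubset_leq_card; apply/fsubsetP => z.
rewrite inE => /orP[] /imfsetP [k kX ->]; apply/near_sumsP.
  by exists k, l0; split=> //; left.
by exists k0, k; split=> //; right.
Qed.

Lemma near_sumsS (X X' Y Y' : {fset int}) : X' `<=` X -> Y' `<=` Y ->
  near_sums X' Y' `<=` near_sums X Y.
Proof.
move=> /fsubsetP sX /fsubsetP sY; apply/fsubsetP => z /near_sumsP [k] [l] [kX lY e].
by apply/near_sumsP; exists k, l; split=> //; [exact: sX|exact: sY].
Qed.

Lemma sum_fsetS (X Y : {fset int}) (f : int -> R) : X `<=` Y ->
  (forall y, y \in Y -> 0 <= f y) ->
  \sum_(x <- X) f x <= \sum_(y <- Y) f y.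
Proof.
move=> sXY f0; rewrite [leRHS](big_fsetID _ (mem X)) /=.
have -> : [fset x in Y | x \in X] = X.
  apply/fsetP => x; rewrite !inE /= andbC; case xX: (x \in X) => //=.
  exact: (fsubsetP sXY).
rewrite lerDl big_seq; apply: sumr_ge0 => x.
by rewrite !inE /= => /andP[/f0].
Qed.

Lemma sum_fset_const (X : {fset int}) (t : R) :
  \sum_(x <- X) t = #|` X|%:R * t.
Proof. by rewrite big_const_seq count_predT iter_addr addr0 mulr_natl. Qed.

Lemma sum_fibers (U : {fset int}) (w : int -> int) (a : int -> R) :
  \sum_(x <- U) a x = \sum_(k <- [fset w x | x in U]) \sum_(x <- [fset x in U | w x == k]) a x.
Proof.
rewrite (partition_big_imfset _ w) /=.
by apply: eq_bigr => k _; rewrite big_fset_condE /= -big_fset_condE big_fset_condE.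
Qed.

Lemma sum_card_fibers (U X : {fset int}) (w : int -> int) :
  \sum_(k <- X) #|` [fset x in U | w x == k]|%:R <= #|` U|%:R :> R.
Proof.
rewrite -[leRHS]mulr1 -sum_fset_const (sum_fibers U w).
have e k : \sum_(x <- [fset x in U | w x == k]) 1 = #|` [fset x in U | w x == k]|%:R :> R.
  by rewrite sum_fset_const mulr1.
rewrite (eq_bigr _ (fun k _ => e k)) (big_fsetID _ (mem [fset w x | x in U])) /=.
rewrite [X in _ + X]big1_seq ?addr0; last first.
  move=> k /andP[_]; rewrite !inE /= => /andP[_ kU].
  suff -> : [fset x in U | w x == k] = fset0 by rewrite cardfs0.
  apply/fsetP => x; rewrite !inE /=; apply/negP => /andP[xU /eqP xk].
  by move/negP: kU; apply; apply/imfsetP; exists x.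
apply: sum_fsetS => [|k _]; last exact: ler0n.
by apply/fsubsetP => k; rewrite !inE /= => /andP[].
Qed.

(* Discrete Prékopa-Leindler inequality with min: the superlevel sets of c
   contain near_sums of those of a and b, and near_sums grows additively.
   Peeling off the lowest level makes this an induction. *)
Lemma prekopa_shifted (X Y : {fset int}) (a b c : int -> R) (t m : R) :
  (exists2 k, k \in X & a k = m) -> (exists2 l, l \in Y & b l = m) ->
  (forall k, k \in X -> t <= a k <= m) -> (forall l, l \in Y -> t <= b l <= m) ->
  (forall k l z, k \in X -> l \in Y -> (z = k + l \/ z = k + l + 1)%R ->
     Num.min (a k) (b l) <= c z) ->
  \sum_(k <- X) (a k - t) + \sum_(l <- Y) (b l - t)
    <= \sum_(z <- near_sums X Y) (c z - t).
Proof.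
have [n] := ubnP (#|` X| + #|` Y|)%N; elim: n => // n IH in X Y t *.
move=> sz [k1 k1X ak1] [l1 l1Y bl1] aX bY cXY.
have X0 : X != fset0 by apply/fset0Pn; exists k1.
have Y0 : Y != fset0 by apply/fset0Pn; exists l1.
have [ka kaX amin] := fset_arg_min a X0.
have [lb lbY bmin] := fset_arg_min b Y0.
pose s := Num.min (a ka) (b lb).
have ts : t <= s.
  by rewrite le_min; case/andP: (aX _ kaX) => -> _; case/andP: (bY _ lbY) => ->.
have as_ k : k \in X -> s <= a k by move=> kX; rewrite ge_min amin.
have bs_ k : k \in Y -> s <= b k by move=> kX; rewrite ge_min bmin ?orbT.
have cs_ z : z \in near_sums X Y -> s <= c z.
  case/near_sumsP => k [l] [kX lY e]; apply: le_trans (cXY k l z kX lY e).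
  by rewrite le_min as_ ?bs_.
have sub (S : {fset int}) (f : int -> R) :
    \sum_(k <- S) (f k - t) = \sum_(k <- S) (f k - s) + #|` S|%:R * (s - t).
  rewrite -sum_fset_const -big_split /=; apply: eq_bigr => k _.
  by rewrite addrA subrK.
rewrite !sub addrACA -mulrDl -natrD; apply: lerD; last first.
  by apply: ler_wpM2r; rewrite ?subr_ge0 // ler_nat card_near_sums.
have sm : s <= m by apply: le_trans (as_ _ k1X) _; rewrite ak1.
have [ems|nms] := eqVneq s m.
  rewrite 2?big1_seq ?addr0.
  - by rewrite big_seq; apply: sumr_ge0 => z /cs_; rewrite subr_ge0.
  - move=> l /andP[_ lY]; apply/eqP; rewrite subr_eq0 eq_le bs_ // ems.
    by case/andP: (bY _ lY) => _ ->.
  - move=> l /andP[_ lX]; apply/eqP; rewrite subr_eq0 eq_le as_ // ems.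
    by case/andP: (aX _ lX) => _ ->.
have ltsm : s < m by rewrite lt_neqAle nms.
pose X' := [fset k in X | s < a k]; pose Y' := [fset l in Y | s < b l].
have sX : X' `<=` X by apply/fsubsetP => k; rewrite !inE => /andP[].
have sY : Y' `<=` Y by apply/fsubsetP => k; rewrite !inE => /andP[].
have strip (S : {fset int}) (f : int -> R) : (forall k, k \in S -> s <= f k) ->
    \sum_(k <- S) (f k - s) = \sum_(k <- [fset k in S | s < f k]) (f k - s).
  move=> fS; rewrite (big_fsetID _ [pred k | s < f k]) /=.
  rewrite [X in _ + X]big1_seq ?addr0 // => k; rewrite !inE /= -leNgt.
  case/andP=> kS fk; apply/eqP; rewrite subr_eq0 eq_le fk fS //.
rewrite (strip X a as_) (strip Y b bs_) -/X' -/Y'.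
apply: le_trans (sum_fsetS (near_sumsS sX sY) _); last first.
  by move=> z /cs_; rewrite subr_ge0.
apply: IH.
- have cX := fsubset_leq_card sX; have cY := fsubset_leq_card sY.
  have [e|e] : s = a ka \/ s = b lb by rewrite /s; case: leP; [left|right].
  + suff : (#|` X'| < #|` X|)%N by move: sz cY; clear; lia.
    apply: fproper_ltn_card; rewrite fproperE sX; apply/negP => /fsubsetP /(_ _ kaX).
    by rewrite !inE -e ltxx andbF.
  + suff : (#|` Y'| < #|` Y|)%N by move: sz cX; clear; lia.
    apply: fproper_ltn_card; rewrite fproperE sY; apply/negP => /fsubsetP /(_ _ lbY).
    by rewrite !inE -e ltxx andbF.
- by exists k1; rewrite ?inE ?k1X ?ak1.
- by exists l1; rewrite ?inE ?l1Y ?bl1.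
- move=> k kX; rewrite as_ ?(fsubsetP sX) //=.
  by case/andP: (aX _ (fsubsetP sX _ kX)).
- move=> k kX; rewrite bs_ ?(fsubsetP sY) //=.
  by case/andP: (bY _ (fsubsetP sY _ kX)).
- by move=> k l z /(fsubsetP sX) kX /(fsubsetP sY) lY; apply: cXY.
Qed.

Lemma prekopa (X Y : {fset int}) (a b c : int -> R) (m : R) :
  (exists2 k, k \in X & a k = m) -> (exists2 l, l \in Y & b l = m) ->
  (forall k, k \in X -> 0 <= a k <= m) -> (forall l, l \in Y -> 0 <= b l <= m) ->
  (forall k l z, k \in X -> l \in Y -> (z = k + l \/ z = k + l + 1)%R ->
     Num.min (a k) (b l) <= c z) ->
  \sum_(k <- X) a k + \sum_(l <- Y) b l <= \sum_(z <- near_sums X Y) c z.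
Proof.
move=> aX bY a0 b0 cXY; have := prekopa_shifted aX bY a0 b0 cXY.
have sum0 (S : {fset int}) (f : int -> R) : \sum_(k <- S) (f k - 0) = \sum_(k <- S) f k.
  by apply: eq_bigr => k _; rewrite subr0.
by rewrite !sum0.
Qed.

End Prekopa.

(** * Residues and windows *)

Section Residues.

Lemma block_bound (b : int) (m n J l : nat) : (m < J)%N -> (n < l)%N ->
  b * l%:Z <= (b + m%:Z) * l%:Z + n%:Z < (b + J%:Z) * l%:Z.
Proof.
move=> mJ nl; have : (m.+1 * l <= J * l)%N by rewrite leq_mul2r mJ orbT.
have := leq0n (m * l); rewrite mulSn !mulrDl -!PoszM.
move: (m * l)%N (J * l)%N (b * l%:Z) => u v w; clear -nl; lia.
Qed.

Lemma block_index (b k r : int) (J l : nat) : (0 < l)%N -> 0 <= r < l%:Z ->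
  b * l%:Z <= k * l%:Z + r < (b + J%:Z) * l%:Z -> b <= k < b + J%:Z.
Proof.
move=> l0 /andP[r0 rl] /andP[h1 h2]; have l0' : 0 < l%:Z by [].
apply/andP; split.
  rewrite -ltzD1 -(ltr_pM2r l0') mulrDl mul1r.
  by apply: le_lt_trans h1 _; rewrite ltrD2l.
by rewrite -(ltr_pM2r l0'); apply: le_lt_trans h2; rewrite lerDl.
Qed.

Variable p : nat.

Let L : int := p.+2%:Z.

Lemma residE (x y : int) : (x%:~R == y%:~R :> 'Z_p.+2) = (L %| x - y)%Z.
Proof.
have nat0 (n : nat) : (n%:R == 0 :> 'Z_p.+2) = (p.+2 %| n)%N.
  by rewrite -val_eqE /= val_Zp_nat.
rewrite -subr_eq0 -intrB; case: (x - y) => n.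
  by rewrite -pmulrn nat0 dvdzE.
by rewrite NegzE intrN oppr_eq0 -pmulrn nat0 dvdzE.
Qed.

Lemma resid_val (z : 'Z_p.+2) : (val z)%:Z%:~R = z.
Proof. by rewrite -pmulrn natr_Zp. Qed.

Lemma resid_lt (z : 'Z_p.+2) : (val z)%:Z < L.
Proof. by have := ltn_ord z; rewrite /L ltz_nat. Qed.

Definition blocks (b : int) (J : nat) (S : {set 'Z_p.+2}) : {fset int} :=
  [fset ((b + (val u.1)%:Z) * L + (val u.2)%:Z)%R | u in setX [set: 'I_J] S]%fset.

Lemma blocksP b J S x :
  (x \in blocks b J S) = (b * L <= x < (b + J%:Z) * L) && (x%:~R \in S).
Proof.
apply/imfsetP/andP => [[[i z] /= ] | [/andP[x1 x2] xS]].
  rewrite in_setX in_setT /= => zS ->; split; last first.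
    by rewrite intrD intrM /L -pmulrn pchar_Zp // mulr0 add0r resid_val.
  exact: block_bound.
have Lx : 0 <= (x %% L)%Z < L by rewrite modz_ge0 ?ltz_pmod.
have := @block_index b (x %/ L)%Z (x %% L)%Z J p.+2 erefl Lx.
rewrite -divz_eq x1 x2 => /(_ erefl) /andP[k1 k2].
have i_lt : (absz ((x %/ L)%Z - b)%R < J)%N.
  by move: k1 k2; move: (x %/ L)%Z => k; clear; lia.
exists (Ordinal i_lt, x%:~R); first by rewrite in_setX in_setT.
have modE : (val (x%:~R : 'Z_p.+2))%:Z = (x %% L)%Z.
  have : ((val (x%:~R : 'Z_p.+2))%:Z == x %[mod L])%Z.
    by rewrite eqz_mod_dvd -residE resid_val.
  by move/eqP => <-; rewrite modz_small // resid_lt andbT.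
rewrite /= modE gez0_abs ?subr_ge0 // [b + _]addrC subrK.
exact: divz_eq.
Qed.

Lemma card_blocks b J S : #|` blocks b J S| = (J * #|S|)%N.
Proof.
rewrite card_imfset /=.
  by rewrite -cardE cardsX cardsT card_ord.
move=> [i z] [i' z'] /= e.
have ez : z = z'.
  rewrite -[z]resid_val -[z']resid_val; apply/eqP; rewrite residE.
  apply/dvdzP; exists ((val i')%:Z - (val i)%:Z).
  move: e; rewrite mulrBl !mulrDl -!addrA => /addrI.
  by rewrite /=; move: (_ * L) (_ * L) => u v; clear; lia.
rewrite ez in e *; congr (_, _); apply: val_inj => /=.
by move: e => /addIr /mulIf -/(_ isT) /addrI [].
Qed.

End Residues.

(** [H] consists of the multiples of some [lam] dividing L, so the points wanted are the x congruent
    to i v modulo [lam], a lattice. The index i ranges over both signs, hence the two alternatives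
    for the residue; period defects do not see the sign. *)
Lemma coset_progression p (H : {set 'Z_p.+2}) v I : (0 < I)%N -> 0 \in H ->
  {in H &, forall a b, a - b \in H} -> (forall i, (0 < i < I)%N -> v *+ i \notin H) ->
  exists x1 x2 L1 L2, [/\ (0 < L1)%N, (0 < L2)%N & (I * #|H| <= 8 * (L1 * L2))%N] /\
  forall l1 l2 : int, (absz l1 < L1)%N -> (absz l2 < L2)%N ->
    [/\ exists i h, [/\ (i < I)%N, h \in H & (l1 * x1 + l2 * x2)%:~R = v *+ i + h \/
                                        (l1 * x1 + l2 * x2)%:~R = - (v *+ i + h)],
        (absz (l1 * x1 + l2 * x2)%R <= p.+2)%N
      & l1 * x1 + l2 * x2 = 0 -> l1 = 0 /\ l2 = 0].
Proof.
move=> I0 H0 HB Hv.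
have HN a : a \in H -> - a \in H by move=> aH; rewrite -[- a]add0r HB.
have HD a b : a \in H -> b \in H -> a + b \in H.
  by move=> aH bH; rewrite -[b]opprK HB // HN.
have HM a n : a \in H -> a *+ n \in H.
  by move=> aH; elim: n => [|n IH]; rewrite ?mulr0n // mulrS HD.
have ex : exists n, (0 < n)%N && (n%:R \in H).
  by exists p.+2; rewrite /= pchar_Zp.
case: (ex_minnP ex) => lam /andP[lam0 lamH] lam_min.
have dvdH (z : int) : (lam%:Z %| z)%Z = (z%:~R \in H).
  apply/idP/idP => [/dvdzP [k ->]|zH].
    rewrite intrM -pmulrn; case: k => k.
      by rewrite -pmulrn mulr_natl HM.
    by rewrite NegzE intrN mulNr HN // -pmulrn mulr_natl HM.
  apply/dvdz_mod0P/eqP; apply: contraT => r0.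
  have rH : (absz (z %% lam)%Z)%:R \in H.
    rewrite pmulrn gez0_abs ?modz_ge0 ?gt_eqF //.
    rewrite /modz intrB HB // intrM -pmulrn; case: (z %/ lam)%Z => k.
      by rewrite -pmulrn mulr_natl HM.
    by rewrite NegzE intrN mulNr HN // -pmulrn mulr_natl HM.
  have := lam_min (absz (z %% lam)%Z); rewrite rH absz_gt0 r0 => /(_ erefl).
  have := ltz_pmod z (lam0 : 0 < lam%:Z).
  have : 0 <= (z %% lam)%Z by rewrite modz_ge0 ?gt_eqF.
  move: (z %% lam)%Z => r; move: lam0; clear; lia.
have lamL : (lam %| p.+2)%N.
  by have := dvdH p.+2; rewrite -pmulrn pchar_Zp // H0 dvdzE => ->.
have cardH : (#|H| * lam <= p.+2)%N.
  rewrite -[leqRHS](divnK lamL) leq_mul2r; apply/orP; right.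
  rewrite -[leqRHS]card_ord -cardsT.
  apply: leq_trans (leq_imset_card (fun j : 'I__ => (j * lam)%:R : 'Z_p.+2) _).
  apply: subset_leq_card; apply/subsetP => h hH; apply/imsetP.
  have := dvdH (val h)%:Z; rewrite resid_val hH dvdzE /= => /dvdnP [k ek].
  have kl : (k < p.+2 %/ lam)%N.
    by rewrite ltn_divRL // -ek; exact: ltn_ord.
  by exists (Ordinal kl); rewrite ?inE //= -ek natr_Zp.
have [i i0 iI|x1 [x2] [L1] [L2] [[L10 L20 size]] prop] :=
  @lattice_progression lam I p.+2 (val v)%:Z lam0 I0 isT.
  rewrite dvdH intrM resid_val.
  have ai : (0 < absz i < I)%N by rewrite absz_gt0 i0; move: iI; clear; lia.
  case: i ai {i0 iI} => i ai.
    by rewrite -pmulrn mulr_natl Hv.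
  rewrite NegzE intrN mulNr -pmulrn mulr_natl; apply: contraNN (Hv _ ai) => /HN.
  by rewrite opprK.
exists x1, x2, L1, L2; split.
  split=> //; rewrite -(leq_pmul2l lam0); apply: leq_trans (_ : I * p.+2 <= _)%N.
    by rewrite mulnCA leq_mul2l mulnC cardH orbT.
  by rewrite mulnCA mulnA.
move=> l1 l2 l1L l2L; have [[i iI dH] [q1 q2]] := prop l1 l2 l1L l2L.
split=> //; move: dH; rewrite dvdH intrB intrM resid_val.
move: (_%:~R) => y; case: i iI => i iI.
  rewrite -pmulrn mulr_natl => yH; exists i, (y - v *+ i); split=> //.
  by left; rewrite addrC subrK.
rewrite NegzE intrN mulNr opprK -pmulrn mulr_natl => yH.
exists i.+1, (- (y + v *+ i.+1)); split=> //; first exact: HN.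
by right; rewrite opprD opprK [y + _]addrC addKr.
Qed.

(** * Dense progressions from almost periods *)

Section DenseProgressions.

Variable R : realType.

Implicit Types (a : int -> R) (P Q : {fset int}).

(** Both alternatives for a weight in place of a set, with an absolute size bound [s]; in this form
    they survive averaging and affine maps. *)
Definition dense_on a (s eps : R) : Prop :=
  (exists P, [/\ is_progression 1 P, s <= #|` P|%:R
    & (1 / 2 - eps) * #|` P|%:R <= \sum_(x <- P) a x]) \/
  (exists Q, [/\ is_proper_progression 2 Q, s <= #|` Q|%:R
    & (1 - eps) * #|` Q|%:R <= \sum_(x <- Q) a x]).

Lemma sum_fset_shift (S : {fset int}) (f : int -> R) (q : int) :
  \sum_(x <- S) f (x + q) = \sum_(y <- [fset (x + q)%R | x in S]%fset) f y.
Proof. by rewrite big_imfset //= => x y _ _ /addIr. Qed.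

Lemma sum_fset_leD (X Y : {fset int}) (f : int -> R) (q : int) :
  (forall x, 0 <= f x <= 1) ->
  \sum_(x <- X) f (x + q) <= \sum_(x <- Y) f x + #|` [fset x in X | (x + q)%R \notin Y]%fset|%:R.
Proof.
move=> f01; rewrite (big_fsetID _ [pred x | x + q \in Y]) /=; apply: lerD.
  rewrite sum_fset_shift.
  apply: sum_fsetS => [|y _]; last by case/andP: (f01 y).
  by apply/fsubsetP => y /imfsetP [x]; rewrite !inE /= => /andP[_ xY] ->.
apply: le_trans (_ : \sum_(x <- [fset x in X | (x + q)%R \notin Y]%fset) 1 <= _); last first.
  by rewrite sum_fset_const mulr1.
by apply: ler_sum => x _; case/andP: (f01 (x + q)).
Qed.

Lemma period_defectE p (E : {set 'Z_p.+2}) s :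
  period_defect E s = #|[set r in E | r + s \notin E]|.
Proof.
rewrite /period_defect -(card_sadd1 s [set r in E | _]); apply: eq_card => y.
by rewrite in_setD !sadd1P inE subrK andbC.
Qed.

Lemma blocks_shift_le p (b : int) (J : nat) (E : {set 'Z_p.+2}) (f : int -> R) (q : int) :
  (0 < J)%N -> (absz q <= p.+2)%N -> (forall x, 0 <= f x <= 1) ->
  \sum_(x <- blocks b J E) f (x + q)
    <= \sum_(x <- blocks b J E) f x + (#|E| + J * period_defect E q%:~R)%:R.
Proof.
move=> J0 qL f01; apply: le_trans (sum_fset_leD _ (blocks b J E) q f01) _.
rewrite lerD2l ler_nat period_defectE -(card_blocks b J) -[X in (_ <= X + _)%N]mul1n.
(* A shift by at most one period can push out only the last or the first period, according to its
   sign. *)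
pose b' := if 0 <= q then b + J.-1%:Z else b.
rewrite -(card_blocks b' 1).
apply: (@leq_trans #|` (blocks b' 1 E `|` blocks b J [set r in E | (r + q%:~R)%R \notin E])%fset|).
  apply: fsubset_leq_card; apply/fsubsetP => x; rewrite !inE !blocksP !inE intrD.
  case/andP => /andP[xb xE]; rewrite xE xb /= andbT.
  case: (_ + _ \in E); rewrite ?orbT // andbT orbF.
  rewrite negb_and -!leNgt -!ltNge => xq; move: xb xq qL J0; rewrite /b'.
  case: (J) => [//|j] /=; rewrite [j.+1%:Z]intS.
  move: (p.+2) => l; case: ifP => q0; rewrite !mulrDl !mul1r.
    by move: (b * _) (j%:Z * _) q0 => u v; clear; lia.
  by move: (b * _) (j%:Z * _) q0 => u v; clear; lia.
by rewrite cardfsU leq_subr.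
Qed.

(** Averaging [1 - a] over base points in the blocks: a shift by [q t] costs [eta] through the
    residues and 1/J at the ends, so some base point does no worse than the mean. *)
Lemma almost_period_density p (b : int) (J : nat) (E : {set 'Z_p.+2}) a
    (T : finType) (q : T -> int) (kap eta : R) :
  (0 < J)%N -> E != set0 -> (forall x, 0 <= a x <= 1) ->
  (forall t, (absz (q t) <= p.+2)%N) ->
  (forall t, (period_defect E (q t)%:~R)%:R <= eta * #|E|%:R) ->
  (1 - kap) * (J * #|E|)%:R <= \sum_(x <- blocks b J E) a x ->
  exists x, (1 - (kap + eta + J%:R^-1)) * #|T|%:R <= \sum_t a (x + q t).
Proof.
move=> J0 E0 a01 qL qE sumE; have JR : 0 < J%:R :> R by rewrite ltr0n.
have [T0|/eqP T0] := eqVneq #|T| 0%N.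
  by exists 0; rewrite T0 mulr0 sumr_ge0 // => t _; case/andP: (a01 (0 + q t)).
pose f x := 1 - a x; have f01 x : 0 <= f x <= 1.
  by move: (a01 x); rewrite /f => /andP[? ?]; rewrite subr_ge0 lerBlDr lerDl; apply/andP.
set e := kap + eta + _; set X := blocks b J E.
have cX : #|` X| = (J * #|E|)%N by rewrite card_blocks.
have X0 : X != fset0 by rewrite -cardfs_gt0 cX muln_gt0 J0 card_gt0.
have [x xX xmin] := fset_arg_min (fun x => \sum_t f (x + q t)) X0.
exists x; rewrite mulrBl mul1r lerBlDr -lerBlDl.
have -> : #|T|%:R - \sum_t a (x + q t) = \sum_t f (x + q t).
  by rewrite /f big_split /= sumr_const sumrN.
have cX0 : 0 < #|` X|%:R :> R by rewrite ltr0n cardfs_gt0.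
rewrite -(ler_pM2l cX0) -sum_fset_const.
apply: le_trans (_ : \sum_(y <- X) \sum_t f (y + q t) <= _).
  by rewrite big_seq [leRHS]big_seq; apply: ler_sum => y yX; exact: xmin.
rewrite exchange_big /= mulrA [_ * #|T|%:R]mulrC mulr_natl -sumr_const.
apply: ler_sum => t _; apply: le_trans (blocks_shift_le b E J0 (qL t) f01) _.
have -> : \sum_(y <- X) f y = #|` X|%:R - \sum_(y <- X) a y.
  by rewrite /f big_split /= sumrN sum_fset_const mulr1.
rewrite cX natrD !natrM /e; move: sumE; rewrite natrM; move: (qE t).
move: (\sum_(_ <- _) _) => s; move: (_%:R) (#|E|%:R) => d n.
move=> hd hs; have -> : J%:R * n * (kap + eta + J%:R^-1) = J%:R * n * kap + J%:R * (eta * n) + n.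
  by move: (J%:R) JR => j /lt0r_neq0 j0; field.
have h2 : J%:R * d <= J%:R * (eta * n) by rewrite ler_pM2l.
by move: hs h2; rewrite mulrBl mul1r [kap * _]mulrC; clear; lra.
Qed.

Lemma dense_on_blocks p (b : int) (J : nat) a (s eps : R) : (0 < J)%N ->
  s <= (J * p.+2)%:R ->
  (1 / 2 - eps) * (J * p.+2)%:R <= \sum_(x <- blocks b J [set: 'Z_p.+2]) a x ->
  dense_on a s eps.
Proof.
move=> J0 hs ha; left; exists (blocks b J [set: 'Z_p.+2]).
rewrite card_blocks cardsT card_ord; split=> //.
exists (b * p.+2%:Z - 1), (fun=> 1), (fun=> (J * p.+2)%N); split=> [_|x].
  by rewrite muln_gt0 J0.
rewrite blocksP inE andbT mulrDl; split=> [x_in|[l l_in ->]].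
  exists (fun=> x - b * p.+2%:Z + 1) => [_|].
    by rewrite PoszM; move: x_in; move: (b * _) (J%:Z * _) => u v; clear; lia.
  by rewrite big_ord1 mulr1; move: (b * _) => u; clear; lia.
rewrite big_ord1 mulr1; move: (l_in ord0); rewrite PoszM.
by move: (l ord0) (b * _) (J%:Z * _) => u v w; clear; lia.
Qed.

Lemma dense_on_grid a (s eps : R) (x x1 x2 : int) (L1 L2 : nat) :
  (0 < L1)%N -> (0 < L2)%N -> s <= (L1 * L2)%:R ->
  (forall l1 l2 : int, (absz l1 < L1)%N -> (absz l2 < L2)%N ->
     l1 * x1 + l2 * x2 = 0 -> l1 = 0 /\ l2 = 0) ->
  (1 - eps) * (L1 * L2)%:R <=
    \sum_(u : 'I_L1 * 'I_L2) a (x + ((val u.1)%:Z * x1 + (val u.2)%:Z * x2)) ->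
  dense_on a s eps.
Proof.
move=> L10 L20 hs inj ha; right.
pose g (u : 'I_L1 * 'I_L2) := x + ((val u.1)%:Z * x1 + (val u.2)%:Z * x2).
have g_inj : injective g.
  move=> [i j] [i' j'] /addrI /eqP; rewrite -subr_eq0 /= => /eqP e.
  have [|||/eqP e1 /eqP] := inj ((val i)%:Z - (val i')%:Z) ((val j)%:Z - (val j')%:Z).
  - by have := ltn_ord i; have := ltn_ord i'; move=> /=; clear; lia.
  - by have := ltn_ord j; have := ltn_ord j'; move=> /=; clear; lia.
  - by rewrite -[RHS]e !mulrBl opprD addrACA.
  by move: e1; rewrite !subr_eq0 => /eqP [/val_inj ->] /eqP [/val_inj ->].
have cQ : #|` [fset g u | u in [set: 'I_L1 * 'I_L2]]%fset| = (L1 * L2)%N.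
  by rewrite card_imfset //= -cardE cardsT card_prod !card_ord.
exists [fset g u | u in [set: 'I_L1 * 'I_L2]]%fset; rewrite cQ; split=> //; last first.
  rewrite big_imfset /=; last by move=> ? ? _ _; apply: g_inj.
  by rewrite big_enum /=; under eq_bigl do rewrite inE.
(* Coordinates of a progression start at 1, so the base point is moved back by one step in each
   direction. *)
exists (x - x1 - x2), (fun i => if i == 0 then x1 else x2), (fun i => if i == 0 then L1 else L2).
split; last by rewrite cQ 2!big_ord_recl big_ord0 muln1.
split=> [i|y]; first by case: ifP.
split=> [/imfsetP [[i j] _ ->]|[l l_in ->]].
  exists (fun k => if k == 0 then (val i)%:Z + 1 else (val j)%:Z + 1) => [k|].
    have := ltn_ord i; have := ltn_ord j; move=> /=.
    by case: ifP => _; move: (nat_of_ord _) (nat_of_ord _) => u v; clear; lia.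
  by rewrite 2!big_ord_recl big_ord0 /g /=; ring.
have := l_in 0; have := l_in (lift ord0 0) => /=; set l1 := l 0; set l2 := l _.
move=> h2 h1.
have i1 : (absz (l1 - 1) < L1)%N by move: h1; clear; lia.
have i2 : (absz (l2 - 1) < L2)%N by move: h2; clear; lia.
apply/imfsetP; exists (Ordinal i1, Ordinal i2); first by rewrite inE.
rewrite 2!big_ord_recl big_ord0 /g /= -/l1 -/l2 !gez0_abs.
- by ring.
- by move: h2; clear; lia.
- by move: h1; clear; lia.
Qed.

End DenseProgressions.

(** * Windows, residues and chains on the integers *)

Section Windows.

Variable p : nat.

Implicit Types (U C X : {fset int}) (J : nat).

Definition resids C : {set 'Z_p.+2} := [set (val c)%:~R | c : C].

Lemma residsP C r : reflect (exists2 c, c \in C & c%:~R = r) (r \in resids C).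
Proof.
apply: (iffP imsetP) => [[c _ ->]|[c cC <-]]; first by exists (val c); rewrite ?(valP c).
by exists [` cC]%fset.
Qed.

Definition window J U (k : int) : {fset int} :=
  [fset x in U | (x %/ (J * p.+2)%:Z)%Z == k]%fset.

Lemma in_window J U k x : (0 < J)%N ->
  (x \in window J U k) = (x \in U) && (k * J%:Z * p.+2%:Z <= x < (k * J%:Z + J%:Z) * p.+2%:Z).
Proof.
move=> J0; rewrite !inE /=; congr (_ && _).
have M0 : 0 < (J * p.+2)%:Z by rewrite ltz_nat muln_gt0 J0.
have -> : k * J%:Z * p.+2%:Z = k * (J * p.+2)%:Z by rewrite PoszM mulrA.
have -> : (k * J%:Z + J%:Z) * p.+2%:Z = (k + 1) * (J * p.+2)%:Z.
  by rewrite PoszM !mulrDl mul1r mulrA.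
by rewrite -lez_divRL // -ltz_divLR // ltzD1 -eq_le eq_sym.
Qed.

Lemma card_window_le J U k : (0 < J)%N ->
  (#|` window J U k| <= J * #|resids (window J U k)|)%N.
Proof.
move=> J0; rewrite -(card_blocks (k * J%:Z)); apply: fsubset_leq_card.
apply/fsubsetP => x xU; rewrite blocksP.
have := xU; rewrite in_window // => /andP[_ ->] /=.
by apply/residsP; exists x.
Qed.

Lemma sum_windows (R : realType) J U (a : int -> R) :
  \sum_(x <- U) a x = \sum_(k <- [fset (x %/ (J * p.+2)%:Z)%Z | x in U]%fset) \sum_(x <- window J U k) a x.
Proof. exact: sum_fibers. Qed.

Lemma sum_card_windows (R : realType) J U X :
  \sum_(k <- X) #|` window J U k|%:R <= #|` U|%:R :> R.
Proof. exact: sum_card_fibers. Qed.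

Definition chain (r : nat) C (U : nat -> {fset int}) : Prop :=
  forall j x c, (j < r)%N -> x \in U j -> c \in C -> x + c \in U j.+1.

Lemma chain_step r C (U : nat -> {fset int}) (n : nat) x c : chain r C U -> (n <= r)%N -> x \in U 0%N ->
  c \in C -> x + c * n%:Z \in U n.
Proof.
move=> hU; elim: n => [_ xU _|n IH nr xU cC]; first by rewrite mulr0 addr0.
by rewrite [n.+1%:Z]intS mulrDr mulr1 [c + _]addrC addrA; apply: hU => //; apply: IH => //; apply: ltnW.
Qed.

Lemma chain_le r C (U : nat -> {fset int}) i j x : chain r C U -> 0 \in C -> (i <= j <= r)%N -> x \in U i -> x \in U j.
Proof.
move=> hU C0 /andP[ij jr] xi; elim: j ij jr => [|j IH].
  by rewrite leqn0 => /eqP <-.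
rewrite leq_eqVlt => /orP[/eqP <- //|ij] jr.
by rewrite -[x]addr0; apply: hU => //; apply: IH => //; apply: ltnW.
Qed.

Lemma chain_shift J C (U : nat -> {fset int}) x c (t : int) : chain J.+2 C U -> 0 \in C ->
  p.+2%:Z \in C -> - p.+2%:Z \in C -> x \in U 0%N -> c \in C -> (absz t <= J.+1)%N ->
  x + c + t * p.+2%:Z \in U J.+2.
Proof.
move=> hU C0 CL CNL xU cC tJ; rewrite addrAC; apply: (hU) => //.
apply: (chain_le (i := absz t) hU C0); first by rewrite tJ leqnSn.
have tr : (absz t <= J.+2)%N by apply: leqW.
case: t tJ tr => n _ nr; first by rewrite mulrC; apply: chain_step nr xU CL.
have := chain_step hU nr xU CNL.
by rewrite NegzE mulNr mulrC mulNr.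
Qed.

Lemma split_shift J (t : int) : (absz t <= J.+1 + J.+1)%N ->
  exists t1 t2, [/\ t = t1 + t2, (absz t1 <= J.+1)%N & (absz t2 <= J.+1)%N].
Proof.
case: (leP t J.+1%:Z) => tJ; last by exists J.+1%:Z, (t - J.+1%:Z); split; lia.
by case: (leP (- J.+1%:Z) t) => tJ'; [exists t, 0|exists (- J.+1%:Z), (t + J.+1%:Z)]; split; lia.
Qed.

(** The target and x + y are less than 2J periods apart and c + c' adds at most two; each of the two
    chains absorbs half of the shift. *)
Lemma shift_bound (x y w c c' k l z t : int) (n J : nat) :
  w - (x + (c + c') + y) = t * n.+1%:Z ->
  k * J%:Z * n.+1%:Z <= x < (k * J%:Z + J%:Z) * n.+1%:Z ->
  l * J%:Z * n.+1%:Z <= y < (l * J%:Z + J%:Z) * n.+1%:Z ->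
  z * J%:Z * n.+1%:Z <= w < (z * J%:Z + J%:Z) * n.+1%:Z ->
  `|c| <= n.+1%:Z -> `|c'| <= n.+1%:Z -> z = k + l \/ z = k + l + 1 ->
  (absz t <= J.+1 + J.+1)%N.
Proof.
move=> et hx hy hz hc hc' kl; set m := n.+1%:Z.
have m0 : 0 < m by [].
have [up lo] : t * m < (J%:Z + J%:Z + 2) * m /\ (- (J%:Z + J%:Z + 2)) * m < t * m.
  rewrite -et; move: hx hy hz hc hc'; rewrite -/m.
  have e2 : (J%:Z + J%:Z + 2) * m = J%:Z * m + J%:Z * m + (m + m).
    by ring.
  case: kl => ->; rewrite mulNr e2 !mulrDl ?mul1r;
    move: (k * _ * _) (l * _ * _) (J%:Z * m) => ? ? ?; clear -m0; lia.
by move: up lo; rewrite !ltr_pM2r //; clear; lia.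
Qed.

(* A residue in E + 2C + F lifts to a sum x + y + c + c' lying within two
   windows of the target, and the chains absorb the remaining shift by a
   multiple of p.+2. *)
Lemma window_sumset J C (U V : nat -> {fset int}) k l z : (0 < J)%N -> chain J.+2 C U -> chain J.+2 C V ->
  0 \in C -> p.+2%:Z \in C -> {in C, forall c, - c \in C} ->
  (forall c, c \in C -> `|c| <= p.+2%:Z) ->
  z = k + l \/ z = k + l + 1 ->
  (J * #|sadd (sadd (resids (window J (U 0%N) k)) (sadd (resids C) (resids C)))
           (resids (window J (V 0%N) l))|
    <= #|` window J (sumset (U J.+2) (V J.+2)) z|)%N.
Proof.
move=> J0 hU hV C0 CL CN Cmax kl; rewrite -(card_blocks (z * J%:Z)).
apply: fsubset_leq_card; apply/fsubsetP => w; rewrite blocksP in_window //.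
case/andP => wz; rewrite wz andbT.
case/saddP => e1 [e2 [/saddP [e3 [e4 [/residsP [x xW <-] he4 ->]]] /residsP [y yW <-]]].
case/saddP: he4 => e5 [e6 [/residsP [c cC <-] /residsP [c' c'C <-] ->]].
rewrite -!intrD => /eqP; rewrite residE => /dvdzP [t et].
have := xW; have := yW; rewrite !in_window // => /andP[yV y_in] /andP[xU x_in].
have tJ : (absz t <= J.+1 + J.+1)%N.
  exact: shift_bound et x_in y_in wz (Cmax _ cC) (Cmax _ c'C) kl.
have [t1 [t2 [et12 t1J t2J]]] := split_shift tJ.
have h1 := chain_shift hU C0 CL (CN _ CL) xU cC t1J.
have h2 := chain_shift hV C0 CL (CN _ CL) yV c'C t2J.
apply/imfset2P; exists (x + c + t1 * p.+2%:Z) => //.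
exists (y + c' + t2 * p.+2%:Z) => //.
apply/eqP; rewrite -subr_eq0; apply/eqP.
have -> : w = t * p.+2%:Z + (x + (c + c') + y) by rewrite -et subrK.
by rewrite et12; ring.
Qed.

End Windows.

(** * Near equality for the window masses *)

Section Core.

Variable R : realType.

(** Here the 4 arises: (mu + mu')^2 >= 4 mu mu' always holds. With k = 1 the conclusion says that
    the two maxima are comparable; with k = 1 + d1 it is contradictory. *)
Lemma weight_balance (mu mu' u v s k d : R) : 0 < mu -> 0 < mu' -> 0 < s -> s <= u -> s <= v ->
  0 <= k -> k * (mu + mu') * (u / mu + v / mu') <= d * s -> k * (mu + mu') ^+ 2 <= d * (mu * mu').
Proof.
move=> m0 m0' s0 su sv k0 h.
have mm0 : 0 < mu * mu' by rewrite mulr_gt0.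
have e : u / mu + v / mu' = (u * mu' + v * mu) / (mu * mu').
  by field; rewrite !gt_eqF.
have h1 : s * (mu + mu') / (mu * mu') <= u / mu + v / mu'.
  rewrite e ler_pM2r ?invr_gt0 // mulrDr addrC; apply: lerD.
    by rewrite ler_pM2r.
  by rewrite ler_pM2r.
have h2 : k * (mu + mu') * (s * (mu + mu') / (mu * mu')) <= d * s.
  by apply: le_trans h; apply: ler_wpM2l => //; rewrite mulr_ge0 // addr_ge0 ?ltW.
rewrite mulrA ler_pdivrMr // in h2.
rewrite -(ler_pM2r s0); apply: le_trans (_ : k * (mu + mu') * (s * (mu + mu')) <= _).
  by rewrite le_eqVlt; apply/orP; left; apply/eqP; ring.
by apply: le_trans h2 _; rewrite le_eqVlt; apply/orP; left; apply/eqP; ring.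
Qed.

Lemma weight_ratio (mu mu' d : R) : 0 < mu -> 0 < mu' -> d <= 1 / 2 ->
  (mu + mu') ^+ 2 <= (4 + d) * (mu * mu') -> mu <= 2 * mu'.
Proof.
move=> m0 m0' d2 h; rewrite leNgt; apply/negP => lt.
have h1 : 0 < (mu - 2 * mu') * (2 * mu - mu').
  by apply: mulr_gt0; move: lt m0 m0'; clear; lra.
have h2 : d * (mu * mu') <= 1 / 2 * (mu * mu').
  by apply: ler_wpM2r => //; rewrite mulr_ge0 // ltW.
by move: h h1 h2; clear; nra.
Qed.

Lemma weight_gap (mu mu' d d1 : R) : 0 < mu -> 0 < mu' -> 0 < d1 -> d < 4 * d1 ->
  ~ (1 + d1) * (mu + mu') ^+ 2 <= (4 + d) * (mu * mu').
Proof.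
move=> m0 m0' d10 dd1; have h1 := sqr_ge0 (mu - mu').
have h2 : d * (mu * mu') < 4 * d1 * (mu * mu') by rewrite ltr_pM2r // mulr_gt0.
have h3 := mulr_ge0 (ltW d10) h1; apply/negP; rewrite -ltNge.
by move: h1 h2 h3; clear; nra.
Qed.

(** To be read with everything scaled by J: [P] and [Q] bound the masses from below, [X] and [Y] are
    |E| and |F|, [Z] is |E + 2C + F| and [W] is L. As Z < W, the lower bound on [Z] is not
    truncated, so [X] and [Y] are squeezed against [P] and [Q]. *)
Lemma light_pair_scaled (eps d1 P Q X Y Z W : R) : 0 < eps -> eps <= 1 / 4 ->
  0 < d1 -> d1 <= eps / 12 -> 0 <= P -> P <= 2 * Q -> Q <= 2 * P -> P <= X -> Q <= Y ->
  0 <= Z -> 0 < W -> Z < (1 + d1) * (P + Q) -> P + Q <= (1 - 2 * eps) * W ->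
  W <= Z \/ X + Y <= Z ->
  [/\ X + Y <= (1 - eps) * W, Z <= (1 + d1) * (X + Y), X <= 4 * Y, Y <= 4 * X
    & (1 - 3 * d1) * X <= P] /\ 0 < P /\ 0 < Q.
Proof.
move=> e0 e4 d0 de P0 PQ QP PX QY Z0 W0 hZ hW.
have d48 : d1 <= 1 / 48 by move: de e4; clear; lra.
have hdP : d1 * P <= 1 / 48 * P by apply: ler_wpM2r.
have Q0 : 0 <= Q by move: QP PQ P0; clear; lra.
have hdQ : d1 * Q <= d1 * (2 * P) by rewrite ler_pM2l.
have dP0 : 0 <= d1 * P by rewrite mulr_ge0 // ltW.
have Pp : 0 < P.
  rewrite lt_def P0 andbT; apply: contraTneq hZ => e; rewrite -leNgt.
  have -> : Q = 0 by move: QP Q0; rewrite e; clear; lra.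
  by rewrite e addr0 mulr0.
have hZW : Z < (1 - eps) * W.
  apply: lt_le_trans hZ _; apply: le_trans (_ : (1 + eps) * ((1 - 2 * eps) * W) <= _).
    apply: ler_pM => //; move: Q0 P0 d0 de e0; clear; lra.
  have -> : (1 + eps) * ((1 - 2 * eps) * W) = (1 - eps) * W - 2 * eps ^+ 2 * W by ring.
  by rewrite gerBl mulr_ge0 ?mulr_ge0 ?sqr_ge0 // ltW.
have eW : 0 < eps * W by rewrite mulr_gt0.
case=> hXY; first by move: hZW eW hXY; clear; lra.
split; last by split=> //; move: Pp PQ; clear; lra.
have hX : X <= P + 3 * (d1 * P) by move: hXY hZ QY hdQ; clear; lra.
have hY : Y <= Q + 3 * (d1 * P) by move: hXY hZ PX hdQ; clear; lra.
split.
- by move: hXY hZW; clear; lra.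
- apply: le_trans (ltW hZ) _; apply: ler_wpM2l; first by move: d0; clear; lra.
  exact: lerD.
- by move: hX hdP PQ QY; clear -P0 Q0; lra.
- by move: hY hdP QP PX; clear -P0 Q0; lra.
have : d1 * X <= d1 * (P + 3 * (d1 * P)) by rewrite ler_pM2l.
have : 0 <= d1 * (d1 * P) by rewrite mulr_ge0 // ltW.
have : d1 * P <= d1 * X by rewrite ler_pM2l.
by move: hX; clear; lra.
Qed.

Variable p : nat.
Variables (J : nat) (U0 V0 D : {fset int}) (a b : int -> R).
Hypothesis J0 : (0 < J)%N.
Hypothesis a01 : forall x, 0 <= a x <= 1.
Hypothesis b01 : forall x, 0 <= b x <= 1.

Let w x := (x %/ (J * p.+2)%:Z)%Z.
Let al k := \sum_(x <- window p J U0 k) a x.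
Let be l := \sum_(x <- window p J V0 l) b x.
Let g z : R := #|` window p J D z|%:R.
Let X := [fset w x | x in U0]%fset.
Let Y := [fset w x | x in V0]%fset.

Lemma heavy_window (S : {fset int}) (f : int -> R) : (forall x, 0 <= f x <= 1) ->
  0 < \sum_(x <- S) f x ->
  exists2 k, k \in [fset w x | x in S]%fset & 0 < \sum_(x <- window p J S k) f x /\
   (forall k', k' \in [fset w x | x in S]%fset ->
      0 <= \sum_(x <- window p J S k') f x <= \sum_(x <- window p J S k) f x).
Proof.
move=> f01; rewrite (sum_windows p J) -/w => f0.
have S0 : [fset w x | x in S]%fset != fset0.
  by apply: contraTneq f0 => ->; rewrite big_seq_fset0 ltxx.
have pos k' : 0 <= \sum_(x <- window p J S k') f x.
  by apply: sumr_ge0 => x _; case/andP: (f01 x).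
have [k kS kmax] := fset_arg_max (fun k => \sum_(x <- window p J S k) f x) S0.
exists k => //; split=> [|k' k'S]; last by rewrite pos kmax.
rewrite lt_def pos andbT; apply: contraTneq f0 => e.
rewrite big1_seq ?ltxx // => k' /andP[_ /kmax]; rewrite e => h.
by apply/eqP; rewrite eq_le h pos.
Qed.

(** Dividing by the maxima gives both mass functions the same top level 1, as [prekopa] requires. *)
Lemma prekopa_windows (k1 l1 : int) (kap : R) : 0 < kap ->
  k1 \in X -> 0 < al k1 -> (forall k, k \in X -> 0 <= al k <= al k1) ->
  l1 \in Y -> 0 < be l1 -> (forall l, l \in Y -> 0 <= be l <= be l1) ->
  (forall k l z, k \in X -> l \in Y -> z = k + l \/ z = k + l + 1 ->
     kap * (al k1 + be l1) * Num.min (al k / al k1) (be l / be l1) <= g z) ->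
  kap * (al k1 + be l1) * ((\sum_(x <- U0) a x) / al k1 + (\sum_(x <- V0) b x) / be l1) <= #|` D|%:R.
Proof.
move=> kap0 k1X m0 kmax l1Y m0' lmax hg.
have th0 : 0 < kap * (al k1 + be l1) by rewrite mulr_gt0 // addr_gt0.
rewrite (sum_windows p J U0) (sum_windows p J V0) -/w -/X -/Y.
rewrite !mulr_suml.
apply: le_trans (sum_card_windows p R J D (near_sums X Y)).
rewrite mulrC -ler_pdivlMr // mulr_suml.
apply: (@prekopa R X Y (fun k => al k / al k1) (fun l => be l / be l1) _ 1).
- by exists k1; rewrite // divff ?gt_eqF.
- by exists l1; rewrite // divff ?gt_eqF.
- by move=> k /kmax /andP[h1 h2]; rewrite divr_ge0 ?ler_pdivrMr ?mul1r //= ltW.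
- by move=> l /lmax /andP[h1 h2]; rewrite divr_ge0 ?ler_pdivrMr ?mul1r //= ltW.
by move=> k l z kX lY kl; rewrite ler_pdivlMr // mulrC; apply: hg kl.
Qed.

(** If every pair of windows exceeded the bound by the factor 1 + d1, the inequality with that
    factor would contradict [weight_gap]. *)
Lemma light_pair (k1 l1 : int) (s d d1 : R) : 0 < d1 -> d <= 1 / 2 -> d < 4 * d1 -> 0 < s ->
  s <= \sum_(x <- U0) a x -> s <= \sum_(x <- V0) b x -> #|` D|%:R <= (4 + d) * s ->
  k1 \in X -> 0 < al k1 -> (forall k, k \in X -> 0 <= al k <= al k1) ->
  l1 \in Y -> 0 < be l1 -> (forall l, l \in Y -> 0 <= be l <= be l1) ->
  (forall k l z, k \in X -> l \in Y -> z = k + l \/ z = k + l + 1 ->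
     (al k1 + be l1) * Num.min (al k / al k1) (be l / be l1) <= g z) ->
  [/\ al k1 <= 2 * be l1, be l1 <= 2 * al k1 &
   exists k l z, [/\ k \in X, l \in Y, z = k + l \/ z = k + l + 1 &
     g z < (1 + d1) * (al k1 + be l1) * Num.min (al k / al k1) (be l / be l1)]].
Proof.
move=> d10 d2 dd1 s0 sU sV sD k1X m0 kmax l1Y m0' lmax hg.
have balance kap : 0 < kap -> (forall k l z, k \in X -> l \in Y -> z = k + l \/ z = k + l + 1 ->
     kap * (al k1 + be l1) * Num.min (al k / al k1) (be l / be l1) <= g z) ->
    kap * (al k1 + be l1) ^+ 2 <= (4 + d) * (al k1 * be l1).
  move=> kap0 hk; apply: (weight_balance m0 m0' s0 sU sV (ltW kap0)).
  by apply: (le_trans _ sD); exact: (prekopa_windows kap0 k1X m0 kmax l1Y m0' lmax hk).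
have h1 : (al k1 + be l1) ^+ 2 <= (4 + d) * (al k1 * be l1).
  by rewrite -[leLHS]mul1r; apply: balance => // k l z kX lY kl; rewrite mul1r; apply: hg kl.
split; first exact: weight_ratio h1.
  by apply: (@weight_ratio _ _ d) => //; rewrite addrC [be _ * _]mulrC.
apply: boolp.contrapT => no.
apply: (weight_gap m0 m0' d10 dd1).
apply: balance => [|k l z kX lY kl]; first by rewrite addr_gt0.
by rewrite leNgt; apply/negP => lt; apply: no; exists k, l, z; split.
Qed.

End Core.

(** * A critical pair of windows and its progression *)

Section CoreWindows.

Variable R : realType.

Definition sub_unit (a : int -> R) := forall x, 0 <= a x <= 1.

(* The data that the smooth model leaves on the integers once the set of almost
   periods C has been made coprime. *)
Definition window_data (p J : nat) (C : {fset int}) (U V : nat -> {fset int}) : Prop :=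
  [/\ (0 < J)%N, chain J.+2 C U & chain J.+2 C V] /\
  [/\ 0 \in C, p.+2%:Z \in C, {in C, forall c, - c \in C},
      forall c, c \in C -> `|c| <= p.+2%:Z & generating (resids p C)].

Lemma sum_window_le (p J : nat) (S : {fset int}) (f : int -> R) k : (0 < J)%N -> sub_unit f ->
  \sum_(x <- window p J S k) f x <= J%:R * #|resids p (window p J S k)|%:R.
Proof.
move=> J0 f01; rewrite -natrM; apply: le_trans (_ : #|` window p J S k|%:R <= _).
  rewrite -[leRHS]mulr1 -sum_fset_const; apply: ler_sum => x _; by case/andP: (f01 x).
by rewrite ler_nat card_window_le.
Qed.

(** The lower bound min(L, |E| + |F|) suffices for [light_pair]: masses bound |E| and |F| from
    below, and when the minimum is L the lightness of the two heaviest windows is enough. *)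
Lemma balanced_windows (p J : nat) C U V (a b : int -> R) (eps d1 d s : R) :
  window_data p J C U V -> sub_unit a -> sub_unit b ->
  0 < eps -> eps <= 1 / 4 -> 0 < d1 -> d1 <= eps / 12 -> d <= d1 -> 0 < s ->
  s <= \sum_(x <- U 0%N) a x -> s <= \sum_(x <- V 0%N) b x ->
  #|` sumset (U J.+2) (V J.+2)|%:R <= (4 + d) * s ->
  (forall k, \sum_(x <- window p J (U 0%N) k) a x <= (1 / 2 - eps) * (J * p.+2)%:R) ->
  (forall k, \sum_(x <- window p J (V 0%N) k) b x <= (1 / 2 - eps) * (J * p.+2)%:R) ->
  exists k l, let E := resids p (window p J (U 0%N) k) in
              let F := resids p (window p J (V 0%N) l) in
    [/\ E != set0, F != set0, #|E|%:R <= 4 * #|F|%:R :> R, #|F|%:R <= 4 * #|E|%:R :> R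
      & #|E|%:R + #|F|%:R <= (1 - eps) * p.+2%:R] /\
    #|sadd (sadd E (sadd (resids p C) (resids p C))) F|%:R <= (1 + d1) * (#|E|%:R + #|F|%:R) /\
    (1 - 3 * d1) * (J * #|E|)%:R <= \sum_(x <- window p J (U 0%N) k) a x.
Proof.
move=> [[J0 hU hV] [C0 CL CN Cmax gen]] a01 b01 e0 e4 d10 de dd s0 sU sV sD lightU lightV.
have [k1 k1X [m0 kmax]] := heavy_window p J a01 (lt_le_trans s0 sU).
have [l1 l1Y [m0' lmax]] := heavy_window p J b01 (lt_le_trans s0 sV).
set D := sumset _ _ in sD.
pose al k := \sum_(x <- window p J (U 0%N) k) a x.
pose be l := \sum_(x <- window p J (V 0%N) l) b x.
rewrite -/(al k1) in m0 kmax; rewrite -/(be l1) in m0' lmax.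
pose E k := resids p (window p J (U 0%N) k); pose F l := resids p (window p J (V 0%N) l).
pose t k l := Num.min (al k / al k1) (be l / be l1).
have J0' : 0 < J%:R :> R by rewrite ltr0n.
have L0 : 0 < p.+2%:R :> R by rewrite ltr0n.
have t_bounds k l : k \in [fset (x %/ (J * p.+2)%:Z)%Z | x in U 0%N]%fset ->
    l \in [fset (x %/ (J * p.+2)%:Z)%Z | x in V 0%N]%fset ->
    [/\ 0 <= t k l, t k l <= 1, al k1 * t k l <= al k & be l1 * t k l <= be l].
  move=> /kmax /andP[ak0 ak1] /lmax /andP[bl0 bl1]; split.
  - by rewrite le_min !divr_ge0 // ltW.
  - by rewrite ge_min ler_pdivrMr // mul1r ak1.
  - by rewrite mulrC -ler_pdivlMr // ge_min lexx.
  - by rewrite mulrC -ler_pdivlMr // ge_min lexx orbT.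
have winS k l z : z = k + l \/ z = k + l + 1 ->
    J%:R * #|sadd (sadd (E k) (sadd (resids p C) (resids p C))) (F l)|%:R
      <= #|` window p J D z|%:R :> R.
  by move=> kl; rewrite -natrM ler_nat; exact: window_sumset.
have winNE (S : {fset int}) k : k \in [fset (x %/ (J * p.+2)%:Z)%Z | x in S]%fset ->
    resids p (window p J S k) != set0.
  case/imfsetP => x xS ->; apply/set0Pn; exists x%:~R; apply/residsP; exists x => //.
  by rewrite !inE xS /=.
have C0' : 0 \in resids p C by apply/residsP; exists 0.
have KS k l : k \in [fset (x %/ (J * p.+2)%:Z)%Z | x in U 0%N]%fset ->
    l \in [fset (x %/ (J * p.+2)%:Z)%Z | x in V 0%N]%fset ->
    (minn p.+2 (#|E k| + #|F l|) <= #|sadd (sadd (E k) (sadd (resids p C) (resids p C))) (F l)|)%N.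
  move=> kX lY; have := card_sadd_generating C0' gen (winNE _ _ kX) (winNE _ _ lY).
  rewrite card_ord => /leq_trans; apply; apply: subset_leq_card.
  rewrite saddC saddA [sadd _ (E k)]saddC; apply: saddS => //; apply: saddS => //.
  exact: sub_saddr.
have th : al k1 + be l1 <= (1 - 2 * eps) * (J * p.+2)%:R.
  apply: le_trans (lerD (lightU k1) (lightV l1)) _; rewrite -mulrDl ler_wpM2r //.
  by clear; lra.
have [|||h1 h2 [k [l [z [kX lY kl gz]]]]] :=
  @light_pair R p J (U 0%N) (V 0%N) D a b k1 l1 s d d1 d10 _ _ s0 sU sV sD k1X m0 kmax l1Y m0' lmax.
- by move: dd de e4; clear; lra.
- by move: dd d10; clear; lra.
- move=> k l z kX lY kl; apply: le_trans (winS _ _ _ kl).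
  have [t0 t1 ta tb] := t_bounds _ _ kX lY; rewrite -/(t k l).
  have := sum_window_le p (U 0%N) k J0 a01; have := sum_window_le p (V 0%N) l J0 b01.
  rewrite -/(al k) -/(be l) -/(E k) -/(F l) => hb ha.
  have := KS _ _ kX lY; rewrite geq_min => /orP[hL|hEF].
    apply: le_trans (_ : J%:R * p.+2%:R <= _); last by rewrite ler_pM2l // ler_nat.
    apply: le_trans (_ : (al k1 + be l1) * 1 <= _).
      by rewrite ler_pM2l // addr_gt0.
    rewrite mulr1; apply: le_trans th _; rewrite natrM.
    by apply: ler_piMl; [rewrite mulr_ge0 // ltW|rewrite gerBl mulr_ge0 // ltW].
  apply: le_trans (_ : J%:R * (#|E k| + #|F l|)%:R <= _); last by rewrite ler_pM2l // ler_nat.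
  by rewrite natrD mulrDl mulrDr; apply: lerD; [apply: le_trans ha|apply: le_trans hb].
exists k, l => /=; rewrite -/(E k) -/(F l) -/(al k).
have [t0 t1 ta tb] := t_bounds _ _ kX lY; rewrite -/(t k l) in gz.
have hb := sum_window_le p (V 0%N) l J0 b01; have ha := sum_window_le p (U 0%N) k J0 a01.
rewrite -/(al k) -/(be l) -/(E k) -/(F l) in ha hb.
set S := #|sadd _ (F l)|.
have [||||||||||[r1 r2 r3 r4 r5] [P0 Q0]] := @light_pair_scaled R eps d1 (al k1 * t k l) (be l1 * t k l)
  (J%:R * #|E k|%:R) (J%:R * #|F l|%:R) (J%:R * S%:R) (J%:R * p.+2%:R) e0 e4 d10 de.
- by rewrite mulr_ge0 // ltW.
- by rewrite mulrA ler_wpM2r.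
- by rewrite mulrA ler_wpM2r.
- exact: le_trans ta ha.
- exact: le_trans tb hb.
- by rewrite mulr_ge0 // ltW.
- by rewrite mulr_gt0.
- by apply: le_lt_trans (winS _ _ _ kl) _; rewrite -mulrDl mulrA.
- rewrite -mulrDl -natrM; apply: le_trans th; rewrite ler_piMr //.
  by rewrite addr_ge0 // ltW.
- have := KS _ _ kX lY; rewrite geq_min -mulrDr -natrD !ler_pM2l // !ler_nat.
  by case/orP; [left|right].
rewrite -mulrDr [(1 - eps) * _]mulrCA ler_pM2l // in r1.
rewrite -mulrDr [(1 + d1) * _]mulrCA ler_pM2l // in r2.
rewrite [4 * _]mulrCA ler_pM2l // in r3; rewrite [4 * _]mulrCA ler_pM2l // in r4.
split; [split=> //; exact: winNE|split=> //].
by rewrite natrM; apply: le_trans r5 ta.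
Qed.

Lemma card_le_resids (p : nat) (C : {fset int}) : (forall c, c \in C -> `|c| <= p.+2%:Z) ->
  (#|` C| <= 3 * #|resids p C|)%N.
Proof.
move=> Cmax; rewrite -(card_blocks (-1)); apply: fsubset_leq_card.
apply/fsubsetP => c cC; rewrite blocksP; apply/andP; split.
  by have := Cmax _ cC; clear; lia.
by apply/residsP; exists c.
Qed.

Lemma heavy_window_dense (p J : nat) (C S : {fset int}) (a : int -> R) (eps c : R) :
  (0 < J)%N -> (forall c, c \in C -> `|c| <= p.+2%:Z) -> sub_unit a -> 0 < c -> c <= 1 / 3 ->
  dense_on a (c * #|` C|%:R) eps \/
  forall k, \sum_(x <- window p J S k) a x <= (1 / 2 - eps) * (J * p.+2)%:R.
Proof.
move=> J0 Cmax a01 c0 c3.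
have [|no] := boolp.EM (forall k, \sum_(x <- window p J S k) a x <= (1 / 2 - eps) * (J * p.+2)%:R).
  by right.
left; have [k /negP] : exists k, ~ \sum_(x <- window p J S k) a x <= (1 / 2 - eps) * (J * p.+2)%:R.
  by apply: boolp.contrapT => no'; apply: no => k; apply: boolp.contrapT => h; apply: no'; exists k.
rewrite -ltNge => /ltW heavy; apply: (@dense_on_blocks R p (k * J%:Z) J) => //.
  apply: le_trans (_ : 1 / 3 * (3 * (J * p.+2))%:R <= _).
    apply: ler_pM => //; first exact: ltW.
    rewrite ler_nat; apply: leq_trans (card_le_resids Cmax) _; rewrite leq_mul2l /=.
    by apply: leq_trans (max_card _) _; rewrite card_ord leq_pmull.
  by rewrite natrM mulrA divfK ?mul1r // pnatr_eq0.
apply: le_trans heavy _; apply: sum_fsetS => [|x _]; last by case/andP: (a01 x).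
apply/fsubsetP => x; rewrite in_window // blocksP => /andP[_ ->] /=.
exact: in_setT.
Qed.

Lemma core_windows (eps : R) : 0 < eps -> eps <= 1 / 4 ->
  exists2 J : nat, (0 < J)%N & exists d0 c : R, [/\ 0 < d0, 0 < c &
  forall (p : nat) C U V (a b : int -> R) (s : R),
  window_data p J C U V -> sub_unit a -> sub_unit b -> 0 < s ->
  s <= \sum_(x <- U 0%N) a x -> s <= \sum_(x <- V 0%N) b x ->
  #|` sumset (U J.+2) (V J.+2)|%:R <= (4 + d0) * s ->
  dense_on a (c * #|` C|%:R) eps \/ dense_on b (c * #|` C|%:R) eps].
Proof.
(* The end loss 1/J is at most eps/4; the other losses are 3d <= eps/4 and a period defect of
   eps/4. *)
move=> e0 e4; have [J J0 hJ] := exists_nat_ge (4 / eps).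
exists J => //; have e1 : eps < 1 by move: e4; clear; lra.
have eta0 : 0 < eps / 4 by rewrite divr_gt0.
have [d1 d10 [c c0 hcrit]] := critical_pair e0 e1 eta0.
(* 240 is 8 from [coset_progression] times 30 from |C| <= 30|E|; 1/3 comes from [C] spanning at most
   three periods, in the case of a heavy window. *)
pose d := Num.min d1 (eps / 12); pose c' := Num.min (1 / 3) (c / 240).
have d0 : 0 < d by rewrite lt_min d10 divr_gt0.
have c'0 : 0 < c' by rewrite lt_min !divr_gt0.
exists d, c'; split=> // p C U V a b s data a01 b01 s0 sU sV sD.
have [[_ hU hV] [C0 CL CN Cmax gen]] := data.
have c'3 : c' <= 1 / 3 by rewrite ge_min lexx.
have [|lightU] := heavy_window_dense (U 0%N) eps J0 Cmax a01 c'0 c'3; first by left.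
have [|lightV] := heavy_window_dense (V 0%N) eps J0 Cmax b01 c'0 c'3; first by right.
have de : d <= eps / 12 by rewrite ge_min lexx orbT.
have [k [l /=]] := balanced_windows data a01 b01 e0 e4 d0 de (lexx d) s0 sU sV sD lightU lightV.
set E := resids p (window p J (U 0%N) k); set F := resids p _.
case=> [[E0 F0 EF FE EFL] [small mass]]; left.
have C0' : 0 \in resids p C by apply/residsP; exists 0.
have small' : #|sadd (sadd E (sadd (resids p C) (resids p C))) F|%:R <= (1 + d1) * (#|E|%:R + #|F|%:R).
  by apply: le_trans small _; apply: ler_wpM2r; rewrite ?addr_ge0 // lerD2l ge_min lexx.
have [v [H [I [[I0 H0 HB] [Hv Hper Hsize]]]]] := hcrit p E F _ C0' gen E0 F0 EF FE EFL small'.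
have [x1 [x2 [L1 [L2 [[L10 L20 size] lat]]]]] := coset_progression I0 H0 HB Hv.
pose q (u : 'I_L1 * 'I_L2) := (val u.1)%:Z * x1 + (val u.2)%:Z * x2.
have qu (u : 'I_L1 * 'I_L2) := lat (val u.1)%:Z (val u.2)%:Z (ltn_ord u.1) (ltn_ord u.2).
have qL u : (absz (q u) <= p.+2)%N by case: (qu u).
have qE u : (period_defect E (q u)%:~R)%:R <= eps / 4 * #|E|%:R.
  case: (qu u) => [[i [h [iI hH hq]]] _ _]; rewrite /q; case: hq => ->.
    exact: Hper.
  by rewrite period_defectN; exact: Hper.
have massB : (1 - 3 * d) * (J * #|E|)%:R <= \sum_(x <- blocks (k * J%:Z) J E) a x.
  apply: le_trans mass _; apply: sum_fsetS => [|x _]; last by case/andP: (a01 x).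
  apply/fsubsetP => x xW; have := xW; rewrite in_window // blocksP => /andP[_ ->] /=.
  by apply/residsP; exists x.
have [x hx] := almost_period_density J0 E0 a01 qL qE massB.
apply: (@dense_on_grid R a _ eps x x1 x2 L1 L2) => //.
- have cC : #|` C|%:R <= 30 * #|E|%:R :> R.
    have h1 : (#|resids p C| <= #|sadd (sadd E (sadd (resids p C) (resids p C))) F|)%N.
      apply: leq_trans (card_sadd_ge _ F0); rewrite saddC.
      by apply: leq_trans (card_sadd_ge _ E0); apply: card_sadd_ge; apply/set0Pn; exists 0.
    have h2 : #|` C|%:R <= 3 * #|resids p C|%:R :> R.
      by rewrite -natrM ler_nat card_le_resids.
    have h3 : #|resids p C|%:R <= (1 + d) * (#|E|%:R + #|F|%:R) by apply: le_trans small; rewrite ler_nat.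
    have h4 : (1 + d) * (#|E|%:R + #|F|%:R) <= 2 * (5 * #|E|%:R).
      apply: ler_pM => //; first by rewrite addr_ge0 // ltW.
      - by rewrite addr_ge0.
      - by move: de e4; clear; lra.
      - by move: FE; clear; lra.
    by move: h2 h3 h4; clear; lra.
  have h1 : I%:R * #|H|%:R <= 8 * (L1 * L2)%:R :> R by rewrite -!natrM ler_nat.
  have h2 : c' * #|` C|%:R <= c / 240 * (30 * #|E|%:R).
    by apply: ler_pM => //; [exact: ltW|rewrite ge_min lexx orbT].
  by move: h1 h2 Hsize; clear; lra.
- by move=> l1 l2 h1 h2; case: (lat l1 l2 h1 h2).
apply: le_trans hx; rewrite card_prod !card_ord; apply: ler_wpM2r => //.
have : J%:R^-1 <= eps / 4.
  have -> : eps / 4 = (4 / eps)^-1 by rewrite invf_div.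
  by rewrite lef_pV2 // posrE ?ltr0n // divr_gt0.
by move: e0 de; clear; lra.
Qed.

End CoreWindows.

(** * Reduction to coprime periods *)

Section Slices.

Variable R : realType.

Implicit Types (q r s y : int) (S T : {fset int}).

Lemma dense_on_affine (a : int -> R) (sz eps : R) (r q : int) : q != 0 ->
  dense_on (fun x => a (r + q * x)) sz eps -> dense_on a sz eps.
Proof.
move=> q0; have q_inj : injective (fun x : int => r + q * x).
  by move=> x y /addrI /(mulfI q0).
have cardE (P : {fset int}) : #|` [fset (r + q * x)%R | x in P]%fset| = #|` P|.
  by rewrite card_imfset.
have sumE (P : {fset int}) : \sum_(x <- [fset (r + q * x)%R | x in P]%fset) a x =
    \sum_(x <- P) a (r + q * x).
  by rewrite big_imfset //= => x y _ _; apply: q_inj.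
have progE d a0 v L P : @progression_with d a0 v L P ->
    progression_with (r + q * a0) (fun i => q * v i) L [fset (r + q * x)%R | x in P]%fset.
  have lin (l : 'I_d -> int) : r + q * (a0 + \sum_(i < d) l i * v i) =
      r + q * a0 + \sum_(i < d) l i * (q * v i).
    by rewrite mulrDr mulr_sumr addrA; congr (_ + _); apply: eq_bigr => i _; rewrite mulrCA.
  case=> L0 hP; split=> // x; split.
    by case/imfsetP => y /= /hP [l hl ->] ->; exists l.
  by case=> l hl ->; rewrite -lin; apply: in_imfset; apply/hP; exists l.
case=> [[P [[a0 [v [L hP]]] hs hd]]|[P [[a0 [v [L [hP hc]]]] hs hd]]].
  by left; exists [fset (r + q * x)%R | x in P]%fset; rewrite cardE sumE; split=> //; do 3 eexists; exact: progE hP.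
right; exists [fset (r + q * x)%R | x in P]%fset; rewrite cardE sumE; split=> //.
by do 3 eexists; split; [exact: progE hP|rewrite cardE].
Qed.

Lemma modz_class (q r y : int) : 0 <= r < q -> ((r + q * y) %% q)%Z = r.
Proof. by move=> rq; rewrite addrC mulrC modzMDl modz_small. Qed.

Definition slice (q r : int) (S : {fset int}) : {fset int} :=
  [fset ((x - r) %/ q)%Z | x in S & (x %% q)%Z == r]%fset.

Lemma in_slice q r S y : 0 <= r < q -> (y \in slice q r S) = (r + q * y \in S).
Proof.
move=> rq; have q0 : q != 0.
  by case/andP: rq => r0 rq; apply: contraTneq rq => ->; rewrite -leNgt.
apply/imfsetP/idP => [[x /=]|yS]; last first.
  exists (r + q * y); rewrite ?inE /= ?yS /=.
    by rewrite modz_class.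
  by rewrite addrAC subrr add0r mulrC mulzK.
rewrite inE /= => /andP[xS /eqP xr] ->; have := divz_eq x q; rewrite xr => ex.
by rewrite {1}ex addrK mulzK // addrC mulrC -ex.
Qed.

Lemma sum_slice q r S (a : int -> R) : 0 <= r < q ->
  \sum_(x <- [fset x in S | (x %% q)%Z == r]%fset) a x = \sum_(y <- slice q r S) a (r + q * y).
Proof.
move=> rq; have q0 : q != 0.
  by case/andP: rq => r0 rq; apply: contraTneq rq => ->; rewrite -leNgt.
suff -> : [fset x in S | (x %% q)%Z == r]%fset = [fset (r + q * y)%R | y in slice q r S]%fset.
  by rewrite big_imfset //= => x y _ _ /addrI /(mulfI q0).
apply/fsetP => x; apply/idP/imfsetP => [|[y /=]].
  rewrite !inE /= => /andP[xS /eqP xr]; exists (x %/ q)%Z => /=; rewrite ?in_slice //;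
    by rewrite -{1}xr addrC mulrC -divz_eq.
rewrite in_slice // => h ->; rewrite !inE /= h /=.
by rewrite modz_class.
Qed.

Lemma card_sumset_slices q r s S T : 0 <= r < q -> 0 <= s < q ->
  (#|` sumset (slice q r S) (slice q s T)| <=
   #|` [fset x in sumset S T | ((x - r) %% q)%Z == s]%fset|)%N.
Proof.
move=> rq sq; have q0 : q != 0.
  by case/andP: rq => r0 rq; apply: contraTneq rq => ->; rewrite -leNgt.
have inj : injective (fun y : int => r + s + q * y) by move=> x y /addrI /(mulfI q0).
have <- : #|` [fset (r + s + q * y)%R | y in sumset (slice q r S) (slice q s T)]%fset| =
    #|` sumset (slice q r S) (slice q s T)| by rewrite card_imfset.
apply: fsubset_leq_card; apply/fsubsetP => z.
case/imfsetP => _ /= /imfset2P [x xS [y yT ->]] ->.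
rewrite in_slice // in xS; rewrite in_slice // in yT.
rewrite !inE /=; apply/andP; split.
  apply/imfset2P; exists (r + q * x) => //; exists (s + q * y) => //.
  by rewrite mulrDr addrACA.
by rewrite -[r + s + _]addrA [r + _]addrC addrK modz_class.
Qed.

Lemma fset_max_nonneg (X : {fset int}) (f : int -> R) : X != fset0 ->
  0 <= \sum_(x <- X) f x -> exists2 x, x \in X & 0 <= f x.
Proof.
move=> X0 hf; have [x xX xmax] := fset_arg_max f X0; exists x => //.
have : 0 <= #|` X|%:R * f x.
  apply: le_trans hf _; rewrite -sum_fset_const big_seq [leRHS]big_seq.
  by apply: ler_sum => y /xmax.
by rewrite pmulr_rge0 // ltr0n cardfs_gt0.
Qed.

Lemma chain_slice C C' (U : nat -> {fset int}) n q r : 0 <= r < q ->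
  (forall c, c \in C' -> q * c \in C) -> chain n C U -> chain n C' (fun j => slice q r (U j)).
Proof.
move=> rq hC hU j x c jn; rewrite !in_slice // mulrDr addrA => xU cC.
by apply: hU => //; apply: hC.
Qed.

Lemma bezout_span (P : int -> Prop) (s : seq int) : P 0 -> (forall x y, P x -> P y -> P (x - y)) ->
  (forall c, c \in s -> P c) -> P (\big[gcdz/0]_(c <- s) c).
Proof.
move=> P0 PB; have PN x : P x -> P (- x) by move=> Px; rewrite -sub0r; apply: PB.
have PD x y : P x -> P y -> P (x + y) by move=> Px Py; rewrite -[y]opprK; apply: PB => //; apply: PN.
have PM u x : P x -> P (u * x).
  move=> Px; have pos (n : nat) : P (n%:Z * x).
    by elim: n => [|n IH]; rewrite ?mul0r // intS mulrDl mul1r; apply: PD.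
  by case: u => n //; rewrite NegzE mulNr; apply: PN.
elim: s => [|c s IH] hs; first by rewrite big_nil.
rewrite big_cons; have [u [v <-]] := Bezoutz c (\big[gcdz/0]_(c <- s) c).
apply: PD; apply: PM; first by apply: hs; rewrite mem_head.
by apply: IH => d ds; apply: hs; rewrite in_cons ds orbT.
Qed.

Lemma dvdz_big_gcdz (s : seq int) c : c \in s -> (\big[gcdz/0]_(d <- s) d %| c)%Z.
Proof.
elim: s => // d s IH; rewrite in_cons big_cons => /orP[/eqP ->|/IH h].
  exact: dvdz_gcdl.
exact: dvdz_trans (dvdz_gcdr _ _) h.
Qed.

(* Dividing C by its gcd makes its residues modulo its maximum generate. *)
Lemma coprime_quotient C : 0 \in C -> {in C, forall c, - c \in C} -> (3 < #|` C|)%N ->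
  exists (q : int) (C' : {fset int}) (p : nat),
  [/\ 0 < q, forall c, c \in C' -> q * c \in C & #|` C'| = #|` C|] /\
  [/\ 0 \in C', p.+2%:Z \in C', {in C', forall c, - c \in C'},
      forall c, c \in C' -> `|c| <= p.+2%:Z & generating (resids p C')].
Proof.
move=> C0 CN C4; pose q := \big[gcdz/0]_(c <- C) c.
have qC c : c \in C -> (q %| c)%Z.
  exact: dvdz_big_gcdz.
have q0 : q != 0.
  apply: contraTneq C4 => e; rewrite -leqNgt.
  suff /fsubset_leq_card : (C `<=` [fset 0])%fset by rewrite cardfs1 => /leq_trans; apply.
  by apply/fsubsetP => c /qC; rewrite e dvd0z inE.
have q1 : 0 < q.
  by rewrite lt_def q0 /q; case: (enum_fset C) => [|d s]; rewrite ?big_nil ?big_cons.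
pose C' := [fset (c %/ q)%Z | c in C]%fset.
have C'P c : (c \in C') = (q * c \in C).
  apply/imfsetP/idP => [[d /= dC ->]|cC].
    by rewrite mulrC divzK // qC.
  by exists (q * c) => //; rewrite mulKz.
have cC' : #|` C'| = #|` C|.
  rewrite card_in_imfset //= => x y xC yC e.
  by rewrite -(divzK (qC _ xC)) -(divzK (qC _ yC)) e.
have C'0 : 0 \in C' by rewrite C'P mulr0.
have C'N : {in C', forall c, - c \in C'} by move=> c; rewrite !C'P mulrN => /CN.
have C'n0 : C' != fset0 by apply/fset0Pn; exists 0.
have [m mC' mmax] := fset_arg_max (fun x => x%:~R : R) C'n0.
have absm c : c \in C' -> `|c| <= m.
  move=> cC; have := mmax _ cC; have := mmax _ (C'N _ cC); rewrite !ler_int.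
  by clear; lia.
(* A maximum below 2 would confine [C'] to -1, 0, 1; four elements guarantee a modulus of the form
   [p.+2]. *)
have m2 : 2 <= m.
  rewrite leNgt; apply/negP => m1; move: C4; rewrite ltnNge => /negP; apply; rewrite -cC'.
  suff /fsubset_leq_card : (C' `<=` [fset x in [:: -1; 0; 1]%Z])%fset.
    by rewrite card_fseq.
  apply/fsubsetP => c /absm; rewrite !inE; move: m1; clear; lia.
case: m m2 mC' absm {mmax} => [[|[|p]]|] // _ mC' absm.
exists q, C', p; split; first by split=> // c; rewrite C'P.
split=> // H H0 HC.
have [n [qn hn]] : exists n, q = q * n /\ (forall h, h \in H -> h + n%:~R \in H).
  pose P x := exists n, x = q * n /\ (forall h, h \in H -> (h + n%:~R \in H) && (h - n%:~R \in H)).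
  have [|x y||n [qn hn]] := @bezout_span P C.
  - by exists 0; rewrite mulr0; split=> // h hH; rewrite !addr0 subr0 hH.
  - move=> [n [-> hn]] [n' [-> hn']]; exists (n - n'); rewrite mulrBr; split=> // h hH.
    have /andP[h1 h2] := hn _ hH.
    have /andP[_ h3] := hn' _ h1; have /andP[h4 _] := hn' _ h2.
    by rewrite intrB addrA h3 opprB addrCA addrC addrAC; move: h4; rewrite addrAC.
  - move=> c cC; exists (c %/ q)%Z; rewrite mulrC divzK ?qC //; split=> // h hH.
    have c'C : (c %/ q)%Z \in C' by rewrite C'P mulrC divzK ?qC.
    apply/andP; split; apply: (subsetP HC); apply: mem_sadd => //; apply/residsP.
      by exists (c %/ q)%Z.
    by exists (- (c %/ q)%Z); rewrite ?intrN // C'N.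
  by exists n; split=> // h /hn /andP[].
have n1 : n = 1 by apply: (mulfI q0); rewrite mulr1.
rewrite {}n1 in hn; apply/setP => z; rewrite inE -(natr_Zp z).
elim: (nat_of_ord z) => [|k IH] //.
by rewrite -natr1; apply: hn.
Qed.

End Slices.

(** * The heaviest residue class *)

Section Classes.

Variable R : realType.

(** Sums with first term in the class [r0] split [D] by the class r of the second term, so some r
    keeps the ratio 4 + d0 relative to the mass of [b] in its own class. Since [r0] is heaviest,
    that mass is also a lower bound on the other side. *)
Lemma heaviest_class (J : nat) (d0 c eps : R) (q : int) (p : nat) C' U V (a b : int -> R) (s : R) r0 :
  (forall U V (a b : int -> R) (s : R),
     window_data p J C' U V -> sub_unit a -> sub_unit b -> 0 < s ->
     s <= \sum_(x <- U 0%N) a x -> s <= \sum_(x <- V 0%N) b x ->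
     #|` sumset (U J.+2) (V J.+2)|%:R <= (4 + d0) * s ->
     dense_on a c eps \/ dense_on b c eps) ->
  0 < d0 -> 0 < q -> 0 <= r0 < q ->
  (forall r, 0 <= r < q -> window_data p J C' (fun j => slice q r (U j)) (fun j => slice q r (U j))) ->
  (forall r, 0 <= r < q -> window_data p J C' (fun j => slice q r (V j)) (fun j => slice q r (V j))) ->
  (forall x, x \in U 0%N -> x \in U J.+2) -> (forall x, x \in V 0%N -> x \in V J.+2) ->
  sub_unit a -> sub_unit b -> 0 < s -> s <= \sum_(x <- V 0%N) b x ->
  #|` sumset (U J.+2) (V J.+2)|%:R <= (4 + d0) * s ->
  slice q r0 (U 0%N) != fset0 ->
  (forall r, 0 <= r < q -> \sum_(y <- slice q r (V 0%N)) b (r + q * y) <=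
                           \sum_(y <- slice q r0 (U 0%N)) a (r0 + q * y)) ->
  dense_on a c eps \/ dense_on b c eps.
Proof.
move=> core d00 q0 r0q dataU dataV incU incV a01 b01 s0 sV sD nonempty heaviest.
have qn0 : q != 0 by rewrite gt_eqF.
set D := sumset _ _ in sD.
pose cl x := (x %% q)%Z; pose g r := #|` [fset x in D | ((x - r0) %% q)%Z == r]%fset|%:R : R.
pose Y := [fset cl x | x in V 0%N]%fset.
pose v r := \sum_(x <- [fset x in V 0%N | cl x == r]%fset) b x.
have sumV : \sum_(x <- V 0%N) b x = \sum_(r <- Y) v r by exact: sum_fibers.
have Y0 : Y != fset0.
  by apply/eqP => e; move: (lt_le_trans s0 sV); rewrite sumV e big_seq_fset0 ltxx.
have clq x : 0 <= cl x < q by rewrite modz_ge0 // ltz_pmod.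
have [|r rY hr] := @fset_max_nonneg R Y (fun r => (4 + d0) * v r - g r) Y0.
  rewrite big_split /= -mulr_sumr -sumV sumrN subr_ge0.
  apply: le_trans (sum_card_fibers R D Y (fun x => ((x - r0) %% q)%Z)) _.
  by apply: le_trans sD _; rewrite ler_pM2l // addr_gt0.
have rq : 0 <= r < q by case/imfsetP: rY => x _ ->; exact: clq.
have vE : v r = \sum_(y <- slice q r (V 0%N)) b (r + q * y) by exact: sum_slice.
rewrite subr_ge0 in hr.
have hS := card_sumset_slices (U J.+2) (V J.+2) r0q rq; rewrite -/D in hS.
have S_pos : (0 < #|` sumset (slice q r0 (U J.+2)) (slice q r (V J.+2))|)%N.
  rewrite cardfs_gt0; case/fset0Pn: nonempty => y; rewrite in_slice // => /incU yU.
  case/imfsetP: rY => x /= xV rx; apply/fset0Pn.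
  exists (y + (x %/ q)%Z); apply/imfset2P; exists y; first by rewrite in_slice.
  exists (x %/ q)%Z => //; rewrite in_slice // rx /cl addrC mulrC -divz_eq.
  exact: incV.
have hr' : #|` sumset (slice q r0 (U J.+2)) (slice q r (V J.+2))|%:R <= (4 + d0) * v r.
  by apply: le_trans hr; rewrite ler_nat.
have v0 : 0 < v r.
  have d4 : 0 < 4 + d0 by rewrite addr_gt0.
  by rewrite -(pmulr_rgt0 _ d4); apply: lt_le_trans hr'; rewrite ltr0n.
have data : window_data p J C' (fun j => slice q r0 (U j)) (fun j => slice q r (V j)).
  by have [[? ? ?] ?] := dataU _ r0q; have [[? ? ?] ?] := dataV _ rq.
have vU : v r <= \sum_(y <- slice q r0 (U 0%N)) a (r0 + q * y) by rewrite vE; apply: heaviest.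
have vV : v r <= \sum_(y <- slice q r (V 0%N)) b (r + q * y) by rewrite vE.
have a01' : sub_unit (fun x => a (r0 + q * x)) by move=> x; apply: a01.
have b01' : sub_unit (fun x => b (r + q * x)) by move=> x; apply: b01.
case: (core _ _ _ _ _ data a01' b01' v0 vU vV hr') => h.
  by left; apply: dense_on_affine h.
by right; apply: dense_on_affine h.
Qed.

Lemma dense_windows (eps : R) : 0 < eps -> eps <= 1 / 4 ->
  exists2 J : nat, (0 < J)%N & exists d0 c : R, [/\ 0 < d0, 0 < c &
  forall C U V (a b : int -> R) (s : R),
  chain J.+2 C U -> chain J.+2 C V -> 0 \in C -> {in C, forall c, - c \in C} -> (3 < #|` C|)%N ->
  sub_unit a -> sub_unit b -> 0 < s ->
  s <= \sum_(x <- U 0%N) a x -> s <= \sum_(x <- V 0%N) b x ->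
  #|` sumset (U J.+2) (V J.+2)|%:R <= (4 + d0) * s ->
  dense_on a (c * #|` C|%:R) eps \/ dense_on b (c * #|` C|%:R) eps].
Proof.
move=> e0 e4; have [J J0 [d0 [c [d00 c0 core]]]] := core_windows e0 e4.
exists J => //; exists d0, c; split=> // C U V a b s hU hV C0 CN C4 a01 b01 s0 sU sV sD.
have [q [C' [p [[q0 hC' <-] [C'0 C'L C'N C'max gen]]]]] := coprime_quotient R C0 CN C4.
have data W r : chain J.+2 C W -> 0 <= r < q ->
    window_data p J C' (fun j => slice q r (W j)) (fun j => slice q r (W j)).
  by move=> hW rq; split; split=> //; apply: chain_slice hW.
have inc W x : chain J.+2 C W -> x \in W 0%N -> x \in W J.+2.
  by move=> hW; apply: (chain_le hW C0); rewrite leqnn.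
have clq (x : int) : 0 <= (x %% q)%Z < q by rewrite modz_ge0 ?ltz_pmod // gt_eqF.
have heaviest (W : nat -> {fset int}) (f : int -> R) : sub_unit f -> s <= \sum_(x <- W 0%N) f x -> exists r,
    [/\ 0 <= r < q, slice q r (W 0%N) != fset0 & forall r', 0 <= r' < q ->
     \sum_(y <- slice q r' (W 0%N)) f (r' + q * y) <= \sum_(y <- slice q r (W 0%N)) f (r + q * y)].
  move=> f01 sW; pose X := [fset (x %% q)%Z | x in W 0%N]%fset.
  have X0 : X != fset0.
    apply/eqP => e; move: (lt_le_trans s0 sW).
    by rewrite (sum_fibers _ (fun x => (x %% q)%Z)) -/X e big_seq_fset0 ltxx.
  have [r rX rmax] := fset_arg_max (fun r => \sum_(y <- slice q r (W 0%N)) f (r + q * y)) X0.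
  have [x xW rx] : exists2 x, x \in W 0%N & r = (x %% q)%Z.
    by case/imfsetP: rX => x xW ->; exists x.
  exists r; split; first by rewrite rx.
    apply/fset0Pn; exists (x %/ q)%Z.
    by rewrite in_slice ?rx // addrC mulrC -divz_eq.
  move=> r' r'q; have [/rmax //|r'X] := boolP (r' \in X).
  rewrite big1_seq ?sumr_ge0 // => [y _|y /andP[_ yW]].
    by case/andP: (f01 (r + q * y)).
  case/negP: r'X; apply/imfsetP; exists (r' + q * y); last by rewrite modz_class.
  by rewrite -in_slice.
have [r [rq rU rmax]] := heaviest U a a01 sU.
have [r' [r'q r'V r'max]] := heaviest V b b01 sV.
have core' := fun U V a b s => core p C' U V a b s.
case: (leP (\sum_(y <- slice q r' (V 0%N)) b (r' + q * y))
           (\sum_(y <- slice q r (U 0%N)) a (r + q * y))) => cmp.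
  apply: (heaviest_class core' d00 q0 rq _ _ _ _ a01 b01 s0 sV sD rU) => *.
  - exact: data.
  - exact: data.
  - exact: inc.
  - exact: inc.
  - by apply: le_trans cmp; apply: r'max.
(* When the heaviest class belongs to [V], the two sides exchange roles. *)
apply/or_comm.
apply: (heaviest_class core' d00 q0 r'q _ _ _ _ b01 a01 s0 sU _ r'V) => *.
- exact: data.
- exact: data.
- exact: inc.
- exact: inc.
- apply: le_trans sD; rewrite ler_nat; apply: fsubset_leq_card; apply/fsubsetP => z.
  case/imfset2P => x xV [y yU ->]; apply/imfset2P; exists y => //; exists x => //.
  exact: addrC.
- by apply: le_trans (ltW cmp); apply: rmax.
Qed.

End Classes.

(** * Transfer from cyclic groups to the integers *)

Section SmallSumBounds.

Variable G : finComNzRingType.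

Implicit Types A B : {set G}.

(** The Ruzsa triangle inequality through the Petridis subset [X], which handles [smul i B] and
    [smul j B] at once. *)
Lemma plunnecke_ruzsa k A B i j : A != set0 -> (#|sadd A B| <= k * #|A|)%N ->
  (#|sdiff (smul i B) (smul j B)| <= k ^ (i + j) * #|A|)%N.
Proof.
move=> A0 AB; have [X [X0 XA hX]] := petridis_smul B A0.
have A1 : (0 < #|A|)%N by rewrite card_gt0.
have X1 : (0 < #|X|)%N by rewrite card_gt0.
have step n : (#|sadd X (smul n B)| <= k ^ n * #|X|)%N.
  rewrite -(leq_pmul2r (m := #|A| ^ n)) ?expn_gt0 ?A1 //.
  apply: leq_trans (hX n) _; rewrite mulnAC -expnMn.
  by apply: leq_mul => //; case: n => // n; rewrite leq_exp2r.
have := leq_trans (ruzsa_triangle X (smul i B) (smul j B)) (leq_mul (step i) (step j)).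
rewrite mulnACA -expnD mulnA leq_pmul2r // => /leq_trans; apply.
by rewrite leq_mul2l subset_leq_card ?orbT.
Qed.

Lemma mem_sdiff A B x y : x \in A -> y \in B -> x - y \in sdiff A B.
Proof. by move=> xA yB; apply/imset2P; exists x y. Qed.

Lemma mem_smul2 B x y : x \in B -> y \in B -> x + y \in smul 2 B.
Proof. by move=> xB yB; rewrite (smulD 1 1) !smul1 mem_sadd. Qed.

Lemma mem_smul3 B x y z : x \in B -> y \in B -> z \in B -> x + y + z \in smul 3 B.
Proof. by move=> xB yB zB; rewrite (smulD 2 1) smul1 mem_sadd // mem_smul2. Qed.

(** Up to sign every element of [A] is an element of [B], so each of these sets embeds in a
    difference of multiples of [B] with at most five terms in all. *)
Lemma small_sum_bounds k A B : A != set0 -> (0 < k)%N -> (#|sadd A B| <= k * #|A|)%N ->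
  A = B \/ (forall x, (x \in A) = (- x \in B)) ->
  [/\ (#|sadd A A| <= k ^ 5 * #|A|)%N, (#|sdiff A A| <= k ^ 5 * #|A|)%N,
      (#|sadd B A| <= k ^ 5 * #|A|)%N,
      (#|sadd (sadd A (sdiff A A)) (sdiff A A)| <= k ^ 5 * #|A|)%N
    & (#|sadd B (sdiff A A)| <= k ^ 5 * #|A|)%N].
Proof.
move=> A0 k0 AB hB; have bound i j (S : {set G}) : (i + j <= 5)%N ->
    S \subset sdiff (smul i B) (smul j B) -> (#|S| <= k ^ 5 * #|A|)%N.
  move=> ij /subset_leq_card /leq_trans; apply; apply: leq_trans (plunnecke_ruzsa i j A0 AB) _.
  by rewrite leq_mul2r leq_pexp2l ?orbT.
have B1 x : x \in B -> x \in smul 1 B by rewrite smul1.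
have z0 : 0 \in smul 0 B by rewrite /= inE.
have sdiffP (S T : {set G}) x : x \in sdiff S T -> exists a b, [/\ a \in S, b \in T & x = a - b].
  by case/imset2P => a b aS bT ->; exists a, b.
case: hB => [eAB|hN].
  subst B; split.
  - apply: (bound 2 0)%N => //; apply/subsetP => x /saddP [a [b [aA bA ->]]].
    by rewrite -[a + b]subr0 mem_sdiff // mem_smul2.
  - apply: (bound 1 1)%N => //; apply/subsetP => x /sdiffP [a [b [aA bA ->]]].
    by rewrite mem_sdiff ?B1.
  - apply: (bound 2 0)%N => //; apply/subsetP => x /saddP [a [b [aA bA ->]]].
    by rewrite -[a + b]subr0 mem_sdiff // mem_smul2.
  - apply: (bound 3 2)%N => //; apply/subsetP => x /saddP [y [z [/saddP [a [w [aA hw ->]]] hz ->]]].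
    have [b [c [bA cA ->]]] := sdiffP _ _ _ hw; have [d [e [dA eA ->]]] := sdiffP _ _ _ hz.
    have -> : a + (b - c) + (d - e) = (a + b + d) - (c + e) by ring.
    by rewrite mem_sdiff ?mem_smul3 ?mem_smul2.
  - apply: (bound 2 1)%N => //; apply/subsetP => x /saddP [a [w [aA hw ->]]].
    have [b [c [bA cA ->]]] := sdiffP _ _ _ hw.
    by rewrite addrA mem_sdiff ?mem_smul2 ?B1.
split.
- apply: (bound 0 2)%N => //; apply/subsetP => x /saddP [a [b [aA bA ->]]].
  have -> : a + b = 0 - (- a + - b) by ring.
  by rewrite mem_sdiff // mem_smul2 // -hN.
- apply: (bound 1 1)%N => //; apply/subsetP => x /sdiffP [a [b [aA bA ->]]].
  have -> : a - b = - b - - a by ring.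
  by rewrite mem_sdiff ?B1 -?hN.
- apply: (bound 1 1)%N => //; apply/subsetP => x /saddP [b [a [bB aA ->]]].
  by rewrite -[a]opprK mem_sdiff ?B1 -?hN.
- apply: (bound 2 3)%N => //; apply/subsetP => x /saddP [y [z [/saddP [a [w [aA hw ->]]] hz ->]]].
  have [b [c [bA cA ->]]] := sdiffP _ _ _ hw; have [d [e [dA eA ->]]] := sdiffP _ _ _ hz.
  have -> : a + (b - c) + (d - e) = (- c + - e) - (- a + - b + - d) by ring.
  by rewrite mem_sdiff ?mem_smul3 ?mem_smul2 -?hN.
- apply: (bound 2 1)%N => //; apply/subsetP => x /saddP [a [w [aA hw ->]]].
  have [b [c [bA cA ->]]] := sdiffP _ _ _ hw.
  have -> : a + (b - c) = (a + - c) - (- b) by ring.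
  by rewrite mem_sdiff ?mem_smul2 ?B1 -?hN.
Qed.

End SmallSumBounds.

(** * Lifting residues to integers without wrap-around *)

Section Lifts.

Variables (R : realType) (p : nat).

Implicit Types (w : nat) (S T : {set 'Z_p.+2}) (A X : {fset int}).

Definition box w : {fset int} := [fset ((val i)%:Z - w%:Z)%R | i in 'I_(w + w).+1]%fset.

Lemma in_box w x : (x \in box w) = (`|x| <= w%:Z).
Proof.
apply/imfsetP/idP => [[i _ ->]|xw]; first by have := ltn_ord i => /=; clear; lia.
have xi : (absz (x + w%:Z)%R < (w + w).+1)%N by move: xw; clear; lia.
exists (Ordinal xi) => //=; move: xw; clear; lia.
Qed.

Definition within w S := forall z, z \in S -> exists2 x : int, `|x| <= w%:Z & x%:~R = z.

Lemma withinS w S T : S \subset T -> within w T -> within w S.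
Proof. by move=> /subsetP ST hT z /ST /hT. Qed.

Lemma withinW w w' S : (w <= w')%N -> within w S -> within w' S.
Proof. by move=> ww hS z /hS [x xw xz]; exists x => //; apply: le_trans xw _; rewrite lez_nat. Qed.

Lemma within_sadd w w' S T : within w S -> within w' T -> within (w + w') (sadd S T).
Proof.
move=> hS hT z /saddP [a [b [/hS [x xw <-] /hT [y yw <-] ->]]].
exists (x + y); last by rewrite intrD.
by apply: le_trans (ler_normD _ _) _; rewrite PoszD lerD.
Qed.

Lemma within_sdiff w w' S T : within w S -> within w' T -> within (w + w') (sdiff S T).
Proof.
move=> hS hT z /imset2P [a b /hS [x xw <-] /hT [y yw <-] ->].
exists (x - y); last by rewrite intrB.
by apply: le_trans (ler_normB _ _) _; rewrite PoszD lerD.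
Qed.

Lemma within_resids w A : (forall x, x \in A -> `|x| <= w%:Z) -> within w (resids p A).
Proof. by move=> hA z /residsP [x xA <-]; exists x => //; apply: hA. Qed.

Lemma resid_inj w w' (x y : int) : (w + w' <= p.+1)%N -> `|x| <= w%:Z -> `|y| <= w'%:Z ->
  x%:~R = y%:~R :> 'Z_p.+2 -> x = y.
Proof.
move=> ww xw yw /eqP; rewrite residE => /dvdzP [k e]; apply/eqP; rewrite -subr_eq0 e.
have k0 : `|k| < 1.
  rewrite -(ltr_pM2r (_ : 0 < p.+2%:Z)) // mul1r.
  have -> : `|k| * p.+2%:Z = `|x - y| by rewrite e normrM.
  by move: ww xw yw; clear; lia.
by have -> : k = 0 by move: k0; clear; lia.
Qed.

Definition lift_fset w S : {fset int} := [fset x in box w | x%:~R \in S]%fset.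

Lemma in_lift w S x : (x \in lift_fset w S) = (`|x| <= w%:Z) && (x%:~R \in S).
Proof. by rewrite !inE in_box. Qed.

Lemma resids_lift w S : within w S -> resids p (lift_fset w S) = S.
Proof.
move=> hS; apply/setP => z; apply/residsP/idP => [[x]|zS].
  by rewrite in_lift => /andP[_ xS] <-.
by have [x xw xz] := hS z zS; exists x => //; rewrite in_lift xw xz.
Qed.

Lemma sum_resids w X (f : 'Z_p.+2 -> R) : (w + w <= p.+1)%N -> (forall x, x \in X -> `|x| <= w%:Z) ->
  \sum_(z in resids p X) f z = \sum_(x <- X) f x%:~R.
Proof.
move=> ww hX; rewrite big_seq_fsetE /= big_imset //= => x y _ _ e.
by apply: val_inj; apply: (resid_inj ww) e; apply: hX; apply: valP.
Qed.

Lemma card_resids_le X : (#|resids p X| <= #|` X|)%N.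
Proof. by rewrite cardfE; apply: leq_imset_card. Qed.

Lemma card_resids w X : (w + w <= p.+1)%N -> (forall x, x \in X -> `|x| <= w%:Z) ->
  #|resids p X| = #|` X|.
Proof.
move=> ww hX; apply/eqP; rewrite -(eqr_nat R) -[#|resids p X|%:R]mulr1 -[#|` X|%:R]mulr1.
by rewrite -sum_fset_const -(sum_resids (fun=> 1) ww hX) sumr_const mulr_natl.
Qed.

Lemma sadd_resids A X : sadd (resids p A) (resids p X) = resids p (sumset A X).
Proof.
apply/setP => z; apply/saddP/residsP.
  case=> a [b [/residsP [x xA <-] /residsP [y yX <-] ->]].
  by exists (x + y); [apply/imfset2P; exists x => //; exists y|rewrite intrD].
case=> _ /imfset2P [x xA [y yX ->]] <-; exists x%:~R, y%:~R.
by split; [apply/residsP; exists x|apply/residsP; exists y|rewrite intrD].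
Qed.

Definition moving_average (A : {fset int}) w (k : 'Z_p.+2 -> R) (x : int) : R :=
  \sum_(y <- box w) k y%:~R * (x - y \in A)%:R.

Lemma moving_average_unit A w k : (w + w <= p.+1)%N -> (forall z, 0 <= k z) -> \sum_z k z <= 1 ->
  sub_unit (moving_average A w k).
Proof.
move=> ww k0 k1 x; rewrite sumr_ge0 => [|y _]; last by rewrite mulr_ge0.
apply: le_trans k1; apply: le_trans (_ : \sum_(y <- box w) k y%:~R <= _).
  by apply: ler_sum => y _; rewrite ler_piMr // lern1 leq_b1.
rewrite -(sum_resids k ww) => [|y]; last by rewrite in_box.
by rewrite [leRHS](bigID (mem (resids p (box w)))) /= lerDl sumr_ge0.
Qed.

(** A moving average is a weighted mean of translates of the indicator of [A], so on any progression
    one translate does at least as well; the progression is then moved back. *)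
Lemma dense_moving_average A w k (s eps : R) : (w + w <= p.+1)%N -> (forall z, 0 <= k z) ->
  \sum_z k z <= 1 -> dense_on (moving_average A w k) s eps ->
  dense_on (fun x => (x \in A)%:R) s eps.
Proof.
move=> ww k0 k1 hd.
have avg (P : {fset int}) : exists y, \sum_(x <- P) moving_average A w k x <=
    \sum_(x <- P) (- y + 1 * x \in A)%:R.
  have box0 : box w != fset0 by apply/fset0Pn; exists 0; rewrite in_box normr0.
  pose g y : R := \sum_(x <- P) (x - y \in A)%:R.
  have [y yb ymax] := fset_arg_max g box0; exists y.
  have -> : \sum_(x <- P) (- y + 1 * x \in A)%:R = g y.
    by apply: eq_bigr => x _; rewrite mul1r addrC.
  rewrite exchange_big /=; apply: le_trans (_ : \sum_(z <- box w) k z%:~R * g y <= _).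
    rewrite big_seq [leRHS]big_seq; apply: ler_sum => z zb.
    by rewrite -mulr_sumr ler_wpM2l // ymax.
  rewrite -mulr_suml ler_piMl //; first by apply: sumr_ge0.
  apply: le_trans k1; rewrite -(sum_resids k ww) => [|z]; last by rewrite in_box.
  by rewrite [leRHS](bigID (mem (resids p (box w)))) /= lerDl sumr_ge0.
case: hd => [[P [hP hs ha]]|[P [hP hs ha]]]; have [y hy] := avg P;
  apply: (@dense_on_affine R _ s eps (- y) 1) => //; [left|right];
  by exists P; split=> //; apply: le_trans ha hy.
Qed.

Lemma dens_le_moving_average A w w' w2 k (x : int) : (w' + w' <= p.+1)%N -> (w2 + w + w' <= p.+1)%N ->
  (forall u, u \in A -> `|u| <= w'%:Z) -> `|x| <= w2%:Z ->
  (forall z, 0 <= k z) -> (forall z, k z != 0 -> exists2 y : int, `|y| <= w%:Z & y%:~R = z) ->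
  dens (resids p A) k x%:~R <= moving_average A w k x.
Proof.
move=> ww ww2 hA xw k0 ksupp; rewrite /dens (sum_resids (fun u => k (x%:~R - u)) ww hA).
rewrite (big_fsetID _ [pred u | `|x - u| <= w%:Z]) /= [X in _ + X]big1_seq ?addr0; last first.
  move=> u /andP[_]; rewrite !inE /= => /andP[uA /negP nxu].
  apply/eqP; apply: contraT => /ksupp [y yw]; rewrite -intrB => exy; case: nxu.
  suff <- : y = x - u by [].
  apply: (@resid_inj w (w2 + w')) exy => //; first by rewrite addnA [(w + w2)%N]addnC.
  by apply: le_trans (ler_normB _ _) _; rewrite PoszD lerD // hA.
rewrite /moving_average; set A' := [fset u in A | _]%fset.
apply: le_trans (_ : \sum_(y <- [fset (x - u)%R | u in A']%fset) k y%:~R * (x - y \in A)%:R <= _).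
  rewrite [leRHS]big_imfset /=; last first.
    by move=> u v _ _ /= e; apply: oppr_inj; apply: (addrI x).
  rewrite big_seq [leRHS]big_seq; apply: ler_sum => u; rewrite !inE /= => /andP[uA _].
  by rewrite subKr uA mulr1 intrB.
apply: sum_fsetS => [|y _]; last by rewrite mulr_ge0.
by apply/fsubsetP => y /imfsetP [u]; rewrite !inE /= => /andP[_ h] ->; rewrite in_box.
Qed.

End Lifts.

(** * The smooth model applied to integer sets *)

Section Transfer.

Variable R : realType.

Lemma dense_on_le (a a' : int -> R) (s s' eps : R) : (forall x, a x <= a' x) -> s' <= s ->
  dense_on a s eps -> dense_on a' s' eps.
Proof.
move=> aa ss [[P [hP hs ha]]|[P [hP hs ha]]]; [left|right]; exists P; split=> //;
  by [apply: le_trans hs|apply: le_trans ha (ler_sum _ _)].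
Qed.

Lemma dense_on_point (A : {fset int}) (s eps : R) : A != fset0 -> 0 < eps -> s <= 1 ->
  dense_on (fun x => (x \in A)%:R) s eps.
Proof.
case/fset0Pn => x xA e0 s1; left; exists [fset x]%fset; rewrite cardfs1 big_seq_fset1 xA.
split=> //; last by rewrite /= !mulr1n mulr1; move: e0; clear; lra.
exists (x - 1), (fun=> 1), (fun=> 1%N); split=> // y; rewrite inE; split=> [/eqP ->|[l hl ->]].
  by exists (fun=> 1) => //; rewrite big_ord1 mulr1 subrK.
by rewrite big_ord1 mulr1; have /= := hl ord0; move: (l ord0) => k; clear; lia.
Qed.

Lemma chain_sub (G : finComNzRingType) (r : nat) (C : {set G}) (U : nat -> {set G}) i j :
  0 \in C -> (forall k, (k < r)%N -> sadd (U k) C \subset U k.+1) -> (i <= j <= r)%N -> U i \subset U j.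
Proof.
move=> C0 hU /andP[ij jr]; elim: j ij jr => [|j IH]; first by rewrite leqn0 => /eqP ->.
rewrite leq_eqVlt => /orP[/eqP -> //|ij] jr.
exact: subset_trans (IH ij (ltnW jr)) (subset_trans (sub_saddr _ C0) (hU _ jr)).
Qed.

Lemma chain_lift (p w w' r : nat) (C : {set 'Z_p.+2}) (U : nat -> {set 'Z_p.+2}) :
  (w + w' + w <= p.+1)%N -> 0 \in C -> (forall k, (k < r)%N -> sadd (U k) C \subset U k.+1) ->
  within w (U r) -> chain r (lift_fset w' C) (fun j => lift_fset w (U j)).
Proof.
move=> ww C0 hU wU j x c jr; rewrite !in_lift => /andP[xw xU] /andP[cw cC].
have h : (x + c)%:~R \in U j.+1 by rewrite intrD; apply: (subsetP (hU _ jr)); apply: mem_sadd.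
have [|y yw exy] := wU (x + c)%:~R.
  by apply: (subsetP (chain_sub C0 hU _)) h; rewrite jr leqnn.
suff <- : y = x + c by rewrite yw exy.
apply: (@resid_inj p w (w + w')) exy => //; first by rewrite addnC.
by apply: le_trans (ler_normD _ _) _; rewrite PoszD lerD.
Qed.

Lemma mass_lift (p w w2 : nat) (X : {fset int}) (T S : {set 'Z_p.+2}) (m : R) :
  (w2 + w2 <= p.+1)%N -> (w + w <= p.+1)%N -> (w2 + (w + w) + w <= p.+1)%N ->
  (forall x, x \in X -> `|x| <= w%:Z) -> within (w + w) (sdiff T T) -> within w2 S ->
  m <= \sum_(z in S) dens (resids p X) (kernel R T) z ->
  m <= \sum_(x <- lift_fset w2 S) moving_average X (w + w) (kernel R T) x.
Proof.
move=> h2 h1 h3 hX wT wS /le_trans; apply; rewrite -{1}(resids_lift wS).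
rewrite (@sum_resids R p w2) // => [|x]; last by rewrite in_lift => /andP[].
rewrite big_seq [leRHS]big_seq; apply: ler_sum => x; rewrite in_lift => /andP[xw _].
apply: (@dens_le_moving_average R p X (w + w) w w2) => // z; first exact: kernel_ge0.
move=> kz; apply: wT; apply: contraNT kz => /kernel_supp ->; exact: eqxx.
Qed.

Lemma card_sumset_lift (p w : nat) (S T : {set 'Z_p.+2}) :
  (w + w + (w + w) <= p.+1)%N -> within w S -> within w T ->
  (#|` sumset (lift_fset w S) (lift_fset w T)| = #|sadd S T|)%N.
Proof.
move=> ww wS wT; rewrite -{2}(resids_lift wS) -{2}(resids_lift wT) sadd_resids.
rewrite (@card_resids R p (w + w)) // => x /imfset2P [y]; rewrite in_lift => /andP[yw _] [z].
rewrite in_lift => /andP[zw _] ->; apply: le_trans (ler_normD _ _) _.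
by rewrite PoszD lerD.
Qed.

(** One factor [1 - eta] is lost in the masses of [U 0] and [V 0], the other in comparing
    [U r + V r] with [A + B]. *)
Lemma loss_exists (d : R) : 0 < d -> exists eta d', [/\ 0 < eta, eta <= 1 / 2, 0 < d', d' <= 1 &
  4 + d' <= (4 + d) * (1 - eta) * (1 - eta)].
Proof.
move=> d0; have d4 : 0 < 4 * (4 + d) by rewrite mulr_gt0 // addr_gt0.
pose e := d / (4 * (4 + d)); have e0 : 0 < e by rewrite divr_gt0.
have e_eq : e * (4 * (4 + d)) = d by rewrite divfK ?gt_eqF.
exists (Num.min (1 / 2) e), (Num.min 1 (d / 2)); split.
- by rewrite lt_min e0 divr_gt0.
- by rewrite ge_min lexx.
- by rewrite lt_min ltr01 divr_gt0.
- by rewrite ge_min lexx.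
set eta := Num.min _ e; have h1 : eta <= e by rewrite ge_min lexx orbT.
have h2 : Num.min 1 (d / 2) <= d / 2 by rewrite ge_min lexx orbT.
apply: le_trans (lerD (lexx 4) h2) _; move: (eta) h1 => x xe.
have h3 : x * (4 + d) <= e * (4 + d) by rewrite ler_pM2r // addr_gt0.
have h4 : 0 <= x ^+ 2 * (4 + d) by rewrite mulr_ge0 ?sqr_ge0 // addr_ge0 // ltW.
have -> : (4 + d) * (1 - x) * (1 - x) = 4 + d - 2 * (x * (4 + d)) + x ^+ 2 * (4 + d) by ring.
by move: h3 h4 e_eq; rewrite mulrCA; move: (e * _) (x * _) (_ ^+ 2 * _) => u v z; clear; lra.
Qed.

Lemma pair_dense (eps : R) : 0 < eps -> eps <= 1 / 4 ->
  exists d0 c : R, [/\ 0 < d0, 0 < c & forall (A : {fset int}) (sg : int),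
  A != fset0%fset -> sg = 1 \/ sg = -1 ->
  #|` sumset A [fset sg * x | x in A]%fset|%:R <= (4 + d0) * #|` A|%:R ->
  dense_on (fun x => (x \in A)%:R) (c * #|` A|%:R) eps].
Proof.
move=> e0 e4; have [J J0 [d [c' [d0 c'0 windows]]]] := dense_windows e0 e4.
have [eta [d' [eta0 eta2 d'0 d'1 hd]]] := loss_exists d0.
(* As d' <= 1, |A + B| <= 5|A|, and the sumsets needed have at most five terms. *)
have [K [K1 hK]] : exists K, (1 <= K)%N /\ K = (5 ^ 5)%N by exists (5 ^ 5)%N; rewrite expn_gt0.
have K1' : 1 <= K%:R :> R by rewrite ler1n.
have eta1 : eta <= 1 by move: eta2; clear; lra.
have eta1' : 0 < 1 - eta by move: eta2; clear; lra.
have [c1 c10 model] := smooth_model J.+2 K1' eta0 eta1.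
pose c := Num.min (c1 / 4) (c' * c1).
exists d', c; split=> //; first by rewrite lt_min divr_gt0 ?mulr_gt0.
move=> A sg A0 hsg; set B := imfset _ _ _ => AB.
have sgK x : sg * (sg * x) = x by case: hsg => ->; rewrite ?mul1r // !mulN1r opprK.
have sgn x : `|sg * x| = `|x| by case: hsg => ->; rewrite ?mul1r // mulN1r normrN.
have BP x : (x \in B) = (sg * x \in A).
  apply/imfsetP/idP => [[y /= yA ->]|xA]; first by rewrite sgK.
  by exists (sg * x); rewrite ?sgK.
have cB : #|` B| = #|` A|.
  by rewrite card_imfset //= => x y /(congr1 (fun z => sg * z)); rewrite !sgK.
have [x0 x0A x0max] := fset_arg_max (fun x => `|x|%:~R : R) A0.
(* [U] lies within w + 2w + 2w = 5w, so sums of [U] and [V] lie within 10w; a modulus above 20w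
   keeps their residues distinct. *)
pose w := absz x0; pose p := (20 * w)%N.
have hA x : x \in A -> `|x| <= w%:Z by move=> /x0max; rewrite ler_int.
have hB x : x \in B -> `|x| <= w%:Z by rewrite BP => /hA; rewrite sgn.
have [ww1 ww2 ww3] : [/\ (w + w <= p.+1)%N, (w + w + (w + w) <= p.+1)%N & (5 * w + (w + w) + 5 * w <= p.+1)%N].
  by rewrite /p; move: (w); clear; split; lia.
have [ww4 ww5 ww6] : [/\ (5 * w + 5 * w + (5 * w + 5 * w) <= p.+1)%N, (5 * w + 5 * w <= p.+1)%N & (5 * w + (w + w) + w <= p.+1)%N].
  by rewrite /p; move: (w); clear; split; lia.
move: p ww1 ww2 ww3 ww4 ww5 ww6 => p ww1 ww2 ww3 ww4 ww5 ww6.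
have cA_ : #|resids p A| = #|` A| := @card_resids R p w A ww1 hA.
have cB_ : #|resids p B| = #|` A| by rewrite (@card_resids R p w B ww1 hB).
have A1 : 0 < #|` A|%:R :> R by rewrite ltr0n cardfs_gt0.
have A_0 : resids p A != set0 by rewrite -card_gt0 cA_ cardfs_gt0.
have AB_ : (#|sadd (resids p A) (resids p B)| <= #|` sumset A B|)%N.
  by rewrite sadd_resids card_resids_le.
have AB5 : (#|sadd (resids p A) (resids p B)| <= 5 * #|resids p A|)%N.
  rewrite -(ler_nat R) natrM cA_; apply: le_trans (_ : #|` sumset A B|%:R <= _).
    by rewrite ler_nat.
  by apply: le_trans AB _; rewrite ler_pM2r //; move: d'1; clear; lra.
have relB : resids p A = resids p B \/ (forall z, (z \in resids p A) = (- z \in resids p B)).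
  case: hsg BP => -> BP; [left; congr resids; apply/fsetP => x; by rewrite BP mul1r|right => z].
  apply/residsP/residsP => -[x xX e]; exists (- x); rewrite ?intrN ?e ?opprK //.
    by rewrite BP mulN1r opprK.
  by rewrite -mulN1r -BP.
have [] := @small_sum_bounds _ 5 _ _ A_0 isT AB5 relB.
rewrite -hK => b1 b2 b3 b4 b5.
have toR n : (n <= K * #|resids p A|)%N -> n%:R <= K%:R * #|resids p A|%:R :> R.
  by rewrite -natrM ler_nat.
have bs : bounded_sums (K%:R : R) (resids p A) (resids p B).
  by split; rewrite ?toR // cB_ cA_.
have [T [C [U [V [[TA T0 CA C0 CN] [[hc hUV UA VB] [h1 h2 h3]]]]]]] := model _ _ _ bs (toR _ b4) (toR _ b5).
have wA := @within_resids p w A hA; have wB := @within_resids p w B hB.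
have wD := within_sdiff wA wA; have wC := withinS CA wD.
have wU : within (5 * w) (U J.+2).
  apply: withinW (withinS UA (within_sadd (within_sadd wA wD) wD)).
  by clear; lia.
have wV : within (5 * w) (V J.+2).
  by apply: withinW (withinS VB (within_sadd wB wD)); clear; lia.
have hU k : (k < J.+2)%N -> sadd (U k) C \subset U k.+1 by case/hUV.
have hV k : (k < J.+2)%N -> sadd (V k) C \subset V k.+1 by case/hUV.
have wT : within (w + w) (sdiff T T).
  by apply: withinS wD; apply: sdiffS.
have cC : #|` lift_fset (w + w) C| = #|C|.
  rewrite -(@card_resids R p (w + w)) ?resids_lift // => x.
  by rewrite in_lift => /andP[].
rewrite cA_ in hc h2 h3.
have cle1 : c <= c1 / 4 by rewrite ge_min lexx.
have cle2 : c <= c' * c1 by rewrite ge_min lexx orbT.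
(* If [C] has at most three elements, |A| is bounded and c|A| <= 1, so a single point of [A] is a
   long enough progression. *)
have [C4|C4] := ltnP 3 #|C|; last first.
  apply: dense_on_point => //; apply: le_trans (_ : c1 / 4 * #|` A|%:R <= _).
    by rewrite ler_pM2r.
  have : #|C|%:R <= 3 :> R by rewrite (ler_nat R _ 3).
  by rewrite mulrAC ler_pdivrMr //; move: hc; clear; lra.
have s0 : 0 < (1 - eta) * #|` A|%:R by rewrite mulr_gt0.
have wU0 : within (5 * w) (U 0%N) by apply: withinS wU; apply: (chain_sub C0 hU); rewrite leqnn.
have wV0 : within (5 * w) (V 0%N) by apply: withinS wV; apply: (chain_sub C0 hV); rewrite leqnn.
have sU := mass_lift ww5 ww1 ww6 hA wT wU0 h2.
have sV := mass_lift ww5 ww1 ww6 hB wT wV0 h3.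
have ker1 : \sum_z kernel R T z <= 1 by rewrite sum_kernel.
have unitA := moving_average_unit A ww2 (kernel_ge0 R T) ker1.
have unitB := moving_average_unit B ww2 (kernel_ge0 R T) ker1.
have C0' : 0 \in lift_fset (w + w) C by rewrite in_lift normr0 C0.
have CN' : {in lift_fset (w + w) C, forall x, - x \in lift_fset (w + w) C}.
  by move=> x; rewrite !in_lift normrN intrN => /andP[-> /CN].
have C4' : (3 < #|` lift_fset (w + w) C|)%N by rewrite cC.
have small : #|` sumset (lift_fset (5 * w) (U J.+2)) (lift_fset (5 * w) (V J.+2))|%:R
    <= (4 + d) * ((1 - eta) * #|` A|%:R).
  rewrite (card_sumset_lift ww4) // -(ler_pM2l eta1').
  apply: le_trans h1 _; apply: le_trans (_ : #|` sumset A B|%:R <= _); first by rewrite ler_nat.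
  apply: le_trans AB _; rewrite !mulrA ler_pM2r //.
  by rewrite [(1 - eta) * _]mulrC.
have le_c : c * #|` A|%:R <= c' * #|` lift_fset (w + w) C|%:R.
  rewrite cC; apply: le_trans (_ : c' * c1 * #|` A|%:R <= _); first by rewrite ler_pM2r.
  by rewrite -mulrA ler_pM2l.
case: (windows _ _ _ _ _ _ (chain_lift ww3 C0 hU wU) (chain_lift ww3 C0 hV wV) C0' CN' C4' unitA unitB s0 sU sV small)
  => /(dense_moving_average ww2 (kernel_ge0 R T) ker1) dense.
  exact: dense_on_le le_c dense.
(* Here the progression is dense in [B], the image of [A] under the involution x -> sg x. *)
apply: (@dense_on_affine R _ _ _ 0 sg); first by case: hsg => ->.
by apply: dense_on_le le_c dense => x; rewrite add0r BP.
Qed.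

End Transfer.

(** * From weights to sets, and the choice of the constant *)

Section Density.

Variable R : realType.

Lemma sum_mem_fset (A P : {fset int}) :
  \sum_(x <- P) (x \in A)%:R = #|` (A `&` P)%fset|%:R :> R.
Proof.
rewrite (big_fsetID _ (mem A)) /= [X in _ + X]big1_seq ?addr0 => [|x].
  have -> : (A `&` P)%fset = [fset x in P | x \in A]%fset.
    by apply/fsetP => x; rewrite !inE /= andbC.
  rewrite -[RHS]mulr1 -sum_fset_const big_seq [RHS]big_seq; apply: eq_bigr => x.
  by rewrite !inE /= => /andP[_ ->].
by rewrite !inE /= => /andP[_ /negbTE ->].
Qed.

Lemma dense_on_progressionP (A : {fset int}) (c e eps : R) : A != fset0%fset -> 0 < c -> e <= eps ->
  dense_on (fun x => (x \in A)%:R) (c * #|` A|%:R) e -> dense_on_progression c eps A.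
Proof.
move=> A0 c0 ee hd; have A1 : 0 < c * #|` A|%:R by rewrite mulr_gt0 // ltr0n cardfs_gt0.
have dens (P : {fset int}) t : c * #|` A|%:R <= #|` P|%:R ->
    (t - e) * #|` P|%:R <= \sum_(x <- P) (x \in A)%:R -> t - eps <= density R A P.
  move=> /(lt_le_trans A1) P0; rewrite sum_mem_fset /density ler_pdivlMr // => h.
  by apply: le_trans h; rewrite ler_pM2r // lerB.
by case: hd => -[P [hP hs /(dens _ _ hs) hd]]; [left|right]; exists P.
Qed.

Definition small_sums (d : R) (A : {fset int}) : Prop :=
  #|` sumset A A|%:R <= (4 + d) * #|` A|%:R \/ #|` diffset A A|%:R <= (4 + d) * #|` A|%:R.

Lemma small_sums_dense (eps : R) : 0 < eps ->
  exists d0 c : R, [/\ 0 < d0, 0 < c & forall A, A != fset0%fset -> small_sums d0 A ->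
    dense_on_progression c eps A].
Proof.
move=> e0; have m0 : 0 < Num.min eps (1 / 4) by rewrite lt_min e0 divr_gt0.
have m4 : Num.min eps (1 / 4) <= 1 / 4 by rewrite ge_min lexx orbT.
have [d0 [c [d00 c0 dense]]] := pair_dense m0 m4.
exists d0, c; split=> // A A0 hA; apply: (dense_on_progressionP (e := Num.min eps (1 / 4))) => //.
  by rewrite ge_min lexx.
case: hA => hA; [apply: (dense _ 1) => //; first by left|apply: (dense _ (-1)) => //; first by right].
  suff -> : [fset 1 * x | x in A]%fset = A by [].
  apply/fsetP => x; apply/imfsetP/idP => [[y yA ->]|xA]; first by rewrite mul1r.
  by exists x; rewrite // mul1r.
suff -> : sumset A [fset -1 * x | x in A]%fset = diffset A A by [].
apply/fsetP => x; apply/imfset2P/imfset2P => -[y yA [z zA ->]]; exists y => //.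
  by case/imfsetP: zA => t tA ->; exists t; rewrite // mulN1r.
by exists (-1 * z); rewrite ?mulN1r //; apply/imfsetP; exists z; rewrite ?mulN1r.
Qed.

Lemma dense_on_progression_le (c e eps : R) A : e <= eps ->
  dense_on_progression c e A -> dense_on_progression c eps A.
Proof.
move=> ee [[P [hP hc hd]]|[P [hP hc hd]]]; [left|right]; exists P; split=> //;
  by apply: le_trans hd; rewrite lerD2l lerN2.
Qed.

Lemma small_sums_le (d d' : R) A : d <= d' -> small_sums d A -> small_sums d' A.
Proof.
by move=> dd [h|h]; [left|right]; apply: le_trans h _; apply: ler_wpM2r => //; rewrite lerD2l.
Qed.

End Density.


Theorem theorem1p2 (R : realType) :
  exists c : R -> R,
    (forall delta : R, 0 < delta -> 0 < c delta) /\
    forall eps : R, 0 < eps ->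
    exists2 delta0 : R, 0 < delta0 &
    forall delta : R, 0 < delta -> delta <= delta0 ->
    forall A : {fset int}, A != fset0%fset ->
      (#|` sumset A A|%:R <= (4 + delta) * #|` A|%:R ->
         dense_on_progression (c delta) eps A)
      /\
      (#|` diffset A A|%:R <= (4 + delta) * #|` A|%:R ->
         dense_on_progression (c delta) eps A).
Proof.
have inv0 n : 0 < n.+1%:R^-1 :> R by rewrite invr_gt0 ltr0n.
have inv_le m n : (m <= n)%N -> n.+1%:R^-1 <= m.+1%:R^-1 :> R.
  by move=> mn; rewrite lef_pV2 ?posrE ?ltr0n // ler_nat.
have const n : exists y : R * R, [/\ 0 < y.1, 0 < y.2 &
    forall A, A != fset0%fset -> small_sums y.1 A -> dense_on_progression y.2 n.+1%:R^-1 A].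
  by have [d0 [c [h1 h2 h3]]] := small_sums_dense (inv0 n); exists (d0, c).
have [dc hdc] := boolp.choice const.
pose d n := Num.min (dc n).1 n.+1%:R^-1.
(* c delta belongs to the largest n for which delta is admissible at density
   loss 1/(n+1); this n is bounded since d n <= 1/(n+1). *)
have uniform delta : exists c : R, 0 < c /\ (0 < delta -> forall m, delta <= d m ->
    forall A, A != fset0%fset -> small_sums delta A -> dense_on_progression c m.+1%:R^-1 A).
  have [[m0 m0d]|no] := boolp.EM (exists m, delta <= d m); last first.
    by exists 1; split=> // _ m md; case: no; exists m.
  have [delta0|ndelta0] := ltP 0 delta; last by exists 1; split.
  have [k k0 hk] := exists_nat_ge delta^-1.
  have bound m : delta <= d m -> (m <= k)%N.
    rewrite le_min => /andP[_ hm]; apply: ltnW; rewrite -(ler_nat R).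
    by apply: le_trans hk; rewrite -[m.+1%:R]invrK lef_pV2 ?posrE.
  have exm : exists m, delta <= d m by exists m0.
  case: (ex_maxnP exm bound) => n nd nmax; have [_ c0 dense] := hdc n.
  exists (dc n).2; split=> // _ m md A A0 hA.
  apply: dense_on_progression_le (inv_le _ _ (nmax m md)) (dense A A0 _).
  by apply: small_sums_le hA; move: nd; rewrite le_min => /andP[].
have [c hc] := boolp.choice uniform.
exists c; split=> [delta _|eps eps0]; first by case: (hc delta).
have [k k0 hk] := exists_nat_ge eps^-1.
have k_eps : k.+1%:R^-1 <= eps.
  rewrite -[eps]invrK lef_pV2 ?posrE ?invr_gt0 ?ltr0n //.
  by apply: le_trans hk _; rewrite ler_nat.
exists (d k); first by rewrite lt_min inv0 andbT; case: (hdc k).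
move=> delta delta0 delta_le A A0.
have dense : small_sums delta A -> dense_on_progression (c delta) eps A.
  case: (hc delta) => _ h hA; apply: dense_on_progression_le k_eps _.
  exact: (h delta0 k delta_le A A0 hA).
by split=> h; apply: dense; [left|right].
Qed.
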